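(* For every integer $r\ge 1$, the function $\xi(s_1,\ldots,s_r)$ (defined in the context for $\mathrm{Re}(s_i)$ sufficiently large) extends to a meromorphic function on $\mathbb{C}^r$, and satisfies the functional equation $$\xi(s_1,\ldots,s_r)=\xi(1-s_r,\ldots,1-s_1)$$ and, for all $p,q\ge 1$, the shuffle product identities $$\xi(s_1,\ldots,s_p)\,\xi(s_{p+1},\ldots,s_{p+q})=\sum_{\sigma\in\Sigma_{p,q}}\xi(s_{\sigma(1)},\ldots,s_{\sigma(p+q)}).$$ It has simple poles along the hyperplanes $$s_1+\cdots+s_k=k,\qquad s_k+\cdots+s_r=0\qquad\text{for all }1\le k\le r,$$ and its residues have the recursive structure $$\mathrm{Res}_{s_k+\cdots+s_r=0}\ \xi(s_1,\ldots,s_r)=(-1)^{r-k+1}\,\frac{\xi(s_1,\ldots,s_{k-1})}{(s_{k+1}+\cdots+s_r)\cdots(s_{r-1}+s_r)\,s_r}\qquad(1\le k\le r).$$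
   Context: Iterated integrals: for one-forms $\omega_i=g_i(t)\,dt$ on $(0,\infty)$, $\int_a^b\omega_1\cdots\omega_n=\int_{a\le t_1\le\cdots\le t_n\le b}g_1(t_1)\cdots g_n(t_n)\,dt_1\cdots dt_n$, extended linearly to linear combinations of words in one-forms; the empty word integrates to $1$. Let $\theta_{\mathbb{Q}}(t)=\sum_{n\in\mathbb{Z}}e^{-\pi n^2t^2}$ for $t>0$, and write $\theta_{\mathbb{Q}}=\theta^\infty+\theta^0$ with $\theta^\infty(t)=1$ and $\theta^0(t)=2\sum_{n\ge1}e^{-\pi n^2t^2}$. For $s_1,\ldots,s_r\in\mathbb{C}$ put $\underline{\theta}_i=\theta_{\mathbb{Q}}(t)t^{s_i-1}dt$, $\underline{\theta}_i^{\infty}=t^{s_i-1}dt$, $\underline{\theta}_i^0=\theta^0(t)t^{s_i-1}dt$. Define the regularisation $$\mathcal{R}(\underline{\theta}_1\cdots\underline{\theta}_r)=\sum_{i=1}^r(-1)^{r-i}\Big((\underline{\theta}_1\underline{\theta}_2\cdots\underline{\theta}_{i-1})\ \sqcup\!\sqcup\ (\underline{\theta}_r^\infty\underline{\theta}_{r-1}^\infty\cdots\underline{\theta}_{i+1}^\infty)\Big)\cdot\underline{\theta}_i^0,$$ where $\sqcup\!\sqcup$ is the shuffle product of words and $\cdot$ is concatenation. The multiple Riemann $\xi$-function is defined, for $\mathrm{Re}(s_i)$ sufficiently large (where the integral converges), by $$\xi(s_1,\ldots,s_r)=\int_0^\infty\mathcal{R}(\underline{\theta}_1\cdots\underline{\theta}_r).$$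 For $r=1$ it is the classical $\xi(s)=\pi^{-s/2}\Gamma(s/2)\zeta(s)$; for $r=0$ it equals $1$. $\Sigma_{p,q}$ is the set of $(p,q)$-shuffles: permutations $\sigma$ of $\{1,\ldots,p+q\}$ such that in the sequence $\sigma(1),\ldots,\sigma(p+q)$ the numbers $1,\ldots,p$ appear in increasing order and the numbers $p+1,\ldots,p+q$ appear in increasing order. The residue along $s_k+\cdots+s_r=0$ is the restriction to this hyperplane of $(s_k+\cdots+s_r)\,\xi(s_1,\ldots,s_r)$. In the residue formula the denominator is $\prod_{j=k+1}^{r}(s_j+\cdots+s_r)$ (equal to $1$ when $k=r$). *)

(* Defs.v *)
From HB Require Import structures.
From mathcomp Require Import all_boot all_order all_algebra all_fingroup.
From mathcomp Require Import all_classical all_reals all_analysis.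
From mathcomp Require Import complex.

Set Implicit Arguments.
Unset Strict Implicit.
Unset Printing Implicit Defensive.

Import Order.TTheory GRing.Theory Num.Theory.
Import numFieldNormedType.Exports.

Local Open Scope classical_set_scope.
Local Open Scope ring_scope.
Local Open Scope complex_scope.

HB.instance Definition _ (R : rcfType) := NormedModule.copy R[i] (R[i]^o).

Section LebesgueTuple.
Context {R : realType}.
Local Notation T := (measurableTypeR R).

Definition tuple_cons n (p : T * n.-tuple T) : n.+1.-tuple T :=
  [the n.+1.-tuple T of p.1 :: p.2].

Definition lebesgue_prod n (m : set (n.-tuple T) -> \bar R) :
    set (n.+1.-tuple T) -> \bar R :=
  pushforward (@lebesgue_measure R \x m)%E (@tuple_cons n).

Section lebesgue_prod_measure.
Variables (n : nat) (m : {sigma_finite_measure set (n.-tuple T) -> \bar R}).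

Let measurable_tuple_cons : measurable_fun [set: T * n.-tuple T] (@tuple_cons n).
Proof. by apply: (@measurable_cons _ _ _ _ fst n snd). Qed.

Let lebesgue_prod0 : lebesgue_prod m set0 = 0%E.
Proof. by rewrite /lebesgue_prod /pushforward preimage_set0 measure0. Qed.

Let lebesgue_prod_ge0 A : (0 <= lebesgue_prod m A)%E.
Proof. exact: measure_ge0. Qed.

Let lebesgue_prod_sigma_additive : semi_sigma_additive (lebesgue_prod m).
Proof.
move=> F mF tF mUF; rewrite /lebesgue_prod /pushforward preimage_bigcup.
apply: measure_semi_sigma_additive.
- by move=> i; rewrite -[X in measurable X]setTI; exact: measurable_tuple_cons.
- apply/trivIsetP => /= i j _ _ ij; rewrite -preimage_setI.
  by move/trivIsetP : tF => /(_ _ _ _ _ ij) ->//; rewrite preimage_set0.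
- by rewrite -preimage_bigcup -[X in measurable X]setTI;
    exact: measurable_tuple_cons.
Qed.

HB.instance Definition _ := isMeasure.Build _ _ _ (lebesgue_prod m)
  lebesgue_prod0 lebesgue_prod_ge0 lebesgue_prod_sigma_additive.

Let lebesgue_prod_sigma_finite : sigma_finite setT (lebesgue_prod m).
Proof.
have /sigma_finiteP[F [FT ndF Foo]] := sigma_finiteT (@lebesgue_measure R).
have /sigma_finiteP[G [GT ndG Goo]] := sigma_finiteT m.
pose g (v : n.+1.-tuple T) : T * n.-tuple T :=
  (tnth v ord0, [tuple of behead v]).
have mg : measurable_fun setT g.
  apply/measurable_fun_pairP; split => /=.
    exact: measurable_tnth.
  exact: measurable_behead.
have consK : cancel (@tuple_cons n) g.
  by case=> x v; congr pair; apply: val_inj.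
exists (fun i => g @^-1` (F i `*` G i)).
  rewrite -preimage_bigcup -[LHS](preimage_setT g); congr (g @^-1` _).
  rewrite -setXTT FT GT predeqE => -[x y]; split.
    move=> [/= [i _ Fix] [k _ Gky]]; exists (maxn i k) => //; split.
    - by move: x Fix; exact/subsetPset/ndF/leq_maxl.
    - by move: y Gky; exact/subsetPset/ndG/leq_maxr.
  by move=> [i _ []/= ? ?]; split; exists i.
move=> i; have [mF Fi] := Foo i; have [mG Gi] := Goo i; split.
  by rewrite -[X in measurable X]setTI; apply: mg => //; exact: measurableX.
rewrite /lebesgue_prod /pushforward -comp_preimage.
have -> : g \o @tuple_cons n = id by apply/funext => p /=; rewrite consK.
rewrite preimage_id product_measure1E// lte_mul_pinfty// ge0_fin_numE//.
Qed.

HB.instance Definition _ := Measure_isSigmaFinite.Build _ _ _ (lebesgue_prod m)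
  lebesgue_prod_sigma_finite.

End lebesgue_prod_measure.

Fixpoint lebesgue_tuple n : {sigma_finite_measure set (n.-tuple T) -> \bar R} :=
  match n with
  | 0 => \d_([tuple] : 0.-tuple T)
  | n'.+1 => lebesgue_prod (lebesgue_tuple n')
  end.

End LebesgueTuple.

Section Shuffle.
Variable T : Type.

Fixpoint shuffle (u v : seq T) : seq (seq T) :=
  let fix shuffle_u (v : seq T) :=
    match u, v with
    | [::], _ => [:: v]
    | _, [::] => [:: u]
    | a :: u', b :: v' =>
        [seq a :: w | w <- shuffle u' v] ++ [seq b :: w | w <- shuffle_u v']
    end in
  shuffle_u v.

End Shuffle.

Section IteratedIntegrals.
Context {R : realType}.
Local Notation T := (measurableTypeR R).
Local Notation C := R[i].

Definition Cintegrable d (X : measurableType d)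
    (mu : {measure set X -> \bar R}) (D : set X) (f : X -> C) : Prop :=
  mu.-integrable D (fun x => (complex.Re (f x))%:E) /\
  mu.-integrable D (fun x => (complex.Im (f x))%:E).

Definition Cintegral d (X : measurableType d)
    (mu : {measure set X -> \bar R}) (D : set X) (f : X -> C) : C :=
  (\int[mu]_(x in D) complex.Re (f x)) +i* (\int[mu]_(x in D) complex.Im (f x)).

(* The one-form g(t) dt on ]0, +oo[ is represented by its density g, and a word
   in one-forms by the sequence of the densities of its letters; a list of
   weighted words stands for a formal linear combination. *)
Definition word := seq (R -> C).

Definition words := seq (C * word).

(* the region 0 <= t_1 <= ... <= t_n <= +oo; the forms only live on ]0, +oo[ *)
Definition simplex n : set (n.-tuple T) :=
  [set t : n.-tuple T |
    sorted (fun x y : R => x <= y) t /\ forall i, (0 : R) < tnth t i].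

Definition word_density (w : word) (t : (size w).-tuple T) : C :=
  \prod_(i < size w) nth (fun=> 0) w i (tnth t i).

Definition iint_cvg (L : words) : Prop :=
  forall i, (i < size L)%N ->
    let w := (nth (0, [::]) L i).2 in
    Cintegrable (lebesgue_tuple (size w)) (@simplex (size w)) (@word_density w).

Definition iint (L : words) : C :=
  \sum_(cw <- L)
    cw.1 * Cintegral (lebesgue_tuple (size cw.2)) (@simplex (size cw.2))
             (@word_density cw.2).

End IteratedIntegrals.

Section Xi.
Context {R : realType}.
Local Notation C := R[i].

Definition gauss (n : int) (t : R) : R := expR (- (pi * n%:~R ^+ 2 * t ^+ 2)).

Definition theta (t : R) : R :=
  fine (\esum_(n in [set: int]) (gauss n t)%:E).

Definition theta_infty (t : R) : R := 1.

Definition theta_zero (t : R) : R :=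
  2 * fine (\sum_(1 <= n <oo) (gauss n%:Z t)%:E).

(* t ^ z = exp (z ln t), meant for t > 0 *)
Definition cpow (t : R) (z : C) : C :=
  (expR (complex.Re z * ln t))%:C *
  (cos (complex.Im z * ln t) +i* sin (complex.Im z * ln t)).

(* the density of phi(t) t^(z-1) dt *)
Definition mellin_form (phi : R -> R) (z : C) : R -> C :=
  fun t => (phi t)%:C * cpow t (z - 1).

(* Indices are shifted: i : 'I_r stands for i + 1, whence the sign
   (-1)^(r - (i + 1)). *)
Definition regularisation r (s : 'rV[C]_r) : words :=
  flatten [seq
    [seq ((-1) ^+ (r - i.+1), rcons w (mellin_form theta_zero (s ord0 i)))
    | w <- shuffle
        [seq mellin_form theta (s ord0 j) | j : 'I_r <- enum 'I_r & (j < i)%N]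
        (rev [seq mellin_form theta_infty (s ord0 j)
             | j : 'I_r <- enum 'I_r & (i < j)%N])]
  | i : 'I_r <- enum 'I_r].

End Xi.

Section Meromorphic.
Context {R : realType}.
Local Notation C := R[i].

(* differentiable is taken over the field R[i], that is, in the complex sense *)
Definition holomorphic_on n (U : set 'rV[C]_n) (f : 'rV[C]_n -> C) : Prop :=
  forall z, U z -> differentiable f z.

(* A meromorphic function is represented by a total function, which is locally
   a quotient g / h and whose values on the zeros of h are irrelevant. *)
Definition meromorphic n (f : 'rV[C]_n -> C) : Prop :=
  forall z, exists U : set 'rV[C]_n, exists g h : 'rV[C]_n -> C,
    [/\ open U /\ U z, holomorphic_on U g, holomorphic_on U h,
        forall V : set 'rV[C]_n, open V -> V `<=` U -> V !=set0 ->
          exists2 w, V w & h w != 0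
      & forall w, U w -> h w != 0 -> f w = g w / h w].

(* For pairwise distinct hyperplanes l i = 0: the function f is holomorphic
   off their union and has a pole of order exactly one along each of them. *)
Definition simple_poles_along n (I : finType) (l : I -> 'rV[C]_n -> C)
    (f : 'rV[C]_n -> C) : Prop :=
  exists F : 'rV[C]_n -> C,
    [/\ holomorphic_on setT F,
        forall s, (forall i, l i s != 0) -> f s = F s / \prod_i l i s
      & forall i, exists2 s, l i s = 0 & F s != 0].

(* v is the value at the point s of the hyperplane l = 0 of the restriction to
   this hyperplane of l * f, which is extended by continuity across it. *)
Definition residue_at n (l f : 'rV[C]_n -> C) (s : 'rV[C]_n) (v : C) : Prop :=
  l w * f w @[w --> within [set w | l w != 0] (nbhs s)] --> v.

(* s_1 + ... + s_(k+1) - (k + 1) and s_(k+1) + ... + s_r, since k : 'I_r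
   starts from 0 *)
Definition head_form r (k : 'I_r) (s : 'rV[C]_r) : C :=
  \sum_(j < r | (j <= k)%N) s ord0 j - k.+1%:R.

Definition tail_form r (k : 'I_r) (s : 'rV[C]_r) : C :=
  \sum_(j < r | (k <= j)%N) s ord0 j.

Definition polar_form r (k : 'I_r + 'I_r) : 'rV[C]_r -> C :=
  match k with inl k => head_form k | inr k => tail_form k end.

Definition off_poles r (s : 'rV[C]_r) : Prop :=
  forall k, polar_form k s != 0.

End Meromorphic.

(* Two values sigma i and sigma j lie in the same block when they are both < p or
   both >= p; each block appears in increasing order among the sigma i. *)
Definition shuffle_perms p q : {set 'S_(p + q)} :=
  [set sigma : 'S_(p + q) |
    [forall i : 'I_(p + q), forall j : 'I_(p + q),
      (i < j)%N && ((sigma i < p)%N == (sigma j < p)%N)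
        ==> (sigma i < sigma j)%N]]%SET.

(* Main.v *)
Require Import Defs.
From HB Require Import structures.
From mathcomp Require Import all_boot all_order all_algebra all_fingroup.
From mathcomp Require Import all_classical all_reals all_analysis.
From mathcomp Require Import measurable_realfun complex ring lra zify.

Set Implicit Arguments.
Unset Strict Implicit.
Unset Printing Implicit Defensive.

Import Order.TTheory GRing.Theory Num.Theory.
Import numFieldNormedType.Exports.
Import ComplexField.Normc.

Local Open Scope classical_set_scope.
Local Open Scope ring_scope.
Local Open Scope complex_scope.

(** The proof follows Chen's calculus of iterated integrals. A function on words
   of exponents is thought of as the iterated integral of the forms
   [theta t ^ (s_i - 1) dt], or of their constant parts, along some path. Paths
   compose by the convolution [conv], which sums over all the ways of cutting a
   word in two; differentiating at an end of the path peels off the first or the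
   last letter ([Lop], [Rop]), and these operators commute with the convolution.

   The regularised word integrates from [x] to infinity to [regint x u], and
   telescoping gives its derivative: minus the form of [theta] on the first letter,
   plus the form of the constant term on the last one ([cderiv_regint]).
   The second summand is cancelled by composing with the path that comes back along
   the constant term of [theta], where integrals are the explicit monomials [powint].
   The result [theta_tail x] obeys the differential equation of an iterated integral
   of [theta]-forms from [x] to a tangential base point at infinity, so it can be
   cut at 1. By the functional equation of [theta] ([theta_inv]), the part from [x]
   to 1 is an integral from 1 to [1 / x] of the forms with exponents
   [1 - s_r, ..., 1 - s_1] ([theta_tail_split]). When [x] tends to 0 both parts
   converge, and for real parts at least 2 this gives ([regint0E])
     [xi = conv (fun w => theta_tail 1 (mirror w)) (theta_tail 1)],
   which is taken as the definition of xi everywhere.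

   In this form the functional equation is a symmetry of the convolution
   ([xi_functional]). As [theta_tail 1] is the convolution of [regint 1], an entire
   function of the exponents, with the rational function [tail_coef], whose
   denominators are the sums [s_j + ... + s_r], xi is a finite sum of entire functions
   divided by explicit products of linear forms ([xi_expand]); the poles and the
   residues are read off from it ([xi_numerator], [residue_value]). For the shuffle
   identity, [regint x] is multiplicative on shuffles since both members have the
   same derivative and vanish at infinity ([regint_shmul]), [tail_coef] is
   multiplicative by partial fractions ([tail_coef_shmul]), and convolutions of
   multiplicative functions are multiplicative ([shmul_conv]).

   Two analytic points carry the rest. The functional equation of [theta] is obtained
   as the limit of an identity between binomial coefficients, following Polya
   ([polya_identity], [polya_limit]). Holomorphy is proved by second order expansions
   in the exponents, with remainders that are uniform enough in [t] to be integrated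
   ([decaying_jet], [differentiable_jet]). *)

(** * Dominated convergence for series *)
Section Tannery.
Variable R : realType.
Implicit Types u v M : nat -> R.

Definition nnsum u : R := fine (\sum_(0 <= n <oo) (u n)%:E)%E.

Definition nnsummable u := (\sum_(0 <= n <oo) (u n)%:E < +oo)%E.

Lemma nnsummable_le u M : (forall n, 0 <= u n <= M n) ->
  nnsummable M -> nnsummable u.
Proof.
move=> uM; rewrite /nnsummable; apply: le_lt_trans.
apply: lee_nneseries => n *; rewrite lee_fin; by case/andP: (uM n).
Qed.

Lemma nnsum_fin u : (forall n, 0 <= u n) -> nnsummable u ->
  (\sum_(0 <= n <oo) (u n)%:E)%E = (nnsum u)%:E.
Proof.
move=> u0 su; rewrite fineK// ge0_fin_numE// nneseries_ge0// => n _ _.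
by rewrite lee_fin.
Qed.

Definition nntail u N : R := fine (\sum_(N <= n <oo) (u n)%:E)%E.

Lemma nnsum_split u N : (forall n, 0 <= u n) -> nnsummable u ->
  nnsum u = \sum_(0 <= n < N) u n + nntail u N.
Proof.
move=> u0 su; rewrite /nnsum (nneseries_split 0 N); last first.
  by move=> k k1; rewrite lee_fin u0.
rewrite add0n fineD ?sumEFin//.
rewrite ge0_fin_numE; last by apply: nneseries_ge0 => n nN _; rewrite lee_fin.
apply: le_lt_trans su; rewrite (nneseries_split 0 N) ?add0n; last first.
  by move=> k k1; rewrite lee_fin u0.
by rewrite leeDr// sumEFin lee_fin; apply: sumr_ge0.
Qed.

Lemma nntail_ge0 u N : (forall n, 0 <= u n) -> 0 <= nntail u N.
Proof. by move=> u0; apply/fine_ge0/nneseries_ge0 => n *; rewrite lee_fin. Qed.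

Lemma le_nntail u M N : (forall n, 0 <= u n <= M n) -> nnsummable M ->
  nntail u N <= nntail M N.
Proof.
move=> uM sM; have su := nnsummable_le uM sM.
have u0 n : 0 <= u n by case/andP: (uM n).
have M0 n : 0 <= M n by apply: le_trans (u0 n) _; case/andP: (uM n).
have fin v : (forall n, 0 <= v n) -> nnsummable v -> (\sum_(N <= n <oo) (v n)%:E)%E \is a fin_num.
  move=> v0 sv; rewrite ge0_fin_numE; last by apply: nneseries_ge0 => n nN _; rewrite lee_fin.
  apply: le_lt_trans sv; rewrite (nneseries_split 0 N) ?add0n; last first.
    by move=> k k1; rewrite lee_fin v0.
  by rewrite leeDr// sumEFin lee_fin; apply: sumr_ge0.
apply: fine_le; rewrite ?fin//.
by apply: lee_nneseries => n *; rewrite lee_fin; case/andP: (uM n).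
Qed.

Lemma cvg_nntail u : (forall n, 0 <= u n) -> nnsummable u ->
  nntail u N @[N --> \oo] --> 0.
Proof.
move=> u0 su; have := @nneseries_tail_cvg R (fun n => (u n)%:E) xpredT su.
move=> /(_ (fun k _ => _ : (0 <= (u k)%:E)%E)) H.
have {}H : (\sum_(N <= k <oo) (u k)%:E)%E @[N --> \oo] --> 0%:E.
  by apply: H => k; rewrite lee_fin.
exact: (fine_cvg H).
Qed.

Lemma nnsum_le u B : (forall n, 0 <= u n) ->
  (forall N, \sum_(0 <= n < N) u n <= B) -> nnsummable u /\ nnsum u <= B.
Proof.
move=> u0 uB.
have L : (\sum_(0 <= n <oo) (u n)%:E <= B%:E)%E.
  apply: lime_le; first by apply: is_cvg_nneseries => n *; rewrite lee_fin.
  by apply: nearW => n; rewrite sumEFin lee_fin.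
have su : nnsummable u by apply: le_lt_trans L _; rewrite ltry.
by split => //; rewrite -lee_fin -nnsum_fin.
Qed.

Lemma nnsum_ge u N : (forall n, 0 <= u n) -> nnsummable u ->
  \sum_(0 <= n < N) u n <= nnsum u.
Proof.
by move=> u0 su; rewrite (nnsum_split N u0 su) lerDl nntail_ge0.
Qed.

Lemma geometric_nnsummable (C q : R) : 0 <= C -> 0 <= q < 1 ->
  nnsummable (fun n => C * q ^+ n) /\ nnsum (fun n => C * q ^+ n) <= C / (1 - q).
Proof.
move=> C0 /andP[q0 q1]; apply: nnsum_le => [n|N].
  by rewrite mulr_ge0// exprn_ge0.
have := @geometric_seriesE R C q; rewrite (lt_eqF q1) => /(_ isT).
move=> /(congr1 (fun f => f N)); rewrite /series/= => ->.
rewrite ler_pM2r ?invr_gt0 ?subr_gt0// ler_piMr//.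
by rewrite lerBlDr lerDl exprn_ge0.
Qed.

Lemma cvg_sum_nat (T : Type) (F : set_system T) {FF : Filter F} (N : nat)
    (f : T -> nat -> R) (g : nat -> R) :
  (forall n, f x n @[x --> F] --> g n) ->
  \sum_(0 <= n < N) f x n @[x --> F] --> \sum_(0 <= n < N) g n.
Proof.
move=> fg; elim: N => [|N IH].
  by rewrite big_nil; under eq_fun do rewrite big_nil; exact: cvg_cst.
rewrite big_nat_recr//=; under eq_fun do rewrite big_nat_recr//=.
exact: cvgD.
Qed.

(** A uniform summable majorant reduces the convergence of the sums to that of finitely
   many terms: the tails are all bounded by the tail of [M]. *)
Lemma tannery (T : Type) (F : set_system T) {FF : ProperFilter F} (f : T -> nat -> R)
    (g : nat -> R) M :
  (forall n, f x n @[x --> F] --> g n) ->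
  (\forall x \near F, forall n, 0 <= f x n <= M n) ->
  nnsummable M -> nnsum (f x) @[x --> F] --> nnsum g.
Proof.
move=> fg fM sM.
have gM n : 0 <= g n <= M n.
  apply/andP; split.
    by apply: (cvgr_to_ge (fg n)); near=> x; have /andP[]: 0 <= f x n <= M n by near: x; apply: filterS fM.
  by apply: (cvgr_to_le (fg n)); near=> x; have /andP[]: 0 <= f x n <= M n by near: x; apply: filterS fM.
have M0 n : 0 <= M n by case/andP: (gM n) => /le_trans; apply.
apply/cvgrPdist_le => e e0.
have [N _ HN] : \forall N \near \oo, nntail M N <= e / 3.
  have /cvgrPdist_le/(_ (e / 3)) := cvg_nntail M0 sM.
  rewrite divr_gt0// => /(_ isT); apply: filterS => N.
  by rewrite sub0r normrN ger0_norm ?nntail_ge0.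
have {HN}HN := HN N (leqnn _).
have /cvgrPdist_le/(_ (e / 3)) : \sum_(0 <= n < N) f x n @[x --> F] --> \sum_(0 <= n < N) g n.
  exact: cvg_sum_nat.
rewrite divr_gt0// => /(_ isT) H.
near=> x.
have fxM : forall n, 0 <= f x n <= M n by near: x.
have fx0 n : 0 <= f x n by case/andP: (fxM n).
have g0 n : 0 <= g n by case/andP: (gM n).
rewrite (nnsum_split N fx0 (nnsummable_le fxM sM)) (nnsum_split N g0 (nnsummable_le gM sM)).
have := le_nntail N fxM sM; have := le_nntail N gM sM.
have := nntail_ge0 N fx0; have := nntail_ge0 N g0.
have : `|\sum_(0 <= n < N) g n - \sum_(0 <= n < N) f x n| <= e / 3 by near: x.
rewrite !ler_norml => /andP[? ?] *; apply/andP; split; lra.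
Unshelve. all: by end_near.
Qed.

Lemma nnsum_finite u N : (forall n, 0 <= u n) -> (forall n, (N <= n)%N -> u n = 0) ->
  nnsum u = \sum_(0 <= n < N) u n.
Proof.
move=> u0 uN.
have tail : (\sum_(N <= n <oo) (u n)%:E)%E = 0%E.
  by apply: eseries0 => n nN _; rewrite uN.
rewrite /nnsum (nneseries_split 0 N); last by move=> k _; rewrite lee_fin.
by rewrite add0n tail adde0 sumEFin.
Qed.

End Tannery.

(** * The theta series *)
Section ThetaSeries.
Variable R : realType.
Implicit Types t x : R.

Lemma gaussE (n : nat) t : gauss n%:Z t = expR (- (pi * t ^+ 2) * n%:R ^+ 2).
Proof. by rewrite /gauss mulrAC mulNr. Qed.

Lemma gauss_ge0 (n : int) t : 0 <= gauss n t. Proof. exact: expR_ge0. Qed.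

Definition jacobi0 x : R := nnsum (fun n => expR (- x * n.+1%:R ^+ 2)).
Definition jacobi x : R := 1 + 2 * jacobi0 x.

Lemma expR_sq_le x y n : 0 <= y <= x ->
  0 <= expR (- x * n.+1%:R ^+ 2) <= expR (- y) * expR (- y) ^+ n.
Proof.
move=> /andP[y0 yx]; rewrite expR_ge0/= -exprS -expRM_natl ler_expR.
rewrite mulrN mulNr lerN2 mulrC ler_pM//.
by rewrite -natrX ler_nat -mulnn leq_pmull.
Qed.

Lemma expRN_itv x : 0 < x -> 0 <= expR (- x) < 1.
Proof. by move=> x0; rewrite expR_ge0 expR_lt1 oppr_lt0. Qed.

Lemma jacobi_nnsummable x : 0 < x -> nnsummable (fun n => expR (- x * n.+1%:R ^+ 2)).
Proof.
move=> x0; apply: (@nnsummable_le _ _ (fun n => expR (- x) * expR (- x) ^+ n)).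
  by move=> n; apply: expR_sq_le; rewrite lexx ltW.
by have [] := geometric_nnsummable (expR_ge0 (- x)) (expRN_itv x0).
Qed.

Lemma jacobi0_ge0 x : 0 <= jacobi0 x.
Proof. by apply/fine_ge0/nneseries_ge0 => n *; rewrite lee_fin expR_ge0. Qed.

Lemma jacobi0_le x : 0 < x -> jacobi0 x <= expR (- x) / (1 - expR (- x)).
Proof.
move=> x0; have [s le] := geometric_nnsummable (expR_ge0 (- x)) (expRN_itv x0).
apply: le_trans le; apply: (nnsum_le _ _).2 => n; first by rewrite expR_ge0.
apply: le_trans (nnsum_ge n _ s) => [|k]; last by rewrite mulr_ge0 ?exprn_ge0 ?expR_ge0.
apply: ler_sum => i _; have := @expR_sq_le x x i.
by rewrite lexx ltW// => /(_ isT) /andP[].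
Qed.

Lemma continuous_jacobi0 x : 0 < x -> {for x, continuous jacobi0}.
Proof.
move=> x0.
have x20 : 0 < x / 2 by rewrite divr_gt0.
suff H : jacobi0 z @[z --> x] --> jacobi0 x by exact: H.
apply: (@tannery R R (nbhs x) _ (fun z n => expR (- z * n.+1%:R ^+ 2)) _
  (fun n => expR (- (x / 2)) * expR (- (x / 2)) ^+ n)).
- move=> n; have H : (- z * n.+1%:R ^+ 2) @[z --> x] --> - x * n.+1%:R ^+ 2.
    by apply: cvgM; [apply: cvgN; exact: cvg_id|exact: cvg_cst].
  exact: (cvg_comp _ _ H (@continuous_expR R _)).
- near=> z => n; apply: expR_sq_le; rewrite ltW//=.
  near: z; apply: filterS (lt_nbhsr (_ : x / 2 < x)) => [z /ltW//|].
  by rewrite ltr_pdivrMr// mulr_natr mulr2n ltrDl.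
- by have [] := geometric_nnsummable (expR_ge0 (- (x / 2))) (expRN_itv x20).
Unshelve. all: by end_near.
Qed.

Lemma theta_zeroE t : theta_zero t = 2 * jacobi0 (pi * t ^+ 2).
Proof.
rewrite /theta_zero; congr (_ * fine _).
rewrite -(@nneseries_addn _ (fun n => (gauss n%:Z t)%:E) 1); last first.
  by move=> n; rewrite lee_fin gauss_ge0.
by apply: eq_eseriesr => n _; rewrite addn1 gaussE.
Qed.

Lemma thetaE t : 0 < t -> theta t = jacobi (pi * t ^+ 2).
Proof.
move=> t0.
have x0 : 0 < pi * t ^+ 2 by rewrite mulr_gt0 ?pi_gt0 ?exprn_gt0.
have sf := nnsum_fin (fun n => expR_ge0 _) (jacobi_nnsummable x0).
have pos (T : choiceType) (A : set T) (i : T -> int) j : A j ->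
  (0 <= (gauss (i j) t)%:E)%E by rewrite lee_fin gauss_ge0.
rewrite /theta (@esumID _ _ (range Posz))//; last first.
  by move=> n _; rewrite lee_fin gauss_ge0.
rewrite !setTI.
rewrite (@reindex_esum _ _ _ [set: nat] _ Posz); last first.
  by split; [move=> n _; exists n|move=> m n _ _ []|move=> m].
rewrite (@reindex_esum _ _ _ [set: nat] _ Negz); last first.
  split; [by move=> n _ [m _]|by move=> m n _ _ []|].
  by move=> [n|n] h; [exfalso; apply: h; exists n|exists n].
rewrite -!nneseries_esumT; try by move=> n; rewrite lee_fin gauss_ge0.
rewrite [X in (_ + X)%E](@eq_eseriesr _ _ (fun n => (expR (- (pi * t ^+ 2) * n.+1%:R ^+ 2))%:E));
  last first.
  by move=> n _; rewrite -gaussE /gauss NegzE mulrNz sqrrN.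
rewrite (nneseries_split 0 1); last by move=> n _; rewrite lee_fin gauss_ge0.
rewrite add0n big_nat1.
rewrite -(@nneseries_addn _ (fun n => (gauss n%:Z t)%:E) 1); last first.
  by move=> n; rewrite lee_fin gauss_ge0.
rewrite [X in (_ + X + _)%E](@eq_eseriesr _ _ (fun n => (expR (- (pi * t ^+ 2) * n.+1%:R ^+ 2))%:E));
  last by move=> n _; rewrite addn1 gaussE.
rewrite sf -!EFinD /= gaussE mulr0n expr0n/= mulr0 expR0.
by rewrite /jacobi /jacobi0 mulr_natl mulr2n addrA.
Qed.

End ThetaSeries.

(** * Polya's identity between binomial coefficients and cosines *)
Section Cis.
Variable R : realType.
Implicit Types x y : R.

Definition cis x : R[i] := cos x +i* sin x.

Lemma cisD x y : cis (x + y) = cis x * cis y.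
Proof. by rewrite /cis cosD sinD; apply/eqP; rewrite eq_complex /= eqxx (addrC (sin x * _)) eqxx. Qed.

Lemma cis0 : cis 0 = 1.
Proof. by rewrite /cis cos0 sin0. Qed.

Lemma cisM x n : cis (n%:R * x) = cis x ^+ n.
Proof.
elim: n => [|n IH]; first by rewrite mul0r cis0 expr0.
by rewrite exprS -IH -cisD -natr1 mulrDl mul1r addrC.
Qed.

Lemma cisDN x : cis x + cis (- x) = (2 * cos x)%:C.
Proof.
by rewrite /cis cosN sinN; apply/eqP; rewrite eq_complex/= subrr eqxx mulr_natl mulr2n eqxx.
Qed.

Lemma cis2pi : cis (2 * pi) = 1.
Proof. by rewrite /cis mulr_natl cos2pi sin2pi. Qed.

Lemma cis_neq1 x : 0 < x < pi -> cis (2 * x) != 1.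
Proof.
move=> /sin_gt0_pi sx; apply/negP => /eqP [].
rewrite mulr_natl mulr2n cosD => h _.
have := cos2Dsin2 x; nra.
Qed.

End Cis.

Section CircularBinomialSums.
Variable R : realType.
Implicit Types (l m d : nat).

Lemma Re_sum (I : Type) (r : seq I) (P : pred I) (F : I -> R[i]) :
  complex.Re (\sum_(i <- r | P i) F i) = \sum_(i <- r | P i) complex.Re (F i).
Proof. by elim/big_rec2: _ => [//|i x y _ <-]; case: (F i) y => [a b] [c e]. Qed.

Lemma sum_cis_roots l d : (0 < l)%N ->
  \sum_(k < l) cis (2 * (k%:R * d%:R * pi / l%:R)) = (if (l %| d)%N then l%:R else 0) :> R[i].
Proof.
move=> l0; have l0R : l%:R != 0 :> R by rewrite pnatr_eq0 -lt0n.
pose w : R[i] := cis (2 * (d%:R * pi / l%:R)).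
have -> : \sum_(k < l) cis (2 * (k%:R * d%:R * pi / l%:R)) = \sum_(k < l) w ^+ k.
  by apply: eq_bigr => k _; rewrite -cisM; congr cis; field.
have wl n : cis (2 * (n * l)%:R * pi / l%:R) = 1 :> R[i].
  rewrite (_ : _ * _ / _ = n%:R * (2 * pi)); last by rewrite natrM; field.
  by rewrite cisM cis2pi expr1n.
case: ifPn => ld.
  suff -> : w = 1 by rewrite (eq_bigr (fun=> 1)) ?sumr_const ?card_ord // => k _; rewrite expr1n.
  by rewrite -(wl (d %/ l)%N) divnK// /w; congr cis; field.
have w1 : w != 1.
  have -> : w = cis (2 * ((d %% l)%:R * pi / l%:R)).
    rewrite -[RHS]mul1r -(wl (d %/ l)%N) -cisD /w; congr cis.
    by rewrite {1}(divn_eq d l) natrD; field.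
  apply: cis_neq1; apply/andP; split.
    by rewrite divr_gt0 ?mulr_gt0 ?pi_gt0 ?ltr0n// lt0n.
  rewrite ltr_pdivrMr ?ltr0n// mulrC ltr_pM2l ?pi_gt0// ltr_nat ltn_mod//.
apply/eqP; rewrite -(mulrI_eq0 _ (mulfI _ : GRing.lreg (1 - w))) ?subr_eq0 1?eq_sym//.
rewrite -[X in 1 - X]mul1r.
have -> : (1 - 1 * w) * \sum_(k < l) w ^+ k = 1 - w ^+ l.
  rewrite mul1r -(expr1n _ l) subrXX expr1n; congr (_ * _).
  by apply: eq_bigr => i _; rewrite expr1n mul1r.
rewrite /w -cisM eq_sym subr_eq0 eq_sym -(wl d); apply/eqP; congr cis.
by rewrite natrM; field.
Qed.

Lemma sum_cos_roots l d : (0 < l)%N ->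
  \sum_(k < l) cos (2 * (k%:R * d%:R * pi / l%:R)) = (if (l %| d)%N then l%:R else 0) :> R.
Proof.
move=> l0; have := congr1 (@complex.Re R) (sum_cis_roots d l0).
rewrite Re_sum => ->; case: ifP => // _.
by rewrite -(rmorph_nat (real_complex R)).
Qed.

Lemma cos_powE m (x : R) :
  (2 * cos x) ^+ (2 * m) = \sum_(i < (2 * m).+1) 'C(2 * m, i)%:R * cos (2 * (m%:R - i%:R) * x).
Proof.
have := congr1 (@complex.Re R) (congr1 (fun z => z ^+ (2 * m)) (cisDN x)).
rewrite -rmorphXn exprDn Re_sum => E; apply: etrans (esym E) _; apply: eq_bigr => i _.
rewrite -!cisM -cisD (_ : _ + _ = 2 * (m%:R - i%:R) * x); last first.
  rewrite natrB; last by rewrite -ltnS.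
  by rewrite natrM; ring.
by rewrite /cis -mulr_natl -[LHS]/(complex.Re _) -(rmorph_nat (real_complex R)) /= mul0r subr0.
Qed.

(** Both sides count the closed lazy walks with [m] steps on a cycle of length [l]:
   by the eigenvalues [(2 cos (k pi / l)) ^ 2] of the step matrix on the left, by the
   starting point and the total displacement on the right. *)
Lemma sum_cos_pow l m : (0 < l)%N ->
  \sum_(k < l) (2 * cos (k%:R * pi / l%:R : R)) ^+ (2 * m) =
  l%:R * ('C(2 * m, m)%:R + 2 * \sum_(0 <= d < m) (l %| d.+1)%N%:R * 'C(2 * m, m + d.+1)%:R).
Proof.
move=> l0; under eq_bigr do rewrite cos_powE.
rewrite exchange_big/= -(big_mkord xpredT (fun i => \sum_(k < l) 'C(2 * m, i)%:R * cos (2 * (m%:R - i%:R) * (k%:R * pi / l%:R)))).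
have E i d : (i + d = m \/ i = m + d)%N -> (\sum_(k < l) 'C(2 * m, i)%:R * cos (2 * (m%:R - i%:R) * (k%:R * pi / l%:R)) : R) =
   l%:R * ((l %| d)%N%:R * 'C(2 * m, m + d)%:R).
  move=> H; rewrite -mulr_sumr.
  have -> : 'C(2 * m, i) = 'C(2 * m, m + d).
    case: H => [H|-> //]; rewrite -bin_sub; last by lia.
    by congr 'C(_, _); lia.
  have -> : \sum_(k < l) cos (2 * (m%:R - i%:R) * (k%:R * pi / l%:R)) =
            \sum_(k < l) cos (2 * (k%:R * d%:R * pi / l%:R)) :> R.
    apply: eq_bigr => k _; case: H => H.
      by rewrite -H natrD; congr cos; ring.
    by rewrite H natrD -cosN; congr cos; ring.
  rewrite sum_cos_roots//; case: ifP => _; rewrite ?mul1r ?mul0r ?mulr0//.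
  by rewrite mulrC.
rewrite (@big_cat_nat _ _ _ m)/=; [|lia|lia].
rewrite [X in _ + X]big_nat_recl; last by lia.
rewrite (E m 0%N); last by left; rewrite addn0.
rewrite dvdn0 mul1r addn0 addrCA mulrDr; congr (_ + _).
have -> : (2 * m = m + m)%N by lia.
rewrite -{5}(add0n m) big_addn addnK.
rewrite big_nat_rev/= add0n mulrA mulr_sumr mulr_natr mulr2n.
rewrite [X in _ = X](_ : _ = \sum_(0 <= i < m) l%:R * ((l %| i.+1)%N%:R * 'C(2 * m, m + i.+1)%:R) + \sum_(0 <= i < m) l%:R * ((l %| i.+1)%N%:R * 'C(2 * m, m + i.+1)%:R)); last first.
  by rewrite -big_split/=; apply: eq_bigr => i _; rewrite (_ : m + m = 2 * m)%N; [ring|lia].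
congr (_ + _); rewrite big_nat [RHS]big_nat; apply: eq_bigr => i /andP[_ im].
  rewrite (_ : m + m = 2 * m)%N; last lia.
  by apply: E; left; lia.
rewrite (_ : m + m = 2 * m)%N; last lia.
by apply: E; right; lia.
Qed.

Lemma sum_dvd_nat (F : nat -> R) l q : (0 < l)%N ->
  \sum_(0 <= d < q * l) (l %| d.+1)%N%:R * F d.+1 = \sum_(0 <= j < q) F (j.+1 * l)%N.
Proof.
case: l => // l _; elim: q => [|q IH]; first by rewrite mul0n !big_nil.
rewrite [RHS]big_nat_recr//= -IH (@big_cat_nat _ _ _ (q * l.+1))/=; [|lia|nia].
congr (_ + _); rewrite mulSn -{1}(add0n (q * l.+1)%N) big_addn addnK big_nat_recr//=.
rewrite big_nat big1 ?add0r => [|i /andP[_ il]].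
  by rewrite -addSn -mulSn dvdn_mull// mul1r.
rewrite -addSn dvdn_addl ?dvdn_mull// gtnNdvd ?mul0r//; lia.
Qed.

Definition polya_bin l m (j : nat) : R := 'C(2 * m, m + j.+1 * l)%:R / 'C(2 * m, m)%:R.

Definition polya_cos (p m : nat) (k : nat) : R :=
  if (k < p)%N then cos (k.+1%:R * pi / (2 * p).+1%:R) ^+ (2 * m) else 0.

Definition polya_const l m : R := 4 ^+ m / ('C(2 * m, m)%:R * l%:R).

Lemma polya_cos_ge0 p m k : 0 <= polya_cos p m k.
Proof. by rewrite /polya_cos; case: ifP => // _; rewrite exprM exprn_ge0// sqr_ge0. Qed.

Lemma polya_bin_ge0 l m k : 0 <= polya_bin l m k.
Proof. by rewrite /polya_bin divr_ge0. Qed.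

Lemma central_bin_neq0 m : 'C(2 * m, m)%:R != 0 :> R.
Proof. by rewrite pnatr_eq0 -lt0n bin_gt0; lia. Qed.

(** Polya's finite version of the Poisson summation formula: when [m] grows like
   [(2 p + 1) ^ 2 / lam], the left side tends to the theta series at [lam] and the right
   side to the one at [pi ^ 2 / lam]. *)
Lemma polya_identity p m :
  1 + 2 * nnsum (polya_bin (2 * p).+1 m) =
  polya_const (2 * p).+1 m * (1 + 2 * nnsum (polya_cos p m)).
Proof.
set l := (2 * p).+1.
rewrite (@nnsum_finite _ _ m); [|exact: polya_bin_ge0|]; last first.
  by move=> n mn; rewrite /polya_bin bin_small ?mul0r// /l; nia.
rewrite (@nnsum_finite _ (polya_cos p m) p); [|exact: polya_cos_ge0|]; last first.
  by move=> n pn; rewrite /polya_cos ltnNge pn.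
have l0 : (0 < l)%N by [].
have := sum_cos_pow m l0.
have -> : \sum_(0 <= d < m) (l %| d.+1)%N%:R * 'C(2 * m, m + d.+1)%:R =
          \sum_(0 <= j < m) 'C(2 * m, m + j.+1 * l)%:R :> R.
  rewrite -(sum_dvd_nat (fun i => 'C(2 * m, m + i)%:R))// [RHS](@big_cat_nat _ _ _ m)/=; [|lia|nia].
  rewrite [X in _ = _ + X]big_nat [X in _ = _ + X]big1 ?addr0// => i /andP[mi _].
  by rewrite bin_small ?mulr0//; lia.
pose f k : R := (2 * cos (k%:R * pi / l%:R)) ^+ (2 * m).
have fE k : (k < p)%N -> f k.+1 = 4 ^+ m * polya_cos p m k.
  by move=> kp; rewrite /f /polya_cos kp exprMn exprM (_ : 2 ^+ 2 = 4) // -natrX.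
rewrite -(big_mkord xpredT f) big_nat_recl// {1}/f mul0r mul0r cos0 mulr1 exprM (_ : 2 ^+ 2 = 4 :> R) -?natrX//.
rewrite (@big_cat_nat _ _ _ p)/=; [|lia|lia].
have -> : \sum_(p <= i < 2 * p) f i.+1 = \sum_(0 <= i < p) f i.+1.
  rewrite -{1}(add0n p) (_ : 2 * p = p + p)%N; last by lia.
  rewrite big_addn addnK big_nat_rev/= add0n big_nat [RHS]big_nat.
  apply: eq_bigr => i /andP[_ ip].
  rewrite /f !exprM; congr (_ ^+ m); rewrite !exprMn; congr (_ * _).
  have -> : (p - i.+1 + p).+1 = (l - i.+1)%N by rewrite /l; lia.
  rewrite natrB ?mulrBl; last by rewrite /l; lia.
  rewrite (_ : l%:R * pi / l%:R = pi); last by rewrite mulrAC divff ?mul1r ?pnatr_eq0.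
  by rewrite addrC cosDpi cosN sqrrN.
rewrite big_nat (eq_bigr (fun k => 4 ^+ m * polya_cos p m k)) -?big_nat; last first.
  by move=> k /andP[_ kp]; rewrite fE.
rewrite -mulr_sumr /polya_const.
have -> : \sum_(0 <= n < m) polya_bin l m n = (\sum_(0 <= j < m) 'C(2 * m, m + j.+1 * l)%:R) / 'C(2 * m, m)%:R.
  by rewrite mulr_suml.
have := central_bin_neq0 m.
move: ('C(2 * m, m)%:R) (\sum_(0 <= j < m) _) (\sum_(0 <= i < p) _) => c S T c0 H.
have l0R : l%:R != 0 :> R by rewrite pnatr_eq0.
apply: (mulfI c0); apply: (mulfI l0R).
rewrite (_ : l%:R * (c * (1 + 2 * (S / c))) = l%:R * (c + 2 * S)); last by field.
by rewrite -H natrX; field; rewrite l0R c0.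
Qed.

End CircularBinomialSums.

(** * The functional equation of theta *)
Section PolyaLimit.
Variable R : realType.
Implicit Types (x y z : R).

Lemma cvg_expR (T : Type) (F : set_system T) {FF : Filter F} (f : T -> R) a :
  f x @[x --> F] --> a -> expR (f x) @[x --> F] --> expR a.
Proof. by move=> fa; exact: (cvg_comp _ _ fa (@continuous_expR R _)). Qed.

Lemma expR_sq_geo x n : 0 <= x -> expR (- x * n.+1%:R ^+ 2) <= expR (- x) * expR (- x) ^+ n.
Proof.
move=> x0; have : 0 <= x <= x by rewrite x0 lexx.
by move=> /(@expR_sq_le _ x x n)/andP[].
Qed.

Lemma cvg_div1 (T : Type) (F : set_system T) {FF : Filter F} (f g : T -> R) (a : R) :
  f x @[x --> F] --> a -> g x @[x --> F] --> (1 : R) -> f x / g x @[x --> F] --> a.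
Proof.
move=> fa g1; have : f x / g x @[x --> F] --> a / 1 by apply: cvgM => //; exact: cvgV.
by rewrite divr1.
Qed.

Lemma expR_le_inv1D z : 0 <= z -> expR (- z) <= (1 + z)^-1.
Proof.
move=> z0; rewrite expRN lef_pV2 ?posrE ?expR_gt0 ?ltr_pwDl//.
exact: expR_ge1Dx.
Qed.

Lemma inv1D_le_expR z : 0 <= z -> (1 + z)^-1 <= expR (- (z / (1 + z))).
Proof.
move=> z0; have z1 : 1 + z != 0 by rewrite gt_eqF// ltr_pwDl.
rewrite {1}(_ : (1 + z)^-1 = 1 + (- (z / (1 + z)))); last by field.
exact: expR_ge1Dx.
Qed.

(** The ratio is the product of the [i] factors [(m - k) / (m + k + 1)], each of
   which is compared with an exponential. The bound [i0] on [i] stays fixed along the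
   induction, so that all the factors are bounded with the same denominators. *)
Lemma central_bin_ratio_bounds i i0 m : (i <= i0 <= m)%N ->
  (expR (- (i%:R ^+ 2 / (m%:R - i0%:R + 1)) : R) <=
  'C(2 * m, m + i)%:R / 'C(2 * m, m)%:R <=
  expR (- (i%:R ^+ 2 / (m%:R + i0%:R)) : R)).
Proof.
have c0 := central_bin_neq0 R m.
elim: i => [_|i IH /andP[ii0 i0m]].
  by rewrite expr0n/= !mul0r oppr0 expR0 addn0 divff// lexx.
have /IH/andP[IHl IHu] : (i <= i0 <= m)%N by lia.
have i0mR : i0%:R <= m%:R :> R by rewrite ler_nat.
have ii0R : i%:R + 1 <= i0%:R :> R by rewrite natr1 ler_nat.
have i0R : 0 <= i%:R :> R by [].
have E : 'C(2 * m, m + i.+1)%:R / 'C(2 * m, m)%:R =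
   'C(2 * m, m + i)%:R / 'C(2 * m, m)%:R * ((m%:R - i%:R) / (m%:R + i%:R + 1)) :> R.
  have := mul_bin_left (2 * m) (m + i) => /(congr1 (fun n => n%:R : R)).
  rewrite -addnS !natrM natrB ?natrD ?natrM; last by lia.
  rewrite -(natr1 i) => H; have d0 : m%:R + i%:R + 1 != 0 :> R by lra.
  apply: (mulfI d0); rewrite mulrA -[m%:R + i%:R + 1]addrA H; field.
  by rewrite c0 addrA d0.
have sq : i.+1%:R ^+ 2 = i%:R ^+ 2 + (2 * i%:R + 1) :> R by rewrite -natr1; ring.
have expRND x y z : expR (- ((x + y) / z)) = expR (- (x / z)) * expR (- (y / z)) :> R.
  by rewrite mulrDl opprD expRD.
rewrite E sq !(expRND (i%:R ^+ 2)); apply/andP; split.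
  apply: ler_pM; rewrite ?expR_ge0//.
  apply: le_trans (_ : expR (- ((2 * i%:R + 1) / (m%:R - i%:R))) <= _).
    rewrite ler_expR lerN2 ler_pM2l; last by lra.
    by rewrite lef_pV2 ?posrE; lra.
  apply: le_trans (expR_le_inv1D _) _; first by rewrite divr_ge0; lra.
  rewrite le_eqVlt; apply/orP; left; apply/eqP; field.
  by apply/andP; split; apply/eqP; lra.
have q0 : 0 <= (m%:R - i%:R) / (m%:R + i%:R + 1) :> R.
  by apply: divr_ge0; lra.
have b0 : 0 <= 'C(2 * m, m + i)%:R / 'C(2 * m, m)%:R :> R by apply: divr_ge0.
apply: (ler_pM b0 q0 IHu).
rewrite (_ : (m%:R - i%:R) / _ = 1 + (- ((2 * i%:R + 1) / (m%:R + i%:R + 1)))); last first.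
  by field; apply/eqP; lra.
apply: le_trans (expR_ge1Dx _) _; rewrite ler_expR lerN2 ler_pM2l; last by lra.
by rewrite lef_pV2 ?posrE; lra.
Qed.

Lemma is_derive_le (f df : R -> R) a b : a <= b ->
  (forall x, is_derive x 1 f (df x)) -> (forall x, a <= x <= b -> 0 <= df x) ->
  f a <= f b.
Proof.
move=> ab fd df0.
have [|c cab] := @MVT_segment R f df a b ab (fun x _ => fd x).
  by apply: derivable_within_continuous => x _; exact: ex_derive.
rewrite -subr_ge0 => ->; rewrite mulr_ge0 ?subr_ge0// df0//.
Qed.

Lemma sin_le y : 0 <= y -> sin y <= y.
Proof.
move=> y0; rewrite -subr_ge0.
have D x : is_derive x 1 (fun z => z - sin z) (1 - cos x) by exact: is_deriveB.
have := is_derive_le y0 D; rewrite sin0 subrr; apply => x _.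
by rewrite subr_ge0 cos_le1.
Qed.

Lemma ycos_le_sin y : 0 <= y <= pi / 2 -> y * cos y <= sin y.
Proof.
move=> /andP[y0 ypi]; rewrite -subr_ge0.
have D x : is_derive x 1 (fun z => sin z - z * cos z) (x * sin x).
  by apply: is_derive_eq; rewrite /GRing.scale/=; ring.
have := is_derive_le y0 D; rewrite sin0 mul0r subrr; apply => x /andP[x0 xy].
by rewrite mulr_ge0// sin_ge0_pi// x0/=; have := pi_ge0 R; lra.
Qed.

(** Since [cos ^ 2 = 1 / (1 + tan ^ 2)] and [tan y >= y]. *)
Lemma cos_sq_le y : 0 <= y <= pi / 2 -> cos y ^+ 2 <= expR (- (y ^+ 2 / (1 + y ^+ 2))).
Proof.
move=> y0; apply: le_trans (inv1D_le_expR (sqr_ge0 y)).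
have y1 : 0 < 1 + y ^+ 2 by rewrite ltr_pwDl// sqr_ge0.
rewrite -[_^-1]mul1r ler_pdivlMr// mulrDr mulr1 -exprMn.
have := cos2Dsin2 y; have := ycos_le_sin y0.
have c0 : 0 <= cos y by apply: cos_ge0_pihalf; have := pi_gt0 R; lra.
have : 0 <= y by lra.
move=> yp; rewrite (mulrC (cos y)); have := mulr_ge0 yp c0.
by move: (y * cos y) => t; nra.
Qed.

Lemma cos_sq_ge y : 0 <= y < 1 -> expR (- (y ^+ 2 / (1 - y ^+ 2))) <= cos y ^+ 2.
Proof.
move=> /andP[y0 y1].
have y2 : 0 < 1 - y ^+ 2 by nra.
have -> : cos y ^+ 2 = 1 - sin y ^+ 2 by rewrite -(cos2Dsin2 y); ring.
have s0 : 0 <= sin y by apply: sin_ge0_pi; have := pi_ge2 R; lra.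
have sy := sin_le y0.
apply: (@le_trans _ _ (1 - y ^+ 2)); last by nra.
apply: le_trans (expR_le_inv1D _) _; first by rewrite divr_ge0 ?sqr_ge0 ?ltW.
rewrite le_eqVlt; apply/orP; left; apply/eqP; field.
by rewrite gt_eqF//= subrK oner_neq0.
Qed.

Lemma central_bin_rec m :
  (m.+1 * 'C(2 * m.+1, m.+1) = 2 * (2 * m).+1 * 'C(2 * m, m))%N.
Proof.
have := mul_bin_diag (2 * m.+1) m; have := mul_bin_diag (2 * m).+1 m.
have -> : 'C((2 * m).+1, m.+1) = 'C((2 * m.+1).-1, m).
  rewrite (_ : (2 * m.+1).-1 = (2 * m).+1); last by lia.
  by rewrite -bin_sub; [congr 'C(_, _); lia|lia].
rewrite succnK => H <-; move: H; move: 'C(_.-1, m) 'C(_, _) => X c H.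
apply/eqP; rewrite -(@eqn_pmul2l m.+1)//; apply/eqP.
transitivity (2 * m.+1 * (m.+1 * X))%N; first by ring.
by rewrite -H; ring.
Qed.

(** Wallis' sequence, whose limit is [pi]. *)
Definition central_sq m : R := 16 ^+ m / ('C(2 * m, m)%:R ^+ 2 * m%:R).

Lemma central_sq_noninc : nonincreasing_seq (fun m => central_sq m.+1).
Proof.
apply/nonincreasing_seqP => m; rewrite /central_sq.
have := central_bin_rec m.+1 => /(congr1 (fun n => n%:R : R)); rewrite !natrM.
have := central_bin_neq0 R m.+1; have := central_bin_neq0 R m.+2.
rewrite -(natr1 (2 * m.+1)) natrM -(natr1 m.+1).
move: ('C(2 * m.+2, _)%:R) ('C(2 * m.+1, _)%:R) => b a b0 a0 H.
have m0 : 0 < m.+1%:R :> R by rewrite ltr0n.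
move: m.+1%:R m0 H => k k0 H; rewrite exprS.
have -> : b = 2 * (2 * k + 1) * a / (k + 1).
  by apply: (mulfI (_ : k + 1 != 0)); [apply/eqP; lra|rewrite H; field; apply/eqP; lra].
have -> : 16 * 16 ^+ m.+1 / ((2 * (2 * k + 1) * a / (k + 1)) ^+ 2 * (k + 1)) =
  16 ^+ m.+1 / (a ^+ 2 * k) * (4 * k * (k + 1) / (2 * k + 1) ^+ 2).
  field; rewrite a0; apply/and3P; split => //; apply/eqP; lra.
apply: ler_piMr; first by rewrite divr_ge0 ?exprn_ge0// mulr_ge0 ?sqr_ge0 ?ltW.
by rewrite ler_pdivrMr; [nra|apply: exprn_gt0; lra].
Qed.

(** Monotonicity gives convergence; the limit is identified in [theta_inv] by the
   self-dual case [lam = pi] of [polya_limit]. *)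
Lemma cvg_central_sq : exists e : R, central_sq m @[m --> \oo] --> e.
Proof.
have : cvgn (fun m => central_sq m.+1).
  apply: nonincreasing_is_cvgn central_sq_noninc _.
  exists 0 => _ [m _ <-]; rewrite /central_sq; apply: divr_ge0; first exact: exprn_ge0.
  by apply: mulr_ge0 => //; exact: sqr_ge0.
move=> /cvg_ex[e He]; exists e; rewrite -(cvg_shiftS central_sq); exact: He.
Qed.

Section Scaling.
Variables (lam : R) (lam0 : 0 < lam).

Let l (p : nat) : nat := (2 * p).+1.
Let m p : nat := Num.truncn ((l p)%:R ^+ 2 / lam).
Let y p : R := (l p)%:R^-1.
Let w p : R := (m p)%:R * y p ^+ 2.

Let l0 p : (l p)%:R != 0 :> R. Proof. by rewrite pnatr_eq0. Qed.
Let y0 p : 0 < y p. Proof. by rewrite invr_gt0 ltr0n. Qed.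

Let cvgy : y p @[p --> \oo] --> 0.
Proof.
apply: (@squeeze_cvgr _ _ _ _ (fun=> 0) harmonic); [|exact: cvg_cst|exact: cvg_harmonic].
apply: nearW => p; rewrite ltW ?y0//= lef_pV2 ?posrE ?ltr0n//.
by rewrite ler_nat /l; lia.
Qed.

Let cvgcy c : c * y p @[p --> \oo] --> 0.
Proof. by rewrite -(mulr0 c); apply: cvgM => //; exact: cvg_cst. Qed.

Let m_itv p : (m p)%:R <= (l p)%:R ^+ 2 / lam < (m p).+1%:R.
Proof. by apply: truncn_itv; rewrite divr_ge0 ?sqr_ge0// ltW. Qed.

Let wE p : w p * (l p)%:R ^+ 2 = (m p)%:R.
Proof. by rewrite /w /y; field; rewrite l0. Qed.

Let w_le p : w p <= lam^-1.
Proof.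
have l2 : 0 < (l p)%:R ^+ 2 :> R by rewrite exprn_gt0 ?ltr0n.
by rewrite -(ler_pM2r l2) wE mulrC; case/andP: (m_itv p).
Qed.

Let cvgw : w p @[p --> \oo] --> lam^-1.
Proof.
apply: (@squeeze_cvgr _ _ _ _ (fun p => lam^-1 - y p ^+ 2) (fun=> lam^-1)); last exact: cvg_cst.
  apply: nearW => p; rewrite w_le andbT.
  have l2 : 0 < (l p)%:R ^+ 2 :> R by rewrite exprn_gt0 ?ltr0n.
  rewrite -(ler_pM2r l2) wE mulrBl /y exprVn mulVf ?expf_neq0//.
  by case/andP: (m_itv p) => _; rewrite -natr1 mulrC => /ltW; rewrite lerBlDr.
rewrite -[X in _ --> X]subr0; apply: cvgB; first exact: cvg_cst.
rewrite -(mulr0 0); under eq_fun do rewrite expr2; exact: cvgM.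
Qed.

Let cvgm : m p @[p --> \oo] --> \oo.
Proof.
apply/cvgnyPge => A; have := nbhs_infty_ger (A%:R * lam); apply: filterS => p Hp.
rewrite /m truncn_ge_nat; last by rewrite divr_ge0 ?sqr_ge0// ltW.
rewrite ler_pdivlMr//.
apply: (le_trans Hp); rewrite -natrX ler_nat /l; nia.
Qed.

Let cvg_polya_bin : nnsum (polya_bin R (l p) (m p)) @[p --> \oo] --> jacobi0 lam.
Proof.
have lam20 : 0 < lam / 2 by rewrite divr_gt0.
apply: (@tannery R nat \oo _ (fun p => polya_bin R (l p) (m p)) _
  (fun n => expR (- (lam / 2)) * expR (- (lam / 2)) ^+ n)).
- move=> j.
  apply: (@squeeze_cvgr _ _ _ _ (fun p => expR (- (j.+1%:R ^+ 2 / (w p - j.+1%:R * y p + y p * y p))))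
    (fun p => expR (- (j.+1%:R ^+ 2 / (w p + j.+1%:R * y p))))).
  + near=> p.
    have jm : (j.+1 * l p <= m p)%N.
      rewrite -(ler_nat R) natrM -wE; rewrite expr2 mulrA ler_pM2r ?ltr0n//.
      rewrite -ler_pdivrMr ?ltr0n//; near: p.
      have H : w p - j.+1%:R * y p @[p --> \oo] --> lam^-1.
        by rewrite -[X in _ --> X]subr0; apply: cvgB.
      have H0 : \forall p \near \oo, 0 < w p - j.+1%:R * y p.
        by apply: (cvgr_gt _ H); rewrite invr_gt0.
      by apply: filterS H0 => p /=; rewrite subr_gt0 => /ltW.
    have := @central_bin_ratio_bounds (j.+1 * l p) (j.+1 * l p) (m p).
    rewrite leqnn jm => /(_ isT).
    rewrite /polya_bin natrM -wE.
    suff [-> ->] : (j.+1%:R * (l p)%:R) ^+ 2 / (w p * (l p)%:R ^+ 2 - j.+1%:R * (l p)%:R + 1) =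
      j.+1%:R ^+ 2 / (w p - j.+1%:R * y p + y p * y p) /\
      (j.+1%:R * (l p)%:R) ^+ 2 / (w p * (l p)%:R ^+ 2 + j.+1%:R * (l p)%:R) =
      j.+1%:R ^+ 2 / (w p + j.+1%:R * y p) by [].
    have l2 : (l p)%:R ^+ 2 != 0 :> R by rewrite expf_neq0.
    split.
      rewrite (_ : w p * _ - _ + 1 = (w p - j.+1%:R * y p + y p * y p) * (l p)%:R ^+ 2).
        by rewrite exprMn -mulf_div divff ?mulr1.
      by rewrite /y; field; rewrite l0.
    rewrite (_ : w p * _ + _ = (w p + j.+1%:R * y p) * (l p)%:R ^+ 2).
      by rewrite exprMn -mulf_div divff ?mulr1.
    by rewrite /y; field; rewrite l0.
  + apply: cvg_expR; rewrite mulNr mulrC.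
    apply: cvgN; apply: cvgM; first exact: cvg_cst.
    rewrite -[X in _ --> X]invrK; apply: cvgV; first by rewrite invr_neq0// gt_eqF.
    rewrite -[X in _ --> X]addr0 -{1}[X in _ --> X + _]subr0; apply: cvgD; first exact: cvgB.
    by rewrite -(mulr0 0); exact: cvgM.
  + apply: cvg_expR; rewrite mulNr mulrC.
    apply: cvgN; apply: cvgM; first exact: cvg_cst.
    rewrite -[X in _ --> X]invrK; apply: cvgV; first by rewrite invr_neq0// gt_eqF.
    rewrite -[X in _ --> X]addr0; exact: cvgD.
- apply: nearW => p j; rewrite polya_bin_ge0/=.
  case: (leqP (j.+1 * l p) (m p)) => jm; last first.
    by rewrite /polya_bin bin_small ?mul0r ?mulr_ge0 ?exprn_ge0 ?expR_ge0//; lia.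
  have := @central_bin_ratio_bounds (j.+1 * l p) (j.+1 * l p) (m p).
  rewrite leqnn jm => /(_ isT) /andP[_] /le_trans; apply.
  apply: le_trans (expR_sq_geo j (ltW lam20)); rewrite ler_expR mulNr lerN2.
  have l2 : 0 < (l p)%:R ^+ 2 :> R by rewrite exprn_gt0 ?ltr0n.
  have m0 : 0 < (m p)%:R :> R by rewrite ltr0n; apply: leq_trans jm; rewrite muln_gt0.
  have jmR : (j.+1 * l p)%:R <= (m p)%:R :> R by rewrite ler_nat.
  rewrite ler_pdivlMr ?ltr_wpDr//.
  apply: (@le_trans _ _ (lam / 2 * j.+1%:R ^+ 2 * (2 * (m p)%:R))).
    by apply: ler_wpM2l; [rewrite mulr_ge0 ?sqr_ge0// ltW|lra].
  have /andP[+ _] := m_itv p; rewrite ler_pdivlMr// => H.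
  rewrite natrM exprMn (_ : _ * (2 * _) = j.+1%:R ^+ 2 * ((m p)%:R * lam)); last by field.
  by apply: ler_wpM2l => //; exact: sqr_ge0.
- by have [] := geometric_nnsummable (expR_ge0 (- (lam / 2))) (expRN_itv lam20).
Unshelve. all: by end_near.
Qed.

Let cvg_polya_cos : nnsum (polya_cos R p (m p)) @[p --> \oo] --> jacobi0 (pi ^+ 2 / lam).
Proof.
(* A majorant: [m y ^ 2 >= 1 / (2 lam)] eventually, and the argument of the cosine is
   at most [pi / 2 < 2], whence a denominator at most 5. *)
pose x : R := pi ^+ 2 / (10 * lam).
have x0 : 0 < x by rewrite divr_gt0 ?exprn_gt0 ?pi_gt0 ?mulr_gt0.
have cosE p k : (k < p)%N -> polya_cos R p (m p) k = (cos (k.+1%:R * pi * y p) ^+ 2) ^+ m p.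
  by move=> kp; rewrite /polya_cos kp exprM.
have arg p k : (k < p)%N -> 0 <= k.+1%:R * pi * y p <= pi / 2.
  move=> kp; rewrite mulr_ge0 ?mulr_ge0 ?pi_ge0 ?(ltW (y0 p))//= /y.
  rewrite ler_pdivrMr ?ltr0n// mulrC -mulrA ler_pM2l ?pi_gt0// mulrC ler_pdivlMr//.
  by rewrite -natrM ler_nat /l; lia.
have upper p k : (k < p)%N -> polya_cos R p (m p) k <=
    expR (- (w p * (pi * k.+1%:R) ^+ 2 / (1 + (k.+1%:R * pi * y p) ^+ 2))).
  move=> kp; rewrite cosE//.
  apply: le_trans (lerXn2r _ _ _ (cos_sq_le (arg _ _ kp))) _; rewrite ?nnegrE ?sqr_ge0 ?expR_ge0//.
  rewrite -expRM_natl le_eqVlt; apply/orP; left; apply/eqP; congr expR.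
  by rewrite /w mulrN; congr (- _); field; rewrite gt_eqF// ltr_wpDr// sqr_ge0.
apply: (@tannery R nat \oo _ (fun p => polya_cos R p (m p)) _
  (fun n => expR (- x) * expR (- x) ^+ n)).
- move=> k.
  have cvgky : k.+1%:R * pi * y p @[p --> \oo] --> 0.
    exact: cvgcy.
  have cvgky2 : (k.+1%:R * pi * y p) ^+ 2 @[p --> \oo] --> 0.
    by rewrite -(mulr0 0); under eq_fun do rewrite expr2; exact: cvgM.
  have cvgn : w p * (pi * k.+1%:R) ^+ 2 @[p --> \oo] --> pi ^+ 2 / lam * k.+1%:R ^+ 2.
    rewrite (_ : _ / _ * _ = lam^-1 * (pi * k.+1%:R) ^+ 2); last by field; rewrite gt_eqF.
    by apply: cvgM => //; exact: cvg_cst.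
  apply: (@squeeze_cvgr _ _ _ _
     (fun p => expR (- (w p * (pi * k.+1%:R) ^+ 2 / (1 - (k.+1%:R * pi * y p) ^+ 2))))
     (fun p => expR (- (w p * (pi * k.+1%:R) ^+ 2 / (1 + (k.+1%:R * pi * y p) ^+ 2))))).
  + near=> p.
    have kp : (k < p)%N by near: p; exact: nbhs_infty_gt.
    rewrite upper// andbT cosE//.
    have z0 : 0 <= k.+1%:R * pi * y p by case/andP: (arg _ _ kp).
    have z1 : k.+1%:R * pi * y p < 1.
      by near: p; apply: (cvgr_lt _ cvgky); exact: ltr01.
    apply: le_trans (lerXn2r _ _ _ (cos_sq_ge _)); rewrite ?nnegrE ?sqr_ge0 ?expR_ge0 ?z0//.
    rewrite -expRM_natl le_eqVlt; apply/orP; left; apply/eqP; congr expR.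
    rewrite (_ : w p * (pi * k.+1%:R) ^+ 2 = (m p)%:R * (k.+1%:R * pi * y p) ^+ 2).
      by rewrite [RHS]mulrN [in RHS]mulrA.
    by rewrite /w; ring.
  + apply: cvg_expR; rewrite mulNr; apply: cvgN.
    apply: cvg_div1 => //.
    by rewrite -[X in _ --> X]subr0; apply: cvgB => //; exact: cvg_cst.
  + apply: cvg_expR; rewrite mulNr; apply: cvgN.
    apply: cvg_div1 => //.
    by rewrite -[X in _ --> X]addr0; apply: cvgD => //; exact: cvg_cst.
- near=> p => k; rewrite polya_cos_ge0/=.
  case: (ltnP k p) => kp; last first.
    by rewrite /polya_cos ltnNge kp/= mulr_ge0 ?exprn_ge0 ?expR_ge0.
  apply: le_trans (upper _ _ kp) _.
  apply: le_trans (expR_sq_geo k (ltW x0)); rewrite ler_expR mulNr lerN2.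
  have wp : (2 * lam)^-1 <= w p.
    near: p; apply: (cvgr_ge _ cvgw).
    by rewrite ltf_pV2 ?posrE ?mulr_gt0// mulr_natl mulr2n ltrDl lam0.
  have /andP[z0 z1] := arg _ _ kp.
  have /andP[_ pi4] := (pihalf_02_cos_pihalf R).1.
  have z2 : (k.+1%:R * pi * y p) ^+ 2 <= 4 by nra.
  rewrite ler_pdivlMr ?ltr_wpDr ?sqr_ge0//.
  apply: (@le_trans _ _ (x * k.+1%:R ^+ 2 * 5)).
    apply: ler_wpM2l; last lra.
    by rewrite mulr_ge0 ?sqr_ge0// ltW.
  rewrite (_ : _ * 5 = (2 * lam)^-1 * (pi * k.+1%:R) ^+ 2); last by rewrite /x; field; rewrite gt_eqF.
  by apply: ler_wpM2r => //; exact: sqr_ge0.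
- by have [] := geometric_nnsummable (expR_ge0 (- x)) (expRN_itv x0).
Unshelve. all: by end_near.
Qed.

Let polya_const_sq p : polya_const R (l p) (m p) ^+ 2 = central_sq (m p) * w p + (m p == 0)%:R * y p ^+ 2.
Proof.
rewrite /polya_const /central_sq /w /y.
have := central_bin_neq0 R (m p); have := l0 p.
case: (m p) => [|n] ln cn; first by rewrite !expr0 !mul0r !mulr0 add0r muln0 bin0 !mul1r.
rewrite mul0r addr0 (_ : 16 = 4 ^+ 2 :> R); last by rewrite -natrX.
rewrite (exprAC _ 2); have n0 : n.+1%:R != 0 :> R by rewrite pnatr_eq0.
move: cn ln n0; move: 'C(_, _)%:R (l p)%:R n.+1%:R (4 ^+ _) => c q k f c0 q0 k0.
by field; rewrite c0 q0 k0.
Qed.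

(** The limit of Polya's identity. It is squared, so that the constant involves
   Wallis' sequence [central_sq]. *)
Lemma polya_limit (e : R) : central_sq n @[n --> \oo] --> e ->
  jacobi lam ^+ 2 = e / lam * jacobi (pi ^+ 2 / lam) ^+ 2.
Proof.
move=> He.
have C1 : (1 + 2 * nnsum (polya_bin R (l p) (m p))) ^+ 2 @[p --> \oo] --> jacobi lam ^+ 2.
  have H : 1 + 2 * nnsum (polya_bin R (l p) (m p)) @[p --> \oo] --> jacobi lam.
    by apply: cvgD; [exact: cvg_cst|apply: cvgM; [exact: cvg_cst|exact: cvg_polya_bin]].
  by under eq_fun do rewrite expr2; rewrite expr2; exact: cvgM.
have C2 : (1 + 2 * nnsum (polya_cos R p (m p))) ^+ 2 @[p --> \oo] --> jacobi (pi ^+ 2 / lam) ^+ 2.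
  have H : 1 + 2 * nnsum (polya_cos R p (m p)) @[p --> \oo] --> jacobi (pi ^+ 2 / lam).
    by apply: cvgD; [exact: cvg_cst|apply: cvgM; [exact: cvg_cst|exact: cvg_polya_cos]].
  by under eq_fun do rewrite expr2; rewrite expr2; exact: cvgM.
have C3 : polya_const R (l p) (m p) ^+ 2 @[p --> \oo] --> e / lam.
  have H : central_sq (m p) * w p @[p --> \oo] --> e / lam.
    by apply: cvgM cvgw; exact: (cvg_comp _ _ cvgm He).
  apply: cvg_trans H; apply: near_eq_cvg.
  have /cvgnyPgt/(_ 0%N) := cvgm; apply: filterS => p mp.
  by rewrite polya_const_sq gtn_eqF// mul0r addr0.
apply: (cvg_unique _ C1); first exact: norm_hausdorff.
rewrite /=; under eq_fun => p do rewrite (polya_identity R p (m p)) exprMn.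
exact: cvgM.
Qed.

End Scaling.

Lemma jacobi_gt0 z : 0 < jacobi z.
Proof. by rewrite /jacobi ltr_wpDr// mulr_ge0 ?jacobi0_ge0. Qed.

Lemma theta_inv (t : R) : 0 < t -> theta t^-1 = t * theta t.
Proof.
move=> t0; have [e He] := cvg_central_sq.
have epi : e = pi.
  have J : jacobi (pi : R) ^+ 2 != 0 by rewrite expf_neq0// gt_eqF// jacobi_gt0.
  have := polya_limit (pi_gt0 R) He; rewrite (expr2 pi) mulfK ?gt_eqF ?pi_gt0// => /esym.
  by rewrite -[RHS]mul1r => /(mulIf J)/divr1_eq.
have x0 : 0 < pi * t ^+ 2 by rewrite mulr_gt0 ?pi_gt0 ?exprn_gt0.
have := polya_limit x0 He; rewrite epi !thetaE ?invr_gt0//.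
have tn : t != 0 by rewrite gt_eqF.
have E1 p : p != 0 -> p ^+ 2 / (p * t ^+ 2) = p * t^-1 ^+ 2 by move=> p0; field; rewrite ?p0 ?tn.
have E2 p : p != 0 -> p / (p * t ^+ 2) = (t ^+ 2)^-1 by move=> p0; field; rewrite ?p0 ?tn.
rewrite E1 ?E2 ?gt_eqF ?pi_gt0//.
move=> H; apply/eqP; rewrite -(@eqrXn2 _ 2)//.
- by rewrite exprMn H mulVKf// expf_neq0.
- by rewrite ltW ?jacobi_gt0.
- by rewrite mulr_ge0 ?ltW ?jacobi_gt0.
Qed.

End PolyaLimit.

(** * Words, shuffles and deconcatenation *)
Section ShuffleSums.
Variables (T : Type) (V : nmodType).
Implicit Types (u v w : seq T) (F : seq T -> V).

Lemma shuffle_cons a u b v : shuffle (a :: u) (b :: v) =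
  [seq a :: w | w <- shuffle u (b :: v)] ++ [seq b :: w | w <- shuffle (a :: u) v].
Proof. by []. Qed.

Lemma shuffle0s v : shuffle [::] v = [:: v]. Proof. by case: v. Qed.
Lemma shuffles0 u : shuffle u [::] = [:: u]. Proof. by case: u. Qed.

Definition shsum F u v : V := \sum_(w <- shuffle u v) F w.

Lemma shsum_cons F a u b v : shsum F (a :: u) (b :: v) =
  shsum (fun w => F (a :: w)) u (b :: v) + shsum (fun w => F (b :: w)) (a :: u) v.
Proof. by rewrite /shsum shuffle_cons big_cat !big_map. Qed.

Lemma shsum0s F v : shsum F [::] v = F v.
Proof. by rewrite /shsum shuffle0s big_seq1. Qed.

Lemma shsums0 F u : shsum F u [::] = F u.
Proof. by rewrite /shsum shuffles0 big_seq1. Qed.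

Lemma eq_shsum F1 F2 u v : F1 =1 F2 -> shsum F1 u v = shsum F2 u v.
Proof. by move=> F12; apply: eq_bigr. Qed.

Lemma shsumD F1 F2 u v : shsum (fun w => F1 w + F2 w) u v = shsum F1 u v + shsum F2 u v.
Proof. exact: big_split. Qed.

Lemma shsum_rcons F a u b v : shsum F (rcons u a) (rcons v b) =
  shsum (fun w => F (rcons w a)) u (rcons v b) +
  shsum (fun w => F (rcons w b)) (rcons u a) v.
Proof.
elim: u v F => [|c u IHu] v F.
  elim: v F => [|d v IHv] F.
    by rewrite /= shsum_cons !shsum0s !shsums0/= addrC.
  rewrite [rcons (d :: v) b]/= shsum_cons -[rcons [::] a]/[:: a] shsum0s.
  rewrite -[X in shsum _ X (rcons v b)]/(rcons [::] a) IHv !shsum0s.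
  rewrite -[rcons [::] a]/[:: a] (shsum_cons _ a [::] d v) shsum0s /=.
  by rewrite addrCA.
elim: v F => [|d v IHv] F.
  rewrite [rcons (c :: u) a]/= -[rcons [::] b]/[:: b] shsum_cons !shsums0.
  rewrite -[X in shsum _ _ X]/(rcons [::] b) IHu !shsums0.
  rewrite -[rcons [::] b]/[:: b] (shsum_cons _ c u b [::]) shsums0 /=.
  by rewrite addrAC.
rewrite !rcons_cons shsum_cons -rcons_cons IHu -rcons_cons IHv.
rewrite (shsum_cons _ c u) (shsum_cons _ c _ d v) -!rcons_cons.
by rewrite addrACA.
Qed.

Lemma shsum_rev F u v : shsum F (rev u) (rev v) = shsum (fun w => F (rev w)) u v.
Proof.
have [n] := ubnP (size u + size v); elim: n u v F => // n IH [|a u] [|b v] F.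
- by rewrite !shsum0s.
- by rewrite !shsum0s.
- by rewrite !shsums0.
rewrite /= => le_n; rewrite !rev_cons shsum_rcons -!rev_cons shsum_cons.
rewrite !IH/=; [|lia|lia].
by congr (_ + _); apply: eq_shsum => w; rewrite rev_cons.
Qed.

End ShuffleSums.

Lemma shuffle_map (T U : Type) (f : T -> U) u v :
  shuffle (map f u) (map f v) = map (map f) (shuffle u v).
Proof.
have [n] := ubnP (size u + size v); elim: n u v => // n IH [|a u] [|b v] le_n.
- by [].
- by rewrite !shuffle0s.
- by rewrite !shuffles0.
rewrite 2!map_cons !shuffle_cons map_cat -!map_comp -(map_cons f b v) -(map_cons f a u).
by rewrite !IH; [rewrite -!map_comp|move: le_n => /=; lia|move: le_n => /=; lia].
Qed.

Lemma mem_shuffle (T : eqType) (u v w : seq T) :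
  (w \in shuffle u v) -> perm_eq w (u ++ v).
Proof.
have [n] := ubnP (size u + size v); elim: n u v w => // n IH [|a u] [|b v] w le_n.
- by rewrite inE => /eqP ->.
- by rewrite inE => /eqP ->.
- by rewrite shuffles0 inE => /eqP ->; rewrite cats0.
rewrite shuffle_cons mem_cat => /orP[] /mapP[w' + ->].
  by move=> /IH; rewrite perm_cons; apply; move: le_n => /=; lia.
move=> /IH -/(_ _) H; rewrite perm_sym.
rewrite -[_ ++ _]/((a :: u) ++ [:: b] ++ v) perm_catCA /= perm_cons perm_sym.
by apply: H; move: le_n => /=; lia.
Qed.

Section Convolution.
Variables (T : Type) (V : pzSemiRingType).
Implicit Types (u v w : seq T).

(** The recursive form of the sum in [splitsE], suited to inductions on [u]. *)
Fixpoint splits (F : seq T -> seq T -> V) u : V :=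
  F [::] u + if u is a :: u' then splits (fun p q => F (a :: p) q) u' else 0.

(** The convolution dual to deconcatenation. By Chen's formula it computes the iterated
   integrals along a composed path from those along the two pieces. *)
Definition conv (A B : seq T -> V) u : V := splits (fun p q => A p * B q) u.

Lemma splits_nil F : splits F [::] = F [::] [::].
Proof. exact: addr0. Qed.

Lemma splits_cons F a u :
  splits F (a :: u) = F [::] (a :: u) + splits (fun p q => F (a :: p) q) u.
Proof. by []. Qed.

Lemma eq_splits F1 F2 u : (forall p q, F1 p q = F2 p q) -> splits F1 u = splits F2 u.
Proof. by elim: u F1 F2 => [|a u IH] F1 F2 F12 /=; rewrite F12 // (IH _ _ (fun p q => F12 (a :: p) q)). Qed.

Lemma splitsD F1 F2 u : splits (fun p q => F1 p q + F2 p q) u = splits F1 u + splits F2 u.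
Proof. by elim: u F1 F2 => [|a u IH] F1 F2 /=; rewrite ?addr0// IH addrACA. Qed.

Lemma splitsE F u : splits F u = \sum_(i < (size u).+1) F (take i u) (drop i u).
Proof.
elim: u F => [|a u IH] F /=; first by rewrite big_ord_recl big_ord0.
by rewrite big_ord_recl /= IH.
Qed.

Lemma convE A B u : conv A B u = \sum_(i < (size u).+1) A (take i u) * B (drop i u).
Proof. exact: splitsE. Qed.

Lemma conv_nil A B : conv A B [::] = A [::] * B [::].
Proof. by rewrite /conv /= addr0. Qed.

Lemma conv_cons A B a u :
  conv A B (a :: u) = A [::] * B (a :: u) + conv (fun w => A (a :: w)) B u.
Proof. by []. Qed.

Lemma eq_conv A1 A2 B1 B2 u : A1 =1 A2 -> B1 =1 B2 -> conv A1 B1 u = conv A2 B2 u.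
Proof. by move=> A12 B12; apply: eq_splits => p q; rewrite A12 B12. Qed.

Lemma convDl A1 A2 B u : conv (fun w => A1 w + A2 w) B u = conv A1 B u + conv A2 B u.
Proof. by rewrite -splitsD; apply: eq_splits => p q; rewrite mulrDl. Qed.

Lemma convZl c A B u : conv (fun w => c * A w) B u = c * conv A B u.
Proof. by rewrite !convE mulr_sumr; apply: eq_bigr => i _; rewrite mulrA. Qed.

Definition counit u : V := if u is [::] then 1 else 0.

Lemma conv1w B u : conv counit B u = B u.
Proof.
case: u => [|a u]; first by rewrite conv_nil mul1r.
rewrite conv_cons mul1r convE big1 ?addr0// => i _; exact: mul0r.
Qed.

Lemma convw1 A u : conv A counit u = A u.
Proof.
elim: u A => [|a u IH] A; first by rewrite conv_nil mulr1.
by rewrite conv_cons mulr0 add0r IH.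
Qed.

(** Both sides are the sum over the cuts of [u] in three parts. *)
Lemma convA A B D u : conv A (conv B D) u = conv (conv A B) D u.
Proof.
elim: u A => [|a u IH] A; first by rewrite !conv_nil mulrA.
rewrite conv_cons [in RHS]conv_cons conv_nil.
have -> : conv (fun w => conv A B (a :: w)) D u =
    A [::] * conv (fun w => B (a :: w)) D u + conv (conv (fun w => A (a :: w)) B) D u.
  by rewrite -convZl -convDl; apply: eq_conv.
by rewrite IH conv_cons mulrDr mulrA addrA.
Qed.

(** The operators by which iterated integrals are differentiated at the lower and at the
   upper end: the first or the last letter is evaluated and removed. *)
Definition Lop (g : T -> V) (A : seq T -> V) u : V :=
  if u is a :: u' then g a * A u' else 0.

Definition Rop (g : T -> V) (A : seq T -> V) u : V :=
  if u is a :: u' then A (belast a u') * g (last a u') else 0.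

Lemma Rop_rcons g A u b : Rop g A (rcons u b) = A u * g b.
Proof. by case: u => //= a u; rewrite belast_rcons last_rcons. Qed.

Lemma conv_Lop g A B u : conv (Lop g A) B u = Lop g (conv A B) u.
Proof.
case: u => [|a u]; first by rewrite conv_nil mul0r.
by rewrite conv_cons mul0r add0r /= convZl.
Qed.

Lemma conv_Rop g A B u : conv (Rop g A) B u = conv A (Lop g B) u.
Proof.
elim: u A => [|a u IH] A; first by rewrite !conv_nil mul0r mulr0.
rewrite !conv_cons mul0r add0r /=.
have -> : conv (fun w => Rop g A (a :: w)) B u =
    A [::] * g a * conv counit B u + conv (Rop g (fun w => A (a :: w))) B u.
  rewrite -convZl -convDl; apply: eq_conv => // -[|c w].
    by rewrite mulr1 addr0.
  by rewrite mulr0 add0r.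
by rewrite conv1w IH mulrA.
Qed.

End Convolution.

Lemma conv_rev (T : Type) (V : comPzSemiRingType) (A B : seq T -> V) u :
  conv A B (rev u) = conv (fun w => B (rev w)) (fun w => A (rev w)) u.
Proof.
rewrite !convE size_rev (reindex_inj rev_ord_inj)/=; apply: eq_bigr => i _.
rewrite mulrC subSS take_rev drop_rev.
have iu : (i <= size u)%N by rewrite -ltnS.
by rewrite subKn.
Qed.

Lemma conv_map (T U : Type) (V : pzSemiRingType) (f : T -> U) (A B : seq U -> V) u :
  conv A B (map f u) = conv (fun w => A (map f w)) (fun w => B (map f w)) u.
Proof.
by rewrite !convE size_map; apply: eq_bigr => i _; rewrite map_take map_drop.
Qed.

Section ShuffleMultiplicative.
Variables (T : Type) (V : comPzSemiRingType).
Implicit Types (u v w : seq T).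

Definition shmul (A : seq T -> V) u v := A u * A v = shsum A u v.

(** Shuffling is compatible with deconcatenation: to cut a shuffle of [u] and [v]
   is to cut [u] and [v] and to shuffle the pieces. *)
Lemma shsum_splits (F : seq T -> seq T -> V) u v :
  shsum (splits F) u v =
  splits (fun u1 u2 => splits (fun v1 v2 =>
    shsum (fun w1 => shsum (fun w2 => F w1 w2) u2 v2) u1 v1) v) u.
Proof.
have [n] := ubnP (size u + size v); elim: n u v F => // n IH [|a u] [|b v] F le_n.
- by rewrite shsum0s !splits_nil !shsum0s.
- by rewrite shsum0s splits_nil; apply: eq_splits => p q; rewrite !shsum0s.
- by rewrite shsums0; apply: eq_splits => p q; rewrite splits_nil !shsums0.
have -> : shsum (splits F) (a :: u) (b :: v) = shsum (F [::]) (a :: u) (b :: v) +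
    (shsum (splits (fun p q => F (a :: p) q)) u (b :: v) +
     shsum (splits (fun p q => F (b :: p) q)) (a :: u) v).
  rewrite shsum_cons (shsum_cons (F [::])) addrACA -!shsumD.
  by congr (_ + _); apply: eq_shsum => w; rewrite splits_cons.
rewrite (IH u (b :: v)); last by move: le_n => /=; lia.
rewrite (IH (a :: u) v); last by move: le_n => /=; lia.
rewrite !splits_cons !shsum0s.
have E u1 u2 : splits (fun v1 v2 =>
      shsum (fun w1 => shsum (fun w2 => F w1 w2) u2 v2) (a :: u1) v1) (b :: v) =
   splits (fun v1 v2 => shsum (fun w1 => shsum (fun w2 => F (a :: w1) w2) u2 v2) u1 v1) (b :: v) +
   splits (fun v1 v2 => shsum (fun w1 => shsum (fun w2 => F (b :: w1) w2) u2 v2) (a :: u1) v1) v.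
  rewrite !splits_cons !shsums0 -addrA -splitsD; congr (_ + _).
  by apply: eq_splits => p q; rewrite shsum_cons.
rewrite (eq_splits _ E) splitsD -!addrA; congr (_ + _).
rewrite addrCA; congr (_ + _).
by apply: eq_splits => p q; rewrite !shsum0s.
Qed.

Lemma shmul_conv A B u v :
  (forall i j, shmul A (take i u) (take j v)) ->
  (forall i j, shmul B (drop i u) (drop j v)) -> shmul (conv A B) u v.
Proof.
move=> HA HB; rewrite /shmul shsum_splits !convE splitsE mulr_suml.
apply: eq_bigr => i _; rewrite splitsE mulr_sumr; apply: eq_bigr => j _.
rewrite mulrACA HA HB /shsum mulr_suml; apply: eq_bigr => w _.
by rewrite mulr_sumr.
Qed.

Lemma shmul0s A v : A [::] = 1 -> shmul A [::] v.
Proof. by rewrite /shmul shsum0s => ->; rewrite mul1r. Qed.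

Lemma shmuls0 A u : A [::] = 1 -> shmul A u [::].
Proof. by rewrite /shmul shsums0 => ->; rewrite mulr1. Qed.

End ShuffleMultiplicative.

(** * Integrals over half-lines *)
Section RealIntegrals.
Variable R : realType.
Local Notation mu := (@lebesgue_measure R).
Implicit Types (f : R -> R) (a x y c M : R).

Lemma continuous_gt_within f a x : (forall t, a < t -> {for t, continuous f}) -> a < x ->
  {within `[x, +oo[, continuous f}.
Proof.
move=> cf ax; apply: continuous_in_subspaceT => t; rewrite inE/= in_itv/= andbT => xt.
by apply: cf; exact: lt_le_trans xt.
Qed.

Lemma expN_tail c x : 0 < c ->
  mu.-integrable `[x, +oo[ (EFin \o (fun t => expR (- (c * t)))) /\
  \int[mu]_(t in `[x, +oo[) expR (- (c * t)) = expR (- (c * x)) / c.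
Proof.
move=> c0; pose F t := - (expR (- (c * t)) / c).
have dF (t : R) : is_derive t (1 : R) F (expR (- (c * t))).
  by apply: is_derive_eq; rewrite /GRing.scale/=; field; rewrite gt_eqF.
have cf : continuous (fun t => expR (- (c * t))).
  move=> t; suff H : expR (- (c * z)) @[z --> t] --> expR (- (c * t)) by exact: H.
  by apply: cvg_expR; apply: cvgN; apply: cvgM; [exact: cvg_cst|exact: cvg_id].
have FTC : (\int[mu]_(t in `[x, +oo[) (expR (- (c * t)))%:E = 0%:E - (F x)%:E)%E.
  apply: (@ge0_continuous_FTC2y R (fun t => expR (- (c * t))) F x 0).
  - by move=> t _; exact: expR_ge0.
  - by apply: continuous_subspaceT.
  - rewrite -oppr0; apply: cvgN; rewrite -(mul0r c^-1); apply: cvgM; last exact: cvg_cst.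
    have H : c * t @[t --> +oo] --> +oo by apply: gt0_cvgMry => //; exact: cvg_id.
    exact: (cvg_comp _ _ H (@cvgr_expR R)).
  - by move=> t _; apply: ex_derive.
  - apply: cvg_at_right_filter; apply: differentiable_continuous.
    by apply/derivable1_diffP; exact: ex_derive.
  - by move=> t _; rewrite derive1E; exact: derive_val.
split; last by rewrite /Rintegral FTC /= sub0r opprK.
apply/integrableP; split.
  apply/measurable_EFinP; apply: measurable_funTS.
  exact: continuous_measurable_fun.
have E : (\int[mu]_(t in `[x, +oo[) `|(EFin \o (fun t : R => expR (- (c * t)))) t| =
    \int[mu]_(t in `[x, +oo[) (expR (- (c * t)))%:E)%E.
  by apply: eq_integral => t _; rewrite /= ger0_norm// expR_ge0.
by rewrite E FTC ltry.
Qed.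

Lemma tail_integral_bound f a M c x : 0 < c -> a < x ->
  (forall t, a < t -> {for t, continuous f}) ->
  (forall t, a < t -> `|f t| <= M * expR (- (c * t))) ->
  mu.-integrable `[x, +oo[ (EFin \o f) /\
  `|\int[mu]_(t in `[x, +oo[) f t| <= M * expR (- (c * x)) / c.
Proof.
move=> c0 ax cf fM.
have M0 : 0 <= M.
  have /(le_trans (normr_ge0 _)) := fM x ax.
  by rewrite pmulr_lge0// expR_gt0.
have [ie Ie] := expN_tail x c0.
have iM : mu.-integrable `[x, +oo[ (EFin \o (fun t => M * expR (- (c * t)))).
  have -> : EFin \o (fun t => M * expR (- (c * t))) = (fun t => M%:E * (EFin \o (fun t => expR (- (c * t)))) t)%E.
    by apply/funext => t; rewrite /= EFinM.
  exact: integrableZl.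
have mf : measurable_fun `[x, +oo[ f.
  by apply: subspace_continuous_measurable_fun => //; exact: continuous_gt_within ax.
have intf : mu.-integrable `[x, +oo[ (EFin \o f).
  apply: (le_integrable _ _ _ iM) => //; first exact/measurable_EFinP.
  move=> t; rewrite /= in_itv/= andbT => xt.
  by rewrite lee_fin (le_trans (fM t (lt_le_trans ax xt)))// ler_norm.
split => //; apply: (le_trans (le_normr_Rintegral _ intf)) => //.
rewrite -mulrA -Ie -RintegralZl//.
apply: le_Rintegral => //.
  by have := integrable_norm intf; apply: eq_integrable.
move=> t /=; rewrite in_itv/= andbT => xt.
exact: fM (lt_le_trans ax xt).
Qed.

Lemma is_derive_int f c x : (forall t, c <= t -> {for t, continuous f}) -> c < x ->
  is_derive x 1 (fun y => \int[mu]_(t in `[c, y]) f t) (f x).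
Proof.
move=> cf cx.
have int1 : mu.-integrable `[c, x + 1] (EFin \o f).
  apply: continuous_compact_integrable; first exact: segment_compact.
  apply: continuous_in_subspaceT => t; rewrite inE/= in_itv/= => /andP[ct _].
  exact: cf.
have [d1 d2] := continuous_FTC1_closed (ltr_pwDr ltr01 (lexx x)) int1 cx (cf x (ltW cx)).
by apply: DeriveDef; [exact: d1|rewrite -derive1E; exact: d2].
Qed.

(** On a neighbourhood of [x] the integral is a constant minus an integral over a
   segment, to which the fundamental theorem of calculus applies. *)
Lemma is_derive_tail f a x : a < x -> (forall t, a < t -> {for t, continuous f}) ->
  (forall y, a < y -> mu.-integrable `[y, +oo[ (EFin \o f)) ->
  is_derive x 1 (fun y => \int[mu]_(t in `[y, +oo[) f t) (- f x).
Proof.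
move=> ax cf intf; pose c := (a + x) / 2.
have ac : a < c by rewrite /c; lra.
have cx : c < x by rewrite /c; lra.
have cfc t : c <= t -> {for t, continuous f} by move=> ct; apply: cf; exact: lt_le_trans ct.
have D : is_derive x 1 (fun y => \int[mu]_(t in `[c, +oo[) f t - \int[mu]_(t in `[c, y]) f t) (- f x).
  have := is_derive_int cfc cx => H.
  exact: is_derive_eq (is_deriveB (is_derive_cst _ _ _) H) (sub0r _).
apply: near_eq_is_derive D; near=> y.
have cy : c < y by near: y; exact: lt_nbhsr.
rewrite Rintegral_itvB ?bnd_simp//; [|exact: intf|exact: ltW].
rewrite Rintegral_itv_obnd_cbnd//.
apply: integrableS (intf y _) => //; last exact: lt_trans cy.
by apply: subset_itvr; rewrite bnd_simp.
Unshelve. all: by end_near.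
Qed.

Definition prim1 f y : R :=
  if 1 <= y then \int[mu]_(t in `[1, y]) f t else - \int[mu]_(t in `[y, 1]) f t.

Lemma prim1_1 f : prim1 f 1 = 0.
Proof. by rewrite /prim1 lexx set_itv1 Rintegral_set1. Qed.

Lemma is_derive_prim1 f x : (forall t, 0 < t -> {for t, continuous f}) -> 0 < x ->
  is_derive x 1 (prim1 f) (f x).
Proof.
move=> cf x0; pose c := Num.min x 1 / 2.
have m0 : 0 < Num.min x 1 by rewrite lt_min x0 ltr01.
have mx : Num.min x 1 <= x by rewrite ge_min lexx.
have m1 : Num.min x 1 <= 1 :> R by rewrite ge_min lexx orbT.
have c0 : 0 < c by rewrite /c; lra.
have cx : c < x by rewrite /c; lra.
have c1 : c < 1 by rewrite /c; lra.
have cfc t : c <= t -> {for t, continuous f} by move=> ct; apply: cf; exact: lt_le_trans ct.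
have intf z w : c <= z -> mu.-integrable `[z, w] (EFin \o f).
  move=> cz; apply: continuous_compact_integrable; first exact: segment_compact.
  apply: continuous_in_subspaceT => t; rewrite inE/= in_itv/= => /andP[ct _].
  by apply: cfc; exact: le_trans ct.
have D : is_derive x 1 (fun y => \int[mu]_(t in `[c, y]) f t - \int[mu]_(t in `[c, 1]) f t) (f x).
  have := is_derive_int cfc cx => H.
  exact: is_derive_eq (is_deriveB H (is_derive_cst _ _ _)) (subr0 _).
apply: near_eq_is_derive D; near=> y.
have cy : c < y by near: y; exact: lt_nbhsr.
have B z w : c <= z -> z <= w -> \int[mu]_(t in `[z, w]) f t =
    \int[mu]_(t in `[c, w]) f t - \int[mu]_(t in `[c, z]) f t.
  move=> cz zw; rewrite Rintegral_itvB ?bnd_simp//; last exact: intf.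
  rewrite Rintegral_itv_obnd_cbnd//.
  apply: integrableS (intf z w cz) => //.
  by apply: subset_itvr; rewrite bnd_simp.
rewrite /prim1; case: ifPn => [y1|]; first by rewrite (B 1 y)// ltW.
by rewrite -ltNge => y1; rewrite (B y 1) ?ltW// opprB.
Unshelve. all: by end_near.
Qed.

Lemma is_derive0_eq f (I : interval R) x y : x \in I -> y \in I ->
  (forall t, t \in I -> is_derive t 1 f 0) -> f x = f y.
Proof.
wlog xy : x y / x <= y => [H|].
  by case: (leP x y) => [|/ltW] xy xI yI D; [|apply/esym]; apply: H.
move=> xI yI D.
have sub t : t \in `[x, y] -> t \in I.
  rewrite in_itv/= => txy; exact: (interval_is_interval xI yI txy).
have [||t _] := @MVT_segment R f (fun=> 0) x y xy.
- by move=> t txy; apply/D/sub; exact: subset_itv_oo_cc.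
- by apply: derivable_within_continuous => t /sub/D ?; exact: ex_derive.
by rewrite mul0r => /eqP; rewrite subr_eq0 => /eqP.
Qed.

End RealIntegrals.

(** * Complex valued functions of a real variable *)
Section ComplexParts.
Variable R : realType.
Local Notation C := R[i].
Implicit Types (z w : C).

Lemma cReD z w : complex.Re (z + w) = complex.Re z + complex.Re w.
Proof. by case: z w => a b [c d]. Qed.
Lemma cImD z w : complex.Im (z + w) = complex.Im z + complex.Im w.
Proof. by case: z w => a b [c d]. Qed.
Lemma cReN z : complex.Re (- z) = - complex.Re z. Proof. by case: z. Qed.
Lemma cImN z : complex.Im (- z) = - complex.Im z. Proof. by case: z. Qed.
Lemma cReM z w : complex.Re (z * w) =
  complex.Re z * complex.Re w - complex.Im z * complex.Im w.
Proof. by case: z w => a b [c d]. Qed.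
Lemma cImM z w : complex.Im (z * w) =
  complex.Re z * complex.Im w + complex.Im z * complex.Re w.
Proof. by case: z w => a b [c d]. Qed.
Lemma complexP z w : complex.Re z = complex.Re w -> complex.Im z = complex.Im w -> z = w.
Proof. by case: z w => a b [c d] /= -> ->. Qed.

Lemma normc_ge0 z : 0 <= normc z.
Proof. by case: z => a b; exact: sqrtr_ge0. Qed.

Lemma Re_le_normc z : `|complex.Re z| <= normc z.
Proof. by case: z => a b /=; rewrite -sqrtr_sqr ler_wsqrtr// lerDl sqr_ge0. Qed.

Lemma Im_le_normc z : `|complex.Im z| <= normc z.
Proof. by case: z => a b /=; rewrite -sqrtr_sqr ler_wsqrtr// lerDr sqr_ge0. Qed.

Lemma normcD z w : normc (z + w) <= normc z + normc w.
Proof. exact: le_normcD. Qed.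

Lemma normc_le_ReIm z : normc z <= `|complex.Re z| + `|complex.Im z|.
Proof.
rewrite {1}(_ : z = (complex.Re z)%:C + (0 +i* complex.Im z)); last first.
  by apply: complexP; rewrite ?cReD ?cImD /= ?addr0 ?add0r.
apply: le_trans (normcD _ _) _; case: z => a b /=.
by rewrite !expr0n/= !addr0 !add0r !sqrtr_sqr.
Qed.

Lemma normc_real (x : R) : normc x%:C = `|x|.
Proof. by rewrite /= expr0n/= addr0 sqrtr_sqr. Qed.

Lemma normc_sum (I : Type) (r : seq I) (P : pred I) (F : I -> C) :
  normc (\sum_(i <- r | P i) F i) <= \sum_(i <- r | P i) normc (F i).
Proof.
elim/big_rec2: _ => [|i y z _ yz]; first by rewrite normc0.
by apply: le_trans (normcD _ _) _; rewrite lerD2l.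
Qed.

End ComplexParts.

Section ComplexCalculus.
Variable R : realType.
Local Notation C := R[i].
Local Notation mu := (@lebesgue_measure R).
Implicit Types (f g : R -> C) (x : R).

(** Derivatives and continuity of complex valued functions of a real variable
   are taken componentwise, as [R[i]] is a normed space over itself only. *)
Definition cderiv f x (d : C) : Prop :=
  is_derive x (1 : R) (fun t => complex.Re (f t)) (complex.Re d) /\
  is_derive x (1 : R) (fun t => complex.Im (f t)) (complex.Im d).

Definition ccont f x : Prop :=
  {for x, continuous (fun t => complex.Re (f t))} /\
  {for x, continuous (fun t => complex.Im (f t))}.

Lemma cderiv_eq f x d d' : cderiv f x d -> d = d' -> cderiv f x d'.
Proof. by move=> + <-. Qed.

Lemma eq_cderiv f g x d : f =1 g -> cderiv f x d -> cderiv g x d.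
Proof. by move=> fg; rewrite (funext fg). Qed.

Lemma cderiv_ccont f x d : cderiv f x d -> ccont f x.
Proof.
by move=> [D1 D2]; split; apply: differentiable_continuous; apply/derivable1_diffP; exact: ex_derive.
Qed.

Lemma cderiv_cst (c : C) x : cderiv (fun=> c) x 0.
Proof. by split; exact: is_derive_cst. Qed.

Lemma cderivD f g x d e : cderiv f x d -> cderiv g x e ->
  cderiv (fun t => f t + g t) x (d + e).
Proof.
move=> [D1 D2] [E1 E2]; split.
  have -> : (fun t => complex.Re (f t + g t)) = (fun t => complex.Re (f t)) + (fun t => complex.Re (g t)).
    by apply/funext => t; rewrite cReD.
  by rewrite cReD; exact: is_deriveD.
have -> : (fun t => complex.Im (f t + g t)) = (fun t => complex.Im (f t)) + (fun t => complex.Im (g t)).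
  by apply/funext => t; rewrite cImD.
by rewrite cImD; exact: is_deriveD.
Qed.

Lemma cderivN f x d : cderiv f x d -> cderiv (fun t => - f t) x (- d).
Proof.
move=> [D1 D2]; split.
  have -> : (fun t => complex.Re (- f t)) = - (fun t => complex.Re (f t)).
    by apply/funext => t; rewrite cReN.
  by rewrite cReN; exact: is_deriveN.
have -> : (fun t => complex.Im (- f t)) = - (fun t => complex.Im (f t)).
  by apply/funext => t; rewrite cImN.
by rewrite cImN; exact: is_deriveN.
Qed.

Lemma cderivB f g x d e : cderiv f x d -> cderiv g x e ->
  cderiv (fun t => f t - g t) x (d - e).
Proof. by move=> Df Dg; exact: cderivD Df (cderivN Dg). Qed.

Lemma cderivM f g x d e : cderiv f x d -> cderiv g x e ->
  cderiv (fun t => f t * g t) x (d * g x + f x * e).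
Proof.
move=> [D1 D2] [E1 E2]; split.
  have -> : (fun t => complex.Re (f t * g t)) =
     (fun t => complex.Re (f t)) * (fun t => complex.Re (g t)) -
     (fun t => complex.Im (f t)) * (fun t => complex.Im (g t)).
    by apply/funext => t; rewrite cReM.
  apply: is_derive_eq (is_deriveB (is_deriveM D1 E1) (is_deriveM D2 E2)) _.
  by rewrite cReD !cReM /GRing.scale/=; ring.
have -> : (fun t => complex.Im (f t * g t)) =
     (fun t => complex.Re (f t)) * (fun t => complex.Im (g t)) +
     (fun t => complex.Im (f t)) * (fun t => complex.Re (g t)).
  by apply/funext => t; rewrite cImM.
apply: is_derive_eq (is_deriveD (is_deriveM D1 E2) (is_deriveM D2 E1)) _.
by rewrite cImD !cImM /GRing.scale/=; ring.
Qed.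

Lemma cderivZ (c : C) f x d : cderiv f x d -> cderiv (fun t => c * f t) x (c * d).
Proof.
by move=> Df; apply: cderiv_eq (cderivM (cderiv_cst c x) Df) _; rewrite mul0r add0r.
Qed.

Lemma cderiv_sum (I : eqType) (r : seq I) (F : I -> R -> C) (dF : I -> C) x :
  (forall i, i \in r -> cderiv (F i) x (dF i)) ->
  cderiv (fun t => \sum_(i <- r) F i t) x (\sum_(i <- r) dF i).
Proof.
elim: r => [|i r IH] H.
  rewrite big_nil; apply: eq_cderiv (cderiv_cst 0 x) => t; by rewrite big_nil.
rewrite big_cons; apply: (@eq_cderiv (fun t => F i t + \sum_(j <- r) F j t)) => [t|].
  by rewrite big_cons.
apply: cderivD; first by apply: H; rewrite mem_head.
by apply: IH => j jr; apply: H; rewrite in_cons jr orbT.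
Qed.

Lemma cderiv_comp f (g : R -> R) x d e : cderiv f (g x) d -> is_derive x (1 : R) g e ->
  cderiv (fun t => f (g t)) x (e%:C * d).
Proof.
move=> [D1 D2] E; split.
  by apply: is_derive_eq (is_derive1_comp D1 E) _; rewrite cReM/= mul0r subr0 mulrC.
by apply: is_derive_eq (is_derive1_comp D2 E) _; rewrite cImM/= mul0r addr0 mulrC.
Qed.

Lemma cderiv0_eq f (I : interval R) x y : x \in I -> y \in I ->
  (forall t, t \in I -> cderiv f t 0) -> f x = f y.
Proof.
move=> xI yI D; apply: complexP.
  by apply: (@is_derive0_eq _ (fun t => complex.Re (f t)) _ _ _ xI yI) => t /D[].
by apply: (@is_derive0_eq _ (fun t => complex.Im (f t)) _ _ _ xI yI) => t /D[].
Qed.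

Lemma ccont_cst (c : C) x : ccont (fun=> c) x.
Proof. exact: cderiv_ccont (cderiv_cst c x). Qed.

Lemma ccontD f g x : ccont f x -> ccont g x -> ccont (fun t => f t + g t) x.
Proof.
move=> [D1 D2] [E1 E2]; split.
  by rewrite (_ : (fun t => _) = fun t => complex.Re (f t) + complex.Re (g t));
    [exact: cvgD|apply/funext => t; rewrite cReD].
by rewrite (_ : (fun t => _) = fun t => complex.Im (f t) + complex.Im (g t));
    [exact: cvgD|apply/funext => t; rewrite cImD].
Qed.

Lemma ccontM f g x : ccont f x -> ccont g x -> ccont (fun t => f t * g t) x.
Proof.
move=> [D1 D2] [E1 E2]; split.
  rewrite (_ : (fun t => _) = fun t => complex.Re (f t) * complex.Re (g t) - complex.Im (f t) * complex.Im (g t)).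
    by apply: cvgB; exact: cvgM.
  by apply/funext => t; rewrite cReM.
rewrite (_ : (fun t => _) = fun t => complex.Re (f t) * complex.Im (g t) + complex.Im (f t) * complex.Re (g t)).
  by apply: cvgD; exact: cvgM.
by apply/funext => t; rewrite cImM.
Qed.

Lemma ccont_real (h : R -> R) x : {for x, continuous h} -> ccont (fun t => (h t)%:C) x.
Proof. by move=> ch; split => //=; exact: cvg_cst. Qed.

(** Functions on ]a, +oo[ smaller than every [exp (- n t)]: integrals over
   half-lines stay in this class, and so do products with functions of at most
   exponential growth. *)
Definition decaying (a : R) f : Prop :=
  (forall x, a < x -> ccont f x) /\
  forall n : nat, exists M, forall t, a < t -> normc (f t) <= M * expR (- (n%:R * t)).

Definition moderate (a : R) f : Prop :=
  (forall x, a < x -> ccont f x) /\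
  exists (n : nat) (M : R), forall t, a < t -> normc (f t) <= M * expR (n%:R * t).

Section Decaying.
Variable a : R.
Hypothesis a0 : 0 <= a.

Lemma decayingD f g : decaying a f -> decaying a g -> decaying a (fun t => f t + g t).
Proof.
move=> [cf Hf] [cg Hg]; split=> [x ax|n]; first by apply: ccontD; [exact: cf|exact: cg].
have [M HM] := Hf n; have [N HN] := Hg n; exists (M + N) => t ta.
by rewrite mulrDl; apply: le_trans (normcD _ _) _; apply: lerD; [exact: HM|exact: HN].
Qed.

Lemma decayingMl f g : moderate a f -> decaying a g -> decaying a (fun t => f t * g t).
Proof.
move=> [cf [k [M HM]]] [cg Hg]; split=> [x ax|n]; first by apply: ccontM; [exact: cf|exact: cg].
have [N HN] := Hg (k + n)%N; exists (M * N) => t ta; rewrite normcM.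
apply: le_trans (ler_pM _ _ (HM t ta) (HN t ta)) _; rewrite ?normc_ge0//.
by rewrite mulrACA -expRD natrD mulrDl opprD addrA subrr add0r.
Qed.

Lemma moderate_cst (c : C) : moderate a (fun=> c).
Proof.
split=> [x _|]; first exact: ccont_cst.
by exists 0%N, (normc c) => t _; rewrite mul0r expR0 mulr1.
Qed.

Lemma decaying_moderate f : decaying a f -> moderate a f.
Proof.
move=> [cf Hf]; split => //; have [M HM] := Hf 0%N; exists 0%N, M => t /HM.
by rewrite mul0r oppr0.
Qed.

Lemma decayingZ (c : C) f : decaying a f -> decaying a (fun t => c * f t).
Proof. by apply: decayingMl; exact: moderate_cst. Qed.

Lemma decaying0 : decaying a (fun=> 0).
Proof.
split=> [x _|n]; first exact: ccont_cst.
by exists 0 => t _; rewrite mul0r normc0.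
Qed.

Lemma decaying_sum (I : eqType) (r : seq I) (F : I -> R -> C) :
  (forall i, i \in r -> decaying a (F i)) -> decaying a (fun t => \sum_(i <- r) F i t).
Proof.
elim: r => [|i r IH] H.
  rewrite (_ : (fun t => _) = fun=> 0); first exact: decaying0.
  by apply/funext => t; rewrite big_nil.
rewrite (_ : (fun t => _) = fun t => F i t + \sum_(i <- r) F i t).
  apply: decayingD; first by apply: H; rewrite mem_head.
  by apply: IH => j jr; apply: H; rewrite in_cons jr orbT.
by apply/funext => t; rewrite big_cons.
Qed.

Definition tint x f : C := Cintegral mu `[x, +oo[%classic f.

Lemma Cintegrable_tail f x : a < x -> decaying a f -> Cintegrable mu `[x, +oo[%classic f.
Proof.
move=> ax [cf /(_ 1%N)[M HM]]; split.
  apply: (tail_integral_bound (f := fun t => complex.Re (f t)) (ltr01) ax _ _).1 => t ta.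
    by have [] := cf t ta.
  by apply: le_trans (Re_le_normc _) _; exact: HM.
apply: (tail_integral_bound (f := fun t => complex.Im (f t)) (ltr01) ax _ _).1 => t ta.
  by have [] := cf t ta.
by apply: le_trans (Im_le_normc _) _; exact: HM.
Qed.

Lemma tint_bound f M n : (forall x, a < x -> ccont f x) ->
  (forall t, a < t -> normc (f t) <= M * expR (- (n.+1%:R * t))) ->
  forall x, a < x -> normc (tint x f) <= 2 * M * expR (- (n%:R * x)).
Proof.
move=> cf fM x ax.
have n0 : 0 < n.+1%:R :> R by rewrite ltr0n.
have M0 : 0 <= M.
  have /(le_trans (normc_ge0 _)) := fM x ax.
  by rewrite pmulr_lge0// expR_gt0.
have E : M * expR (- (n.+1%:R * x)) / n.+1%:R <= M * expR (- (n%:R * x)).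
  rewrite ler_pdivrMr// -mulrA ler_wpM2l// -[leLHS]mulr1 ler_pM ?expR_ge0//.
    by rewrite ler_expR lerN2 ler_wpM2r ?ler_nat// (ltW (le_lt_trans a0 ax)).
  by rewrite ler1n.
apply: le_trans (normc_le_ReIm _) _; rewrite -mulrA mulr_natl mulr2n; apply: lerD.
  apply: le_trans E; apply: (tail_integral_bound n0 ax _ _).2 => t ta.
    by have [] := cf t ta.
  by apply: le_trans (Re_le_normc _) _; exact: fM.
apply: le_trans E; apply: (tail_integral_bound n0 ax _ _).2 => t ta.
  by have [] := cf t ta.
by apply: le_trans (Im_le_normc _) _; exact: fM.
Qed.

Lemma cderiv_tint f x : a < x -> decaying a f -> cderiv (tint ^~ f) x (- f x).
Proof.
move=> ax df; split; rewrite ?cReN ?cImN; apply: (is_derive_tail ax).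
- by move=> t /(df.1)[].
- by move=> y ay; have [] := Cintegrable_tail ay df.
- by move=> t /(df.1)[].
- by move=> y ay; have [] := Cintegrable_tail ay df.
Qed.

Lemma decaying_tint f : decaying a f -> decaying a (tint ^~ f).
Proof.
move=> df; split=> [x ax|n]; first exact: cderiv_ccont (cderiv_tint ax df).
have [M HM] := df.2 n.+1; exists (2 * M); apply: tint_bound => //; exact: df.1.
Qed.

Lemma decaying_cvg0 f : decaying a f -> forall e : R, 0 < e ->
  \forall t \near +oo, normc (f t) <= e.
Proof.
move=> [_ /(_ 1%N)[M HM]] e e0.
have H : M * expR (- t) @[t --> +oo] --> M * 0 by apply: cvgM; [exact: cvg_cst|exact: cvgr_expR].
rewrite mulr0 in H; move/cvgrPdist_le: H => /(_ e e0); near_simpl => H; near=> t.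
apply: le_trans (HM t _) _; first by near: t; apply: nbhs_pinfty_gt; exact: num_real.
have : `|0 - M * expR (- t)| <= e by near: t.
by rewrite sub0r normrN mul1r; apply: le_trans; exact: ler_norm.
Unshelve. all: by end_near.
Qed.

(** The difference is constant and tends to 0 at infinity. *)
Lemma decaying_eq f g : decaying a f -> decaying a g ->
  (forall x, a < x -> exists2 d, cderiv f x d & cderiv g x d) ->
  forall x, a < x -> f x = g x.
Proof.
move=> df dg D x ax.
have dfg : decaying a (fun t => f t - g t).
  have := decayingD df (decayingZ (-1) dg); congr decaying.
  by apply/funext => t; rewrite mulN1r.
have cst t : a < t -> f t - g t = f x - g x.
  move=> ta; apply: (@cderiv0_eq (fun t => f t - g t) `]a, +oo[); rewrite ?in_itv/= ?andbT//.
  move=> y; rewrite in_itv/= andbT => /D[d Df Dg].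
  by apply: cderiv_eq (cderivB Df Dg) _; rewrite subrr.
apply/eqP; rewrite -subr_eq0; apply/eqP/eq0_normc.
apply/eqP; rewrite eq_le normc_ge0 andbT leNgt; apply/negP => n0.
have : \forall t \near +oo, normc (f t - g t) <= normc (f x - g x) / 2.
  by apply: (decaying_cvg0 dfg); rewrite divr_gt0.
move=> H.
have [t [at_ Ht]] : exists t, a < t /\ normc (f t - g t) <= normc (f x - g x) / 2.
  near (pinfty_nbhs R) => t; exists t; split; last by near: t.
  by near: t; apply: nbhs_pinfty_gt; exact: num_real.
move: Ht; rewrite cst//; lra.
Unshelve. all: by end_near.
Qed.

Lemma tintZ (c : C) f x : a < x -> decaying a f -> tint x (fun t => c * f t) = c * tint x f.
Proof.
move=> ax df; have dcf := decayingZ c df.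
apply: (decaying_eq (decaying_tint dcf) (decayingZ c (decaying_tint df))) ax => y ay.
exists (- (c * f y)); first exact: cderiv_tint.
by apply: cderiv_eq (cderivZ c (cderiv_tint ay df)) _; rewrite mulrN.
Qed.

Lemma tintD f g x : a < x -> decaying a f -> decaying a g ->
  tint x (fun t => f t + g t) = tint x f + tint x g.
Proof.
move=> ax df dg.
apply: (decaying_eq (decaying_tint (decayingD df dg))
  (decayingD (decaying_tint df) (decaying_tint dg))) ax => y ay.
exists (- (f y + g y)); first by apply: cderiv_tint => //; exact: decayingD.
by apply: cderiv_eq (cderivD (cderiv_tint ay df) (cderiv_tint ay dg)) _; rewrite opprD.
Qed.

Lemma tint_sum (I : eqType) (r : seq I) (F : I -> R -> C) x : a < x ->
  (forall i, i \in r -> decaying a (F i)) ->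
  tint x (fun t => \sum_(i <- r) F i t) = \sum_(i <- r) tint x (F i).
Proof.
move=> ax dF.
apply: (decaying_eq (decaying_tint (decaying_sum dF))
  (decaying_sum (fun i ir => decaying_tint (dF i ir)))) ax => y ay.
exists (- \sum_(i <- r) F i y); first by apply: cderiv_tint => //; exact: decaying_sum.
have := cderiv_sum (fun i ir => cderiv_tint ay (dF i ir)).
by rewrite sumrN.
Qed.

End Decaying.
End ComplexCalculus.

(** * Complex powers and the forms of theta *)
Section ComplexPowers.
Variable R : realType.
Local Notation C := R[i].
Implicit Types (t x : R) (z w : C).

Lemma normc_cis x : normc (cis x) = 1.
Proof. by rewrite /= cos2Dsin2 sqrtr1. Qed.

Lemma cpowE t z : cpow t z = (expR (complex.Re z * ln t))%:C * cis (complex.Im z * ln t).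
Proof. by []. Qed.

Lemma cpowD t z w : cpow t (z + w) = cpow t z * cpow t w.
Proof.
by rewrite !cpowE cReD cImD !mulrDl expRD cisD rmorphM /= mulrACA.
Qed.

Lemma cpowt0 t : cpow t 0 = 1.
Proof. by rewrite cpowE /= !mul0r expR0 cis0 mulr1. Qed.

Lemma cpow1z z : cpow 1 z = 1.
Proof. by rewrite cpowE ln1 !mulr0 expR0 cis0 mulr1. Qed.

Lemma normc_cpow t z : normc (cpow t z) = expR (complex.Re z * ln t).
Proof. by rewrite cpowE normcM normc_cis mulr1 normc_real ger0_norm ?expR_ge0. Qed.

Lemma cpowV t z : 0 < t -> cpow t^-1 z = cpow t (- z).
Proof. by move=> t0; rewrite !cpowE lnV ?posrE// cReN cImN !mulrN !mulNr. Qed.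

Lemma cpowtN1 t : 0 < t -> cpow t (-1) = (t^-1)%:C.
Proof.
by move=> t0; rewrite cpowE /= oppr0 mul0r mulN1r expRN lnK ?posrE// cis0 mulr1.
Qed.

Lemma cpowt1 t : 0 < t -> cpow t 1 = t%:C.
Proof. by move=> t0; rewrite cpowE /= mul0r mul1r lnK ?posrE// cis0 mulr1. Qed.

Lemma cderiv_cpow t z : 0 < t -> cderiv (fun x => cpow x z) t (z * cpow t (z - 1)).
Proof.
move=> t0.
pose h (y : R) : C := (expR (complex.Re z * y))%:C * cis (complex.Im z * y).
have Dh y : cderiv h y (z * h y).
  have DE : cderiv (fun y => (expR (complex.Re z * y))%:C) y (complex.Re z * expR (complex.Re z * y))%:C.
    split => /=; last exact: is_derive_cst.
    by apply: is_derive_eq; rewrite /GRing.scale/=; ring.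
  have DC : cderiv (fun y => cis (complex.Im z * y)) y
     ((- (complex.Im z * sin (complex.Im z * y))) +i* (complex.Im z * cos (complex.Im z * y))).
    by split => /=; apply: is_derive_eq; rewrite /GRing.scale/=; ring.
  apply: cderiv_eq (cderivM DE DC) _; apply: complexP; rewrite /h !(cReD, cImD, cReM, cImM) /=; ring.
apply: cderiv_eq (cderiv_comp (Dh (ln t)) (is_derive1_ln t0)) _.
by rewrite cpowD cpowtN1// -[h _]/(cpow t z) mulrC mulrA.
Qed.

Lemma ccont_cpow t z : 0 < t -> ccont (fun x => cpow x z) t.
Proof. by move=> t0; exact: cderiv_ccont (cderiv_cpow z t0). Qed.

Lemma abs_ln_le (a t : R) : 0 < a -> a < t -> `|ln t| <= t + `|ln a|.
Proof.
move=> a0 at_; have t0 : 0 < t by exact: lt_trans at_.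
have l1 : ln t <= t - 1 by have := @le_ln1Dx R (t - 1); rewrite (_ : 1 + (t - 1) = t); [apply; lra|ring].
have l2 : ln a <= ln t by rewrite ler_ln ?posrE// ltW.
have := ler_norm (- ln a); rewrite normrN => l3; have := normr_ge0 (ln a) => l4.
rewrite ler_norml; apply/andP; split; lra.
Qed.

Lemma nat_ge (c : R) : exists n : nat, c <= n%:R.
Proof. by exists (Num.truncn c).+1; apply/ltW/truncnS_gt. Qed.

Lemma moderate_cpow (a : R) z : 0 < a -> moderate a (fun t => cpow t z).
Proof.
move=> a0; split=> [t ta|]; first by apply: ccont_cpow; exact: lt_trans ta.
have [n zn] := nat_ge `|complex.Re z|; exists n, (expR (n%:R * `|ln a|)) => t ta.
rewrite normc_cpow -expRD ler_expR -mulrDr addrC.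
apply: le_trans (ler_norm _) _; rewrite normrM ler_pM//.
exact: abs_ln_le.
Qed.

End ComplexPowers.

Section ThetaForms.
Variable R : realType.
Local Notation C := R[i].
Implicit Types (t x a : R) (z w : C).

Lemma theta_zero_ge0 t : 0 <= theta_zero t.
Proof. by rewrite theta_zeroE mulr_ge0// jacobi0_ge0. Qed.

Lemma theta_split t : 0 < t -> theta t = theta_infty t + theta_zero t.
Proof. by move=> t0; rewrite thetaE// theta_zeroE. Qed.

Lemma theta_zero_le a t : 0 < a -> a <= t ->
  theta_zero t <= 2 / (1 - expR (- (pi * a ^+ 2))) * expR (- (pi * t ^+ 2)).
Proof.
move=> a0 at_; have t0 : 0 < t by exact: lt_le_trans at_.
have p0 := pi_gt0 R.
have pa : 0 < pi * a ^+ 2 by rewrite mulr_gt0 ?exprn_gt0.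
have pt : 0 < pi * t ^+ 2 by rewrite mulr_gt0 ?exprn_gt0.
rewrite theta_zeroE -mulrA ler_pM2l//; apply: le_trans (jacobi0_le pt) _.
rewrite mulrC ler_pM2r ?expR_gt0// lef_pV2 ?posrE ?subr_gt0 ?expR_lt1 ?oppr_lt0//.
by rewrite lerD2l lerN2 ler_expR lerN2 ler_pM2l//; apply: lerXn2r => //; rewrite nnegrE ltW.
Qed.

(** From [n t <= n ^ 2 + t ^ 2] and [1 <= pi]. *)
Lemma expR_sq_decay (n : nat) t : expR (- (pi * t ^+ 2)) <= expR (n%:R ^+ 2) * expR (- (n%:R * t)).
Proof.
rewrite -expRD ler_expR; have := pi_ge2 R.
have := sqr_ge0 t; have := sqr_ge0 (n%:R - t); nra.
Qed.

Lemma continuous_theta_zero t : 0 < t -> {for t, continuous (@theta_zero R)}.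
Proof.
move=> t0; rewrite (_ : @theta_zero R = fun x => 2 * jacobi0 (pi * x ^+ 2)); last first.
  by apply/funext => x; rewrite theta_zeroE.
have pt : 0 < pi * t ^+ 2 by rewrite mulr_gt0 ?exprn_gt0 ?pi_gt0.
have H : pi * x ^+ 2 @[x --> t] --> pi * t ^+ 2.
  by apply: cvgM; [exact: cvg_cst|exact: exprn_continuous].
suff G : 2 * jacobi0 (pi * x ^+ 2) @[x --> t] --> 2 * jacobi0 (pi * t ^+ 2) by exact: G.
apply: cvgM; first exact: cvg_cst.
exact: (cvg_comp _ _ H (continuous_jacobi0 pt)).
Qed.

Lemma continuous_theta t : 0 < t -> {for t, continuous (@theta R)}.
Proof.
move=> t0; suff G : theta x @[x --> t] --> theta t by exact: G.
have H : theta_infty x + theta_zero x @[x --> t] --> theta_infty t + theta_zero t.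
  by apply: cvgD; [exact: cvg_cst|exact: continuous_theta_zero].
rewrite theta_split//; apply: cvg_trans H; apply: near_eq_cvg.
have := lt_nbhsr t0; apply: filterS => x x0; by rewrite theta_split.
Qed.

Lemma decaying_theta_zero a : 0 < a -> decaying a (fun t => (theta_zero t)%:C : C).
Proof.
move=> a0; split=> [x ax|n].
  by apply: ccont_real; apply: continuous_theta_zero; exact: lt_trans ax.
exists (2 / (1 - expR (- (pi * a ^+ 2))) * expR (n%:R ^+ 2)) => t ta.
rewrite normc_real ger0_norm ?theta_zero_ge0//.
apply: le_trans (theta_zero_le a0 (ltW ta)) _; rewrite -[leRHS]mulrA ler_pM2l ?expR_sq_decay//.
by rewrite divr_gt0// subr_gt0 expR_lt1 oppr_lt0 mulr_gt0 ?pi_gt0 ?exprn_gt0.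
Qed.

Lemma moderateD a (f g : R -> C) : 0 <= a ->
  moderate a f -> moderate a g -> moderate a (fun t => f t + g t).
Proof.
move=> a0 [cf [n [M HM]]] [cg [m [N HN]]]; split=> [x ax|].
  by apply: ccontD; [exact: cf|exact: cg].
have nneg (k : nat) (B : R) (h : R -> C) :
    (forall t, a < t -> normc (h t) <= B * expR (k%:R * t)) -> 0 <= B.
  move=> /(_ (a + 1)); rewrite ltrDl ltr01 => /(_ isT) /(le_trans (normc_ge0 _)).
  by rewrite pmulr_lge0// expR_gt0.
exists (n + m)%N, (M + N) => t ta; have t0 : 0 <= t by exact: ltW (le_lt_trans a0 ta).
rewrite mulrDl; apply: le_trans (normcD _ _) _; apply: lerD.
  apply: le_trans (HM t ta) _; rewrite ler_wpM2l ?(nneg _ _ _ HM)// ler_expR.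
  by rewrite ler_wpM2r// ler_nat leq_addr.
apply: le_trans (HN t ta) _; rewrite ler_wpM2l ?(nneg _ _ _ HN)// ler_expR.
by rewrite ler_wpM2r// ler_nat leq_addl.
Qed.

Lemma moderateM a (f g : R -> C) :
  moderate a f -> moderate a g -> moderate a (fun t => f t * g t).
Proof.
move=> [cf [n [M HM]]] [cg [m [N HN]]]; split=> [x ax|].
  by apply: ccontM; [exact: cf|exact: cg].
exists (n + m)%N, (M * N) => t ta; rewrite normcM natrD mulrDl expRD mulrACA.
by apply: ler_pM; rewrite ?normc_ge0// ?HM ?HN.
Qed.

Lemma eq_moderate a (f g : R -> C) : (forall x, a < x -> ccont g x) ->
  (forall t, a < t -> f t = g t) -> moderate a f -> moderate a g.
Proof.
move=> cg fg [_ [n [M HM]]]; split => //.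
by exists n, M => t ta; rewrite -fg// HM.
Qed.

Lemma ccont_theta x : 0 < x -> ccont (fun t => (theta t)%:C : C) x.
Proof. by move=> x0; apply: ccont_real; exact: continuous_theta. Qed.

Lemma moderate_theta a : 0 < a -> moderate a (fun t => (theta t)%:C : C).
Proof.
move=> a0; apply: (@eq_moderate _ (fun t => 1 + (theta_zero t)%:C)).
- by move=> x ax; apply: ccont_theta; exact: lt_trans ax.
- by move=> t ta; rewrite theta_split ?rmorphD//; exact: lt_trans ta.
apply: moderateD; [exact: ltW|exact: moderate_cst|].
exact/decaying_moderate/decaying_theta_zero.
Qed.

(** Near 0 the series [theta t] is of size [1 / t], which the power [t ^ (z - 1)]
   compensates as soon as [Re z >= 2]: the forms are then bounded on [0, 1]
   and the exponents of all the estimates can be taken uniform on [t > 0]. *)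
Definition admissible a z := (0 < a) || ((0 <= a) && (2 <= complex.Re z)).

(** By the functional equation, [t * theta t] is the value of [theta] at [1 / t],
   and [theta] is bounded on [1, +oo[. *)
Lemma theta_bounded1 : exists B : R, forall t, 0 < t -> t <= 1 -> t * theta t <= B.
Proof.
exists (1 + 2 / (1 - expR (- (pi * 1 ^+ 2)))) => t t0 t1.
have t1' : 1 <= t^-1 by rewrite invf_ge1.
rewrite -theta_inv// theta_split ?invr_gt0// lerD2l.
apply: le_trans (theta_zero_le ltr01 t1') _; rewrite ler_piMr//.
  by rewrite divr_ge0// subr_ge0 ltW// expR_lt1 oppr_lt0 mulr_gt0 ?pi_gt0.
by rewrite -expR0 ler_expR oppr_le0 mulr_ge0 ?pi_ge0 ?sqr_ge0.
Qed.

Lemma ccont_mellin phi x z : 0 < x -> {for x, continuous phi} ->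
  ccont (mellin_form phi z : R -> C) x.
Proof. by move=> x0 cphi; apply: ccontM; [exact: ccont_real|exact: ccont_cpow]. Qed.

Lemma mellin_bounded1 phi z : 2 <= complex.Re z ->
  (forall t, 0 < t -> 0 <= phi t <= theta t) ->
  exists2 B : R, 0 <= B & forall t, 0 < t -> t <= 1 -> normc (mellin_form phi z t) <= B.
Proof.
move=> z2 phit; have [B HB] := theta_bounded1; exists B.
  apply: le_trans (HB 1 ltr01 (lexx _)); rewrite mul1r.
  by case/andP: (phit 1 ltr01); exact: le_trans.
move=> t t0 t1; have /andP[p0 pt] := phit t t0.
rewrite normcM normc_real ger0_norm// normc_cpow.
apply: le_trans (HB t t0 t1); rewrite mulrC ler_pM ?expR_ge0//.
rewrite -{2}(lnK (_ : t \is Num.pos))// ler_expR cReD/=.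
have : ln t <= 0 by rewrite ln_le0.
nra.
Qed.

(** A bound on ]0, 1] only affects the constants of the exponential bounds. *)
Lemma decaying_glue (f : R -> C) B : (forall x, 0 < x -> ccont f x) -> 0 <= B ->
  (forall t, 0 < t -> t <= 1 -> normc (f t) <= B) -> decaying 1 f -> decaying 0 f.
Proof.
move=> cf B0 HB [_ Hf]; split => // n; have [M HM] := Hf n.
exists (B * expR n%:R + `|M|) => t t0; rewrite mulrDl.
case: (leP t 1) => t1.
  apply: le_trans (HB t t0 t1) _; rewrite -[leLHS]addr0; apply: lerD; last first.
    by rewrite mulr_ge0 ?expR_ge0.
  rewrite -mulrA -expRD ler_peMr// -[leLHS]expR0 ler_expR subr_ge0.
  by rewrite ler_piMr.
apply: le_trans (HM t t1) _; rewrite -[leLHS]add0r; apply: lerD.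
  by rewrite mulr_ge0 ?expR_ge0// mulr_ge0 ?expR_ge0.
by rewrite ler_wpM2r ?expR_ge0// ler_norm.
Qed.

Lemma moderate_glue (f : R -> C) B : (forall x, 0 < x -> ccont f x) -> 0 <= B ->
  (forall t, 0 < t -> t <= 1 -> normc (f t) <= B) -> moderate 1 f -> moderate 0 f.
Proof.
move=> cf B0 HB [_ [n [M HM]]]; split => //; exists n, (B + `|M|) => t t0; rewrite mulrDl.
case: (leP t 1) => t1.
  apply: le_trans (HB t t0 t1) _; rewrite -[leLHS]addr0; apply: lerD; last first.
    by rewrite mulr_ge0 ?expR_ge0.
  by rewrite ler_peMr// -[leLHS]expR0 ler_expR mulr_ge0// ltW.
apply: le_trans (HM t t1) _; rewrite -[leLHS]add0r; apply: lerD.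
  by rewrite mulr_ge0 ?expR_ge0.
by rewrite ler_wpM2r ?expR_ge0// ler_norm.
Qed.

Lemma ccont_mellin_theta x z : 0 < x -> ccont (mellin_form theta z : R -> C) x.
Proof. by move=> x0; apply: ccont_mellin => //; exact: continuous_theta. Qed.

Lemma ccont_mellin_zero x z : 0 < x -> ccont (mellin_form theta_zero z : R -> C) x.
Proof. by move=> x0; apply: ccont_mellin => //; exact: continuous_theta_zero. Qed.

Lemma ccont_mellin_infty x z : 0 < x -> ccont (mellin_form theta_infty z : R -> C) x.
Proof. by move=> x0; apply: ccont_mellin => //; exact: cvg_cst. Qed.

Lemma theta_infty_itv t : 0 < t -> 0 <= theta_infty t <= theta t.
Proof. by move=> t0; rewrite theta_split// /theta_infty ler01 lerDl theta_zero_ge0. Qed.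

Lemma theta_zero_itv t : 0 < t -> 0 <= theta_zero t <= theta t.
Proof. by move=> t0; rewrite theta_split// /theta_infty theta_zero_ge0 lerDr ler01. Qed.

Lemma theta_itv t : 0 < t -> 0 <= theta t <= theta t.
Proof. by move=> t0; rewrite lexx andbT; case/andP: (theta_zero_itv t0) => /le_trans; apply. Qed.

Lemma decaying_theta_zero_form a z : admissible a z -> decaying a (mellin_form theta_zero z : R -> C).
Proof.
have pos b : 0 < b -> decaying b (mellin_form theta_zero z : R -> C).
  move=> b0; rewrite (_ : mellin_form theta_zero z = fun t => cpow t (z - 1) * (theta_zero t)%:C).
    by apply: decayingMl; [exact: moderate_cpow|exact: decaying_theta_zero].
  by apply/funext => t; rewrite mulrC.
case/orP => [/pos//|/andP[]]; rewrite le_eqVlt => /orP[/eqP<- z2|/pos//].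
have [B B0 HB] := mellin_bounded1 z2 theta_zero_itv.
by apply: (decaying_glue _ B0 HB (pos 1 ltr01)) => x; exact: ccont_mellin_zero.
Qed.

Lemma moderate_theta_form a z : admissible a z -> moderate a (mellin_form theta z : R -> C).
Proof.
have pos b : 0 < b -> moderate b (mellin_form theta z : R -> C).
  by move=> b0; apply: moderateM; [exact: moderate_theta|exact: moderate_cpow].
case/orP => [/pos//|/andP[]]; rewrite le_eqVlt => /orP[/eqP<- z2|/pos//].
have [B B0 HB] := mellin_bounded1 z2 theta_itv.
by apply: (moderate_glue _ B0 HB (pos 1 ltr01)) => x; exact: ccont_mellin_theta.
Qed.

Lemma moderate_theta_infty_form a z : admissible a z -> moderate a (mellin_form theta_infty z : R -> C).
Proof.
have pos b : 0 < b -> moderate b (mellin_form theta_infty z : R -> C).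
  by move=> b0; apply: moderateM; [exact: (moderate_cst _ 1)|exact: moderate_cpow].
case/orP => [/pos//|/andP[]]; rewrite le_eqVlt => /orP[/eqP<- z2|/pos//].
have [B B0 HB] := mellin_bounded1 z2 theta_infty_itv.
by apply: (moderate_glue _ B0 HB (pos 1 ltr01)) => x; exact: ccont_mellin_infty.
Qed.

Lemma mellin_split z t : 0 < t ->
  mellin_form theta z t = mellin_form theta_infty z t + mellin_form theta_zero z t :> C.
Proof. by move=> t0; rewrite /mellin_form -mulrDl -rmorphD -theta_split. Qed.

End ThetaForms.

(** * Regularised iterated integrals *)
Section IteratedTails.
Variable R : realType.
Local Notation C := R[i].
Implicit Types (t x a : R) (z : C).

(** The iterated integral over [x <= t_1 <= ... <= t_n]; the smallest variable, that of
   the first letter, is the outermost one. *)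
Fixpoint titer x (w : seq (R -> C)) : C :=
  if w is g :: w' then tint x (fun t => g t * titer t w') else 1.

(** Letters of the words of the regularisation: [inl z] and [inr z] stand for
   the forms of [theta] and of its constant term. *)
Definition letter : Type := (C + C)%type.

Definition dens (l : letter) : R -> C :=
  match l with inl z => mellin_form theta z | inr z => mellin_form theta_infty z end.

Definition exponent (l : letter) : C := match l with inl z => z | inr z => z end.

Definition all_admissible a (u : seq C) : Prop := forall z, z \in u -> admissible a z.

Definition admissible_word a (w : seq letter) : Prop :=
  forall l, l \in w -> admissible a (exponent l).

Lemma moderate_dens a l : admissible a (exponent l) -> moderate a (dens l).
Proof. by case: l => z; [exact: moderate_theta_form|exact: moderate_theta_infty_form]. Qed.

Lemma admissible_word_cons a l w : admissible_word a (l :: w) ->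
  admissible a (exponent l) /\ admissible_word a w.
Proof.
by move=> H; split=> [|k kw]; apply: H; rewrite in_cons ?eqxx// kw orbT.
Qed.

Lemma decaying_titer a w c : 0 <= a -> admissible_word a w -> decaying a c ->
  decaying a (titer ^~ (rcons (map dens w) c)).
Proof.
move=> a0; elim: w => [|l w IH] Hw dc /=.
  apply: decaying_tint => //.
  by rewrite (_ : (fun t => c t * 1) = c)//; apply/funext => t; rewrite mulr1.
have [Hl {}Hw] := admissible_word_cons Hw.
apply: decaying_tint => //; apply: decayingMl; first exact: moderate_dens.
exact: IH.
Qed.

Lemma cderiv_titer a l w c x : 0 <= a -> a < x -> admissible_word a (l :: w) -> decaying a c ->
  cderiv (titer ^~ (rcons (map dens (l :: w)) c)) x (- (dens l x * titer x (rcons (map dens w) c))).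
Proof.
move=> a0 ax Hw dc; have [Hl {}Hw] := admissible_word_cons Hw.
have D : decaying a (fun t => dens l t * titer t (rcons (map dens w) c)).
  by apply: decayingMl; [exact: moderate_dens|exact: decaying_titer].
exact: (cderiv_tint ax D).
Qed.

Lemma cderiv_titer1 a c x : 0 <= a -> a < x -> decaying a c ->
  cderiv (titer ^~ [:: c]) x (- c x).
Proof.
move=> a0 ax dc; rewrite -[c x](mulr1 (c x)).
have D : decaying a (fun t => c t * 1).
  by rewrite (_ : (fun t => c t * 1) = c)//; apply/funext => t; rewrite mulr1.
exact: (cderiv_tint ax D).
Qed.

Definition shiter x (p q : seq letter) c : C :=
  shsum (fun w => titer x (rcons (map dens w) c)) p q.

Lemma admissible_shuffle a p q w : admissible_word a p -> admissible_word a q ->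
  w \in shuffle p q -> admissible_word a w.
Proof.
move=> Hp Hq /mem_shuffle/perm_mem E l; rewrite E mem_cat => /orP[]; [exact: Hp|exact: Hq].
Qed.

Lemma decaying_shiter a p q c : 0 <= a -> admissible_word a p -> admissible_word a q ->
  decaying a c -> decaying a (fun x => shiter x p q c).
Proof.
move=> a0 Hp Hq dc; apply: decaying_sum => // w wpq; apply: decaying_titer => //.
exact: admissible_shuffle wpq.
Qed.

Definition shiter_deriv x (p q : seq letter) c : C :=
  (if p is l :: p' then dens l x * shiter x p' q c else 0) +
  (if q is l :: q' then dens l x * shiter x p q' c else 0) +
  (if nilp p && nilp q then c x else 0).

(** The first letter of a shuffle comes from [p] or from [q], and the last letter [c]
   is reached first only when both are empty. *)
Lemma cderiv_shiter a p q c x : 0 <= a -> a < x -> admissible_word a p -> admissible_word a q ->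
  decaying a c -> cderiv (fun x => shiter x p q c) x (- shiter_deriv x p q c).
Proof.
move=> a0 ax Hp Hq dc.
pose d w := if w is l :: w' then dens l x * titer x (rcons (map dens w') c) else c x.
have D : cderiv (fun x => shiter x p q c) x (\sum_(w <- shuffle p q) - d w).
  apply: cderiv_sum => w /(admissible_shuffle Hp Hq) Hw.
  by case: w Hw => [_|l w Hw]; [exact: (cderiv_titer1 a0 ax)|exact: (cderiv_titer a0 ax)].
apply: cderiv_eq D _; rewrite sumrN; congr (- _).
rewrite -/(shsum d p q) /shiter_deriv; case: p Hp => [|l p] Hp; case: q Hq => [|k q] Hq.
- by rewrite shsum0s /= !add0r.
- by rewrite shsum0s /= /shiter shsum0s add0r addr0.
- by rewrite shsums0 /= /shiter shsums0 !addr0.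
rewrite shsum_cons /= addr0; congr (_ + _); rewrite /shiter /shsum mulr_sumr.
  by apply: eq_bigr.
by apply: eq_bigr.
Qed.

(** The integral from [x] to infinity of the regularisation of the word with exponents
   [u], which is 1 for the empty word. *)
Definition regint x (u : seq C) : C :=
  if u is [::] then 1 else
  \sum_(i < size u) (-1) ^+ (size u - i.+1) *
    shiter x (map inl (take i u)) (map inr (rev (drop i.+1 u)))
      (mellin_form theta_zero (nth 0 u i)).

Arguments regint : simpl never.

Lemma regintE x u : u != [::] -> regint x u = \sum_(i < size u) (-1) ^+ (size u - i.+1) *
    shiter x (map inl (take i u)) (map inr (rev (drop i.+1 u)))
      (mellin_form theta_zero (nth 0 u i)).
Proof. by case: u. Qed.

Lemma admissible_inl a u : all_admissible a u -> admissible_word a (map inl u).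
Proof. by move=> H l /mapP[z zu ->]; exact: H. Qed.

Lemma admissible_inr a u : all_admissible a u -> admissible_word a (map inr u).
Proof. by move=> H l /mapP[z zu ->]; exact: H. Qed.

Lemma all_admissible_sub a u v : {subset v <= u} -> all_admissible a u -> all_admissible a v.
Proof. by move=> vu Hu z /vu; exact: Hu. Qed.

Section Regularised.
Variables (a : R) (a0 : 0 <= a).

Lemma decaying_regint_term u i : all_admissible a u -> (i < size u)%N ->
  decaying a (fun x => shiter x (map inl (take i u)) (map inr (rev (drop i.+1 u)))
      (mellin_form theta_zero (nth 0 u i))).
Proof.
move=> Hu iu; apply: decaying_shiter => //.
- by apply/admissible_inl/all_admissible_sub/Hu => z; exact: mem_take.
- by apply/admissible_inr/all_admissible_sub/Hu => z; rewrite mem_rev; exact: mem_drop.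
by apply/decaying_theta_zero_form/Hu/mem_nth.
Qed.

Lemma decaying_regint u : all_admissible a u -> u != [::] -> decaying a (regint ^~ u).
Proof.
move=> Hu u0; rewrite (funext (fun x => regintE x u0)).
by apply: decaying_sum => i _; apply: decayingZ; apply: decaying_regint_term.
Qed.

Definition thetaf x z : C := mellin_form theta z x.
Definition inftyf x z : C := mellin_form theta_infty z x.

(** In the alternating sum defining [regint], the terms whose first letter comes from
   the [theta] block form the regularised integral of the tail of [u]. Those whose
   first letter comes from the reversed block form that of [u] without its last
   letter, with the opposite sign. A word of one letter gives the same formula, since
   [- theta_zero] is minus [theta] plus its constant term. *)
Lemma cderiv_regint u x : all_admissible a u -> a < x -> cderiv (regint ^~ u) x
  (- Lop (thetaf x) (regint x) u + Rop (inftyf x) (regint x) u).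
Proof.
move=> Hu ax; case: (eqVneq u [::]) => [->|u0].
  by rewrite /= oppr0 addr0; exact: cderiv_cst.
have x0 : 0 < x by exact: le_lt_trans ax.
have D : cderiv (regint ^~ u) x (\sum_(i < size u) (-1) ^+ (size u - i.+1) *
   - shiter_deriv x (map inl (take i u)) (map inr (rev (drop i.+1 u)))
      (mellin_form theta_zero (nth 0 u i))).
  rewrite (funext (fun x => regintE x u0)).
  apply: cderiv_sum => i _; apply: cderivZ; apply: (cderiv_shiter a0 ax).
  - by apply/admissible_inl/all_admissible_sub/Hu => z; exact: mem_take.
  - by apply/admissible_inr/all_admissible_sub/Hu => z; rewrite mem_rev; exact: mem_drop.
  by apply/decaying_theta_zero_form/Hu/mem_nth.
apply: cderiv_eq D _; move: u0 {Hu}; case: u => // b [|b' u] _.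
  rewrite /= big_ord_recl big_ord0 /= expr0 mul1r addr0 /shiter_deriv /= !add0r mulr1 mul1r.
  by rewrite /thetaf /inftyf mellin_split// opprD addrAC addNr add0r.
set v := b' :: u; have v0 : v != [::] by [].
have [w [c E]] : exists w c, b :: v = rcons w c by exists (belast b v), (last b v); exact: lastI.
have sw : size w = size v by have := congr1 size E; rewrite size_rcons => -[].
have w0 : w != [::] by rewrite -size_eq0 sw.
have -> : Rop (inftyf x) (regint x) (b :: v) = regint x w * inftyf x c.
  by rewrite E Rop_rcons.
have -> : Lop (thetaf x) (regint x) (b :: v) = thetaf x b * regint x v by [].
rewrite (regintE x v0) (regintE x w0).
pose A i := if take i (b :: v) is y :: p' then thetaf x y *
  shiter x (map inl p') (map inr (rev (drop i.+1 (b :: v)))) (mellin_form theta_zero (nth 0 (b :: v) i)) else 0.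
pose B i := if rev (drop i.+1 (rcons w c)) is y :: q' then inftyf x y *
  shiter x (map inl (take i (rcons w c))) (map inr q') (mellin_form theta_zero (nth 0 (rcons w c) i)) else 0.
have AB i : (i < size (b :: v))%N ->
    shiter_deriv x (map inl (take i (b :: v))) (map inr (rev (drop i.+1 (b :: v))))
      (mellin_form theta_zero (nth 0 (b :: v) i)) = A i + B i.
  move=> ib; rewrite /shiter_deriv /B -E.
  set nn := nilp _ && nilp _; have -> : nn = false.
    rewrite /nn /nilp !size_map size_rev size_take size_drop ib /=.
    by move: ib; rewrite /v /=; lia.
  rewrite addr0 /A; congr (_ + _).
    by case: (take i (b :: v)).
  by case: (rev _).
rewrite (eq_bigr (fun i : 'I_(size (b :: v)) => - ((-1) ^+ (size (b :: v) - i.+1) * A i) - ((-1) ^+ (size (b :: v) - i.+1) * B i))); last first.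
  by move=> i _; rewrite AB// -opprD mulrN mulrDr.
rewrite big_split /=; congr (_ + _).
  rewrite sumrN; congr (- _); rewrite big_ord_recl {1}/A take0 mulr0 add0r mulr_sumr.
  apply: eq_bigr => i _; rewrite /A lift0 /= subSS mulrCA.
  by [].
have su : (size u).+1 = size w by rewrite sw.
rewrite su big_ord_recr /= {2}/B -cats1 drop_oversize; last by rewrite size_cat /= addn1.
rewrite /= mulr0 oppr0 addr0 mulr_suml; apply: eq_bigr => i _; rewrite /B.
rewrite drop_rcons; last exact: ltn_ord.
rewrite rev_rcons nth_rcons ltn_ord -cats1 takel_cat; last exact: ltnW.
rewrite subSn; last exact: ltn_ord.
by rewrite exprS mulN1r mulNr opprK mulrCA mulrC.
Qed.

(** Both sides decay at infinity and have the same derivative: [Lop] and [Rop] are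
   derivations for the shuffle product, by induction on the sizes. *)
Lemma regint_shmul u v x : all_admissible a u -> all_admissible a v -> a < x ->
  shmul (regint x) u v.
Proof.
have [n] := ubnP (size u + size v); elim: n u v x => // n IH u v x le_n Hu Hv ax.
case: (eqVneq u [::]) => [->|u0]; first exact: shmul0s.
case: (eqVneq v [::]) => [->|v0]; first exact: shmuls0.
have Huv w : w \in shuffle u v -> all_admissible a w /\ w != [::].
  move=> /mem_shuffle E; split.
    by move=> z; rewrite (perm_mem E) mem_cat => /orP[]; [exact: Hu|exact: Hv].
  by rewrite -size_eq0 (perm_size E) size_cat addn_eq0 size_eq0 (negPf u0).
apply: (decaying_eq (f := fun x => regint x u * regint x v) (g := fun x => shsum (regint x) u v) _ _ _ ax).
- by apply: decayingMl; [apply/decaying_moderate; exact: decaying_regint|exact: decaying_regint].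
- by apply: decaying_sum => // w /Huv[Hw w0]; exact: decaying_regint.
move=> {x ax} x ax.
exists (shsum (fun w => - Lop (thetaf x) (regint x) w + Rop (inftyf x) (regint x) w) u v); last first.
  by apply: cderiv_sum => w /Huv[Hw _]; exact: cderiv_regint.
apply: cderiv_eq (cderivM (cderiv_regint Hu ax) (cderiv_regint Hv ax)) _.
rewrite shsumD.
have NL : shsum (fun w => - Lop (thetaf x) (regint x) w) u v = - shsum (Lop (thetaf x) (regint x)) u v.
  exact: sumrN.
rewrite NL.
rewrite [X in _ = - X + _](_ : _ = Lop (thetaf x) (regint x) u * regint x v + regint x u * Lop (thetaf x) (regint x) v); last first.
  case: u v u0 v0 le_n Hu Hv {Huv NL} => [//|b u] [//|c v] _ _ le_n Hu Hv.
  have Hu' : all_admissible a u by apply: all_admissible_sub Hu => z zu; rewrite in_cons zu orbT.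
  have Hv' : all_admissible a v by apply: all_admissible_sub Hv => z zu; rewrite in_cons zu orbT.
  rewrite shsum_cons /=.
  have E1 : shmul (regint x) u (c :: v) by apply: IH => //; move: le_n => /=; lia.
  have E2 : shmul (regint x) (b :: u) v by apply: IH => //; move: le_n => /=; lia.
  rewrite [X in X + _](_ : _ = thetaf x b * shsum (regint x) u (c :: v)); last by rewrite /shsum mulr_sumr.
  rewrite [X in _ + X](_ : _ = thetaf x c * shsum (regint x) (b :: u) v); last by rewrite /shsum mulr_sumr.
  by rewrite -E1 -E2; ring.
rewrite [X in _ = _ + X](_ : _ = Rop (inftyf x) (regint x) u * regint x v + regint x u * Rop (inftyf x) (regint x) v); last first.
  case/lastP: u u0 le_n Hu {Huv NL} => [//|u b] _; case/lastP: v v0 Hv => [//|v c] _ Hv le_n Hu.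
  have Hu' : all_admissible a u by apply: all_admissible_sub Hu => z zu; rewrite mem_rcons in_cons zu orbT.
  have Hv' : all_admissible a v by apply: all_admissible_sub Hv => z zu; rewrite mem_rcons in_cons zu orbT.
  rewrite shsum_rcons !Rop_rcons.
  have E1 : shmul (regint x) u (rcons v c).
    by apply: IH => //; move: le_n; rewrite !size_rcons; lia.
  have E2 : shmul (regint x) (rcons u b) v.
    by apply: IH => //; move: le_n; rewrite !size_rcons; lia.
  rewrite [X in X + _](_ : _ = inftyf x b * shsum (regint x) u (rcons v c)); last first.
    by rewrite /shsum mulr_sumr; apply: eq_bigr => w _; rewrite Rop_rcons mulrC.
  rewrite [X in _ + X](_ : _ = inftyf x c * shsum (regint x) (rcons u b) v); last first.
    by rewrite /shsum mulr_sumr; apply: eq_bigr => w _; rewrite Rop_rcons mulrC.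
  by rewrite -E1 -E2; ring.
ring.
Qed.

End Regularised.
End IteratedTails.

(** * Composition of paths *)
Section PowerIntegrals.
Variable R : realType.
Local Notation C := R[i].
Implicit Types (t x a : R) (z : C) (u v : seq C).

Definition csum u : C := \sum_(z <- u) z.

Lemma csum_cons z u : csum (z :: u) = z + csum u.
Proof. exact: big_cons. Qed.

Lemma csum_nil : csum [::] = 0. Proof. exact: big_nil. Qed.

(** The sums of the nonempty suffixes of [u] are the denominators of [tail_coef u]. *)
Fixpoint tails_neq0 u : bool :=
  if u is z :: u' then (csum u != 0) && tails_neq0 u' else true.

Fixpoint tail_coef u : C := if u is z :: u' then - (csum u)^-1 * tail_coef u' else 1.

(** The iterated integral of the forms [t ^ (s_i - 1) dt] along the path from
   [x] back to 0, regularised at 0. *)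
Definition powint x u : C := cpow x (csum u) * tail_coef u.

Lemma powint1 u : powint 1 u = tail_coef u.
Proof. by rewrite /powint cpow1z mul1r. Qed.

Lemma cderiv_powint u x : 0 < x -> tails_neq0 u ->
  cderiv (powint ^~ u) x (- Lop (inftyf x) (powint x) u).
Proof.
move=> x0; case: u => [_|z u /= /andP[s0 _]].
  rewrite /= oppr0 /powint csum_nil; apply: eq_cderiv (cderiv_cst 1 x) => t.
  by rewrite cpowt0 mul1r.
rewrite /powint.
apply: cderiv_eq (cderivM (cderiv_cpow (csum (z :: u)) x0) (cderiv_cst (tail_coef (z :: u)) x)) _.
rewrite mulr0 addr0 /= /inftyf /mellin_form mul1r.
rewrite (_ : csum (z :: u) - 1 = (z - 1) + csum u); last by rewrite csum_cons addrAC.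
by rewrite cpowD; field.
Qed.

End PowerIntegrals.

Section ConvLimits.
Variable R : realType.
Local Notation C := R[i].

Lemma cvgcD (T : Type) (F : set_system T) {FF : Filter F} (f g : T -> C) (a b : C) :
  f x @[x --> F] --> a -> g x @[x --> F] --> b -> f x + g x @[x --> F] --> a + b.
Proof. by move=> fa gb; exact: (@cvgD R[i] R[i] T F FF f g a b fa gb). Qed.

Lemma cvgcB (T : Type) (F : set_system T) {FF : Filter F} (f g : T -> C) (a b : C) :
  f x @[x --> F] --> a -> g x @[x --> F] --> b -> f x - g x @[x --> F] --> a - b.
Proof. by move=> fa gb; exact: (@cvgB R[i] R[i] T F FF f g a b fa gb). Qed.

Lemma cvgcM (T : Type) (F : set_system T) {FF : Filter F} (f g : T -> C) (a b : C) :
  f x @[x --> F] --> a -> g x @[x --> F] --> b -> f x * g x @[x --> F] --> a * b.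
Proof. by move=> fa gb; exact: (@cvgM R[i] T F FF f g a b fa gb). Qed.

Lemma cvgc_cst (T : Type) (F : set_system T) {FF : Filter F} (a : C) :
  (fun=> a) x @[x --> F] --> a.
Proof. exact: (@cvg_cst R[i] a T F FF). Qed.

Lemma cderiv_conv (T : eqType) (A B : R -> seq T -> C) (dA dB : seq T -> C) u x :
  (forall i, cderiv (A ^~ (take i u)) x (dA (take i u))) ->
  (forall i, cderiv (B ^~ (drop i u)) x (dB (drop i u))) ->
  cderiv (fun x => conv (A x) (B x) u) x (conv dA (B x) u + conv (A x) dB u).
Proof.
move=> HA HB; apply: (@eq_cderiv _ (fun y => \sum_(i < (size u).+1) A y (take i u) * B y (drop i u))).
  by move=> y; rewrite convE.
rewrite !convE -big_split /=; apply: cderiv_sum => i _; exact: cderivM.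
Qed.

Lemma convNl (T : Type) (A B : seq T -> C) u : conv (fun w => - A w) B u = - conv A B u.
Proof. by rewrite !convE -sumrN; apply: eq_bigr => i _; rewrite mulNr. Qed.

Lemma convNr (T : Type) (A B : seq T -> C) u : conv A (fun w => - B w) u = - conv A B u.
Proof. by rewrite !convE -sumrN; apply: eq_bigr => i _; rewrite mulrN. Qed.

(** The norm of [R[i]] has values in [R[i]] itself; limits are tested here with real
   radii and the real valued norm. *)
Lemma cvgc_normP (T : Type) (F : set_system T) {FF : Filter F} (f : T -> C) (l : C) :
  (forall e : R, 0 < e -> \forall x \near F, normc (l - f x) <= e) ->
  f x @[x --> F] --> l.
Proof.
move=> H; apply/cvgrPdist_le => eps; rewrite ltcE => /andP[/= /eqP i0 r0].
have {H} := H _ r0; apply: filterS => x Hx.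
have -> : eps = (complex.Re eps)%:C by apply: complexP; rewrite //= i0.
by rewrite lecR.
Qed.

Lemma cvg_bigsum (T I : Type) (F : set_system T) {FF : Filter F} (r : seq I)
    (f : I -> T -> C) (l : I -> C) :
  (forall i, f i x @[x --> F] --> l i) ->
  \sum_(i <- r) f i x @[x --> F] --> \sum_(i <- r) l i.
Proof.
move=> H; elim: r => [|i r IH].
  have E : (fun x => \sum_(i <- [::]) f i x) = fun=> 0 by apply/funext => x; exact: big_nil.
  rewrite E [X in _ --> X]big_nil; exact: cvgc_cst.
have E : (fun x => \sum_(j <- i :: r) f j x) = fun x => f i x + \sum_(j <- r) f j x.
  by apply/funext => x; exact: big_cons.
have HH := cvgcD (FF := FF) (H i) IH.
rewrite E [X in _ --> X]big_cons; exact HH.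
Qed.

Lemma cvg_conv (T S : Type) (F : set_system T) {FF : Filter F} (A B : T -> seq S -> C)
    (A' B' : seq S -> C) u :
  (forall i, A x (take i u) @[x --> F] --> A' (take i u)) ->
  (forall i, B x (drop i u) @[x --> F] --> B' (drop i u)) ->
  conv (A x) (B x) u @[x --> F] --> conv A' B' u.
Proof.
move=> HA HB; rewrite convE (_ : (fun x => conv _ _ _) = fun x => \sum_(i < (size u).+1) A x (take i u) * B x (drop i u)).
  have H (i : 'I_(size u).+1) := cvgcM (FF := FF) (HA i) (HB i).
  exact: cvg_bigsum H.
by apply/funext => x; rewrite convE.
Qed.

Lemma decaying_cvg a (f : R -> C) : decaying a f -> f y @[y --> +oo] --> (0 : C).
Proof.
move=> df; apply: cvgc_normP => e e0.
have := decaying_cvg0 df e0; apply: filterS => x.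
by rewrite sub0r normcN.
Qed.

Lemma cvg_cpow_pinfty (z : C) : complex.Re z < 0 -> cpow y z @[y --> +oo] --> (0 : C).
Proof.
move=> z0; apply: cvgc_normP => e e0; near=> y.
have ye : expR (ln e / complex.Re z) < y.
  by near: y; apply: nbhs_pinfty_gt; exact: num_real.
have y0 : 0 < y by exact: lt_trans (expR_gt0 _) ye.
rewrite sub0r normcN normc_cpow -[leRHS](lnK (_ : e \is Num.pos))//.
rewrite ler_expR mulrC -ler_ndivrMr//.
by rewrite -[leLHS]expRK ler_ln ?posrE ?expR_gt0// ltW.
Unshelve. all: by end_near.
Qed.

Lemma cvg_cpow_0 (z : C) : 0 < complex.Re z -> cpow y z @[y --> 0^'+] --> (0 : C).
Proof.
move=> z0; apply: cvgc_normP => e e0; near=> y.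
have y0 : 0 < y by near: y; exact: nbhs_right_gt.
have ye : y < expR (ln e / complex.Re z) by near: y; apply: nbhs_right_lt; exact: expR_gt0.
rewrite sub0r normcN normc_cpow -[leRHS](lnK (_ : e \is Num.pos))//.
rewrite ler_expR mulrC -ler_pdivlMr//.
by rewrite -[leRHS]expRK ler_ln ?posrE ?expR_gt0// ltW.
Unshelve. all: by end_near.
Qed.

Lemma Re_csum (u : seq C) : complex.Re (csum u) = \sum_(z <- u) complex.Re z.
Proof. exact: Re_sum. Qed.

Lemma Re_csum_gt0 (u : seq C) : (forall z, z \in u -> 0 < complex.Re z) -> u != [::] ->
  0 < complex.Re (csum u).
Proof.
case: u => // z u H _; rewrite csum_cons cReD ltr_pwDl ?Re_csum//.
  by apply: H; rewrite mem_head.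
rewrite big_seq; apply: sumr_ge0 => w wu; apply/ltW/H.
by rewrite in_cons wu orbT.
Qed.

Lemma Re_csum_lt0 (u : seq C) : (forall z, z \in u -> complex.Re z < 0) -> u != [::] ->
  complex.Re (csum u) < 0.
Proof.
move=> H u0; have := @Re_csum_gt0 (map -%R u).
rewrite -size_eq0 size_map size_eq0 => /(_ _ u0).
rewrite /csum big_map sumrN cReN oppr_gt0; apply.
by move=> z /mapP[w wu ->]; rewrite cReN oppr_gt0 H.
Qed.

Lemma tails_neq0_Re (u : seq C) :
  (forall v, v != [::] -> {subset v <= u} -> complex.Re (csum v) != 0) -> tails_neq0 u.
Proof.
elim: u => //= z u IH H; apply/andP; split.
  by apply/eqP => E; have := H (z :: u) isT (fun w p => p); rewrite E eqxx.
by apply: IH => v v0 vu; apply: H => // w /vu wu; rewrite in_cons wu orbT.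
Qed.

Lemma tails_neq0_lt0 (u : seq C) : (forall z, z \in u -> complex.Re z < 0) -> tails_neq0 u.
Proof.
move=> H; apply: tails_neq0_Re => v v0 vu.
by rewrite lt_eqF// Re_csum_lt0// => z /vu/H.
Qed.

Lemma tails_neq0_gt0 (u : seq C) : (forall z, z \in u -> 0 < complex.Re z) -> tails_neq0 u.
Proof.
move=> H; apply: tails_neq0_Re => v v0 vu.
by rewrite gt_eqF// Re_csum_gt0// => z /vu/H.
Qed.

Lemma tails_neq0_drop (u : seq C) i : tails_neq0 u -> tails_neq0 (drop i u).
Proof.
elim: u i => [|z u IH] [|i]//= /andP[_ ?]; exact: IH.
Qed.

End ConvLimits.

Section PathComposition.
Variable R : realType.
Local Notation C := R[i].
Implicit Types (t x a y : R) (z : C) (u v : seq C).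

(** The iterated integral of the forms [theta t ^ (s_i - 1) dt] from [x] to a
   tangential base point at infinity: continue to infinity along [theta] with
   counterterms, and come back along the constant term of [theta]. *)
Definition theta_tail x u : C := conv (regint x) (powint x) u.

Lemma all_admissible_take a u i : all_admissible a u -> all_admissible a (take i u).
Proof. by move=> H; apply: all_admissible_sub H => z; exact: mem_take. Qed.

Lemma all_admissible_drop a u i : all_admissible a u -> all_admissible a (drop i u).
Proof. by move=> H; apply: all_admissible_sub H => z; exact: mem_drop. Qed.

(** The contribution of the constant term at the end of the word in [cderiv_regint]
   cancels the derivative of [powint], by [conv_Rop]. *)
Lemma cderiv_theta_tail a u x : 0 <= a -> a < x -> all_admissible a u -> tails_neq0 u ->
  cderiv (theta_tail ^~ u) x (- Lop (thetaf x) (theta_tail x) u).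
Proof.
move=> a0 ax Hu tu; have x0 : 0 < x by exact: le_lt_trans ax.
apply: cderiv_eq (cderiv_conv
   (dA := fun w => - Lop (thetaf x) (regint x) w + Rop (inftyf x) (regint x) w)
   (dB := fun w => - Lop (inftyf x) (powint x) w) _ _) _.
- by move=> i; apply: (cderiv_regint a0) => //; exact: all_admissible_take.
- by move=> i; apply: cderiv_powint => //; exact: tails_neq0_drop.
by rewrite convDl convNl convNr conv_Rop conv_Lop addrK.
Qed.

Definition cprim1 (f : R -> C) y : C :=
  prim1 (fun t => complex.Re (f t)) y +i* prim1 (fun t => complex.Im (f t)) y.

Lemma cderiv_cprim1 (f : R -> C) y : (forall t, 0 < t -> ccont f t) -> 0 < y ->
  cderiv (cprim1 f) y (f y).
Proof.
move=> cf y0; split => /=.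
  by apply: (is_derive_prim1 (f := fun t => complex.Re (f t))) => // t /cf[].
by apply: (is_derive_prim1 (f := fun t => complex.Im (f t))) => // t /cf[].
Qed.

Fixpoint theta_path_rev y u : C :=
  if u is z :: u' then cprim1 (fun t => thetaf t z * theta_path_rev t u') y else 1.

(** The iterated integral of the forms of [theta] from 1 to [y]; the recursion peels
   off the last letter, which carries the outermost variable. *)
Definition theta_path y u : C := theta_path_rev y (rev u).

Lemma ccont_theta_path_rev u t : 0 < t -> ccont (theta_path_rev ^~ u) t.
Proof.
elim: u t => [|z u IH] t t0 /=; first exact: ccont_cst.
apply: cderiv_ccont; apply: cderiv_cprim1 => // r r0; apply: ccontM; last exact: IH.
exact: ccont_mellin_theta.
Qed.

Lemma cderiv_theta_path u y : 0 < y -> cderiv (theta_path ^~ u) y (Rop (thetaf y) (theta_path y) u).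
Proof.
move=> y0; case/lastP: u => [|u z]; first exact: cderiv_cst.
rewrite Rop_rcons mulrC /theta_path rev_rcons.
have D : forall t, 0 < t -> ccont (fun t => thetaf t z * theta_path_rev t (rev u)) t.
  by move=> t t0; apply: ccontM; [exact: ccont_mellin_theta|exact: ccont_theta_path_rev].
exact: (cderiv_cprim1 D y0).
Qed.

Lemma theta_path1 u : theta_path 1 u = counit C u.
Proof.
case/lastP: u => // u z; rewrite /theta_path rev_rcons /= /cprim1 !prim1_1.
by case: u.
Qed.

(** The composition of the path from 1 to [y] with the path from [y] to infinity: the
   derivative in [y] vanishes by [conv_Rop], and at [y = 1] the first path is trivial. *)
Lemma conv_theta_path_theta_tail a u y : 0 <= a -> a < 1 -> a < y -> all_admissible a u -> tails_neq0 u ->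
  conv (theta_path y) (theta_tail y) u = theta_tail 1 u.
Proof.
move=> a0 a1 ay Hu tu.
rewrite -[RHS]conv1w -(@eq_conv _ _ (theta_path 1) (counit C) (theta_tail 1) (theta_tail 1))//; last exact: theta_path1.
apply: (@cderiv0_eq _ (fun y => conv (theta_path y) (theta_tail y) u) `]a, +oo[); rewrite ?in_itv/= ?andbT//.
move=> t; rewrite in_itv/= andbT => ta; have t0 : 0 < t by exact: le_lt_trans ta.
apply: cderiv_eq (cderiv_conv (dA := Rop (thetaf t) (theta_path t))
   (dB := fun w => - Lop (thetaf t) (theta_tail t) w) _ _) _.
- by move=> i; exact: cderiv_theta_path.
- move=> i; apply: (cderiv_theta_tail a0) => //; first exact: all_admissible_drop.
  exact: tails_neq0_drop.
by rewrite convNr conv_Rop subrr.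
Qed.

(** The change of variables [s_1, ..., s_r -> 1 - s_r, ..., 1 - s_1] of the functional
   equation. *)
Definition mirror u : seq C := rev (map (fun z => 1 - z) u).

Lemma mirror_cons z u : mirror (z :: u) = rcons (mirror u) (1 - z).
Proof. by rewrite /mirror /= rev_cons. Qed.

Lemma mirrorK : involutive mirror.
Proof.
move=> u; rewrite /mirror map_rev revK -map_comp -[RHS]map_id.
by apply: eq_map => z /=; rewrite opprB addrC subrK.
Qed.

(** The factor [x ^ 2] compensates the Jacobian of [x -> 1 / x]: the form of [theta] with
   exponent [1 - z] is exchanged with the opposite of the one with exponent [z]. *)
Lemma thetaf_inv x z : 0 < x -> thetaf x^-1 (1 - z) = (x ^+ 2)%:C * thetaf x z.
Proof.
move=> x0; rewrite /thetaf /mellin_form theta_inv// cpowV//.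
rewrite (_ : - (1 - z - 1) = (z - 1) + 1); last by ring.
by rewrite cpowD cpowt1// rmorphM expr2 rmorphM /=; ring.
Qed.

Lemma cderiv_theta_path_inv u x : 0 < x ->
  cderiv (fun x => theta_path x^-1 (mirror u)) x
    (- Lop (thetaf x) (fun w => theta_path x^-1 (mirror w)) u).
Proof.
move=> x0; case: u => [|z u].
  by rewrite /= oppr0; exact: cderiv_cst.
rewrite mirror_cons.
have D : is_derive x (1 : R) (fun y => y^-1) (- x ^- 2).
  have xn : x != 0 by rewrite gt_eqF.
  have := is_deriveV xn (is_derive_id x 1).
  by rewrite /GRing.scale /= mulr1.
have xi : 0 < x^-1 by rewrite invr_gt0.
apply: cderiv_eq (cderiv_comp (cderiv_theta_path (rcons (mirror u) (1 - z)) xi) D) _.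
rewrite Rop_rcons thetaf_inv//= rmorphN /= fmorphV /=.
have xn : (x ^+ 2)%:C != 0 :> C by rewrite (inj_eq (@complexI R)) expf_neq0// gt_eqF.
by move: xn; move: (x ^+ 2)%:C => X xn; field.
Qed.

(** The path from [x] to infinity through 1; by the functional equation of
   [theta], the part from [x] to 1 is an integral from 1 to [1 / x] of the
   reflected forms. *)
Lemma theta_tail_split u x : all_admissible 0 u -> tails_neq0 u -> 0 < x ->
  theta_tail x u = conv (fun w => theta_path x^-1 (mirror w)) (theta_tail 1) u.
Proof.
elim: u x => [|z u IH] x Hu tu x0.
  by rewrite conv_nil /theta_tail !conv_nil /powint csum_nil !cpowt0 !mul1r.
have Hu' : all_admissible 0 u by apply: all_admissible_sub Hu => w wu; rewrite in_cons wu orbT.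
have tu' : tails_neq0 u by move: tu => /= /andP[].
pose f x := theta_tail x (z :: u) - conv (fun w => theta_path x^-1 (mirror w)) (theta_tail 1) (z :: u).
suff E : f x = f 1.
  apply/eqP; rewrite -subr_eq0 -/(f x) E /f invr1.
  rewrite (@eq_conv _ _ _ (counit C) _ (theta_tail 1))// ?conv1w ?subrr// => w.
  by rewrite theta_path1 /mirror; case: w => //= y w; rewrite rev_cons; case: (rev _).
apply: (@cderiv0_eq _ f `]0, +oo[); rewrite ?in_itv/= ?andbT//.
move=> t; rewrite in_itv/= andbT => t0.
have D1 := cderiv_theta_tail (lexx 0) t0 Hu tu.
have D2 := cderiv_conv (A := fun x w => theta_path x^-1 (mirror w)) (B := fun x w => theta_tail 1 w)
   (dA := fun w => - Lop (thetaf t) (fun w => theta_path t^-1 (mirror w)) w)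
   (dB := fun=> 0) (fun i => cderiv_theta_path_inv (take i (z :: u)) t0) (fun i => cderiv_cst _ t).
apply: cderiv_eq (cderivB D1 D2) _.
rewrite (@convE _ _ _ (fun=> 0)) big1 ?addr0; last by move=> i _; rewrite mulr0.
by rewrite convNl conv_Lop /= -IH// opprK addNr.
Qed.

Lemma cvg_regint_pinfty a u : 0 <= a -> all_admissible a u ->
  regint y u @[y --> +oo] --> counit C u.
Proof.
move=> a0 Hu; case: (eqVneq u [::]) => [->|u0]; first exact: cvgc_cst.
by case: u u0 Hu => // z u u0 Hu; exact: (decaying_cvg (decaying_regint a0 Hu u0)).
Qed.

Lemma cvg_powint_pinfty u : (forall z, z \in u -> complex.Re z < 0) ->
  powint y u @[y --> +oo] --> counit C u.
Proof.
move=> Hu; case: u Hu => [|z u] Hu.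
  rewrite /powint csum_nil /=; under eq_fun do rewrite cpowt0 mulr1; exact: cvgc_cst.
rewrite /powint -[counit _ _]/(0 : C) -(mul0r (tail_coef (z :: u))); apply: cvgcM; last exact: cvgc_cst.
by apply: cvg_cpow_pinfty; exact: Re_csum_lt0.
Qed.

Lemma cvg_theta_tail_pinfty u : (forall z, z \in u -> complex.Re z < 0) ->
  theta_tail y u @[y --> +oo] --> counit C u.
Proof.
move=> Hu; rewrite -[counit C u]conv1w; apply: cvg_conv => i.
  by apply: (@cvg_regint_pinfty (2^-1)) => // z _; rewrite /admissible invr_gt0 ltr0n.
by apply: cvg_powint_pinfty => z /mem_drop; exact: Hu.
Qed.

(** By induction on the size: in [conv_theta_path_theta_tail], all the terms but
   [theta_path y u] have a factor [theta_tail y] of a nonempty word, which tends to 0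
   when the exponents have negative real parts. *)
Lemma cvg_theta_path_pinfty u : (forall z, z \in u -> complex.Re z < 0) ->
  theta_path y u @[y --> +oo] --> theta_tail 1 u.
Proof.
have [n] := ubnP (size u); elim: n u => // n IH u le_n Hu.
have h1 : 2^-1 < 1 :> R by rewrite invf_lt1// ltr1n.
have Hadm : all_admissible (2^-1) u by move=> z _; rewrite /admissible invr_gt0 ltr0n.
pose S y := \sum_(i < size u) theta_path y (take i u) * theta_tail y (drop i u).
have E y : 2^-1 < y -> theta_path y u = theta_tail 1 u - S y.
  move=> y2; rewrite -(conv_theta_path_theta_tail _ h1 y2 Hadm (tails_neq0_lt0 Hu))//.
  rewrite convE big_ord_recr /= take_size drop_size /theta_tail conv_nil /powint csum_nil cpowt0 /=.
  by rewrite !mulr1 /S addrAC subrr add0r.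
have CS : S y @[y --> +oo] --> \sum_(i < size u) theta_tail 1 (take i u) * counit C (drop i u).
  apply: cvg_bigsum => i; apply: cvgcM.
    apply: IH => [|z /mem_take]; last exact: Hu.
    by rewrite size_take ltn_ord; apply: leq_trans (ltn_ord i) _; rewrite -ltnS.
  by apply: cvg_theta_tail_pinfty => z /mem_drop; exact: Hu.
have S0 : \sum_(i < size u) theta_tail 1 (take i u) * counit C (drop i u) = 0.
  apply: big1 => i _; have : drop i u != [::] by rewrite -size_eq0 size_drop subn_eq0 -ltnNge.
  by case: (drop i u) => // ? ? _; rewrite mulr0.
have : theta_tail 1 u - S y @[y --> +oo] --> theta_tail 1 u - 0.
  by apply: cvgcB; [exact: cvgc_cst|rewrite -[X in _ --> X]S0].
rewrite subr0; apply: cvg_trans; apply: near_eq_cvg.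
have : \forall y \near +oo, (2^-1 : R) < y by apply: nbhs_pinfty_gt; exact: num_real.
by apply: filterS => y /E ->.
Qed.

End PathComposition.

(** * Fubini for complex valued functions *)
Section ComplexFubini.
Variable R : realType.
Local Notation C := R[i].
Local Notation T := (measurableTypeR R).
Local Notation mu := (@lebesgue_measure R).

(** An equivalent norm, whose measurability and product bounds are immediate. *)
Definition norm1 (z : C) : R := `|complex.Re z| + `|complex.Im z|.

Lemma norm1_ge0 z : 0 <= norm1 z. Proof. exact: addr_ge0. Qed.

Lemma norm10 : norm1 0 = 0. Proof. by rewrite /norm1 /= normr0 addr0. Qed.

Lemma norm1M z w : norm1 (z * w) <= norm1 z * norm1 w.
Proof.
rewrite /norm1 cReM cImM; case: z w => a b [c d] /=.
rewrite mulrDl !mulrDr -!normrM.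
have := ler_normB (a * c) (b * d); have := ler_normD (a * d) (b * c); lra.
Qed.

Lemma norm1_le z : norm1 z <= 2 * normc z.
Proof. by rewrite mulr_natl mulr2n; apply: lerD; [exact: Re_le_normc|exact: Im_le_normc]. Qed.

Definition cmeas d (X : measurableType d) (f : X -> C) : Prop :=
  measurable_fun setT (fun x => complex.Re (f x)) /\
  measurable_fun setT (fun x => complex.Im (f x)).

Lemma cmeas_cst d (X : measurableType d) (c : C) : cmeas ((fun=> c) : X -> C).
Proof. by split; exact: measurable_cst. Qed.

Lemma cmeasM d (X : measurableType d) (f g : X -> C) : cmeas f -> cmeas g ->
  cmeas (fun x => f x * g x).
Proof.
move=> [f1 f2] [g1 g2]; split.
  rewrite (_ : (fun x => _) = fun x => complex.Re (f x) * complex.Re (g x) -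
      complex.Im (f x) * complex.Im (g x)); last by apply/funext => x; rewrite cReM.
  by apply: measurable_funB; exact: measurable_funM.
rewrite (_ : (fun x => _) = fun x => complex.Re (f x) * complex.Im (g x) +
    complex.Im (f x) * complex.Re (g x)); last by apply/funext => x; rewrite cImM.
by apply: measurable_funD; exact: measurable_funM.
Qed.

Lemma cmeas_if d (X : measurableType d) (b : X -> bool) (f g : X -> C) :
  measurable_fun setT b -> cmeas f -> cmeas g -> cmeas (fun x => if b x then f x else g x).
Proof.
move=> mb [f1 f2] [g1 g2]; split.
  rewrite (_ : (fun x => _) = fun x => if b x then complex.Re (f x) else complex.Re (g x)).
    exact: measurable_fun_ifT.
  by apply/funext => x; case: (b x).
rewrite (_ : (fun x => _) = fun x => if b x then complex.Im (f x) else complex.Im (g x)).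
  exact: measurable_fun_ifT.
by apply/funext => x; case: (b x).
Qed.

Lemma cmeas_comp d d' (X : measurableType d) (Y : measurableType d') (f : Y -> C) (h : X -> Y) :
  cmeas f -> measurable_fun setT h -> cmeas (fun x => f (h x)).
Proof. by move=> [f1 f2] mh; split; [exact: measurableT_comp f1 mh|exact: measurableT_comp f2 mh]. Qed.

Lemma cmeas_norm1 d (X : measurableType d) (f : X -> C) : cmeas f ->
  measurable_fun setT (fun x => (norm1 (f x))%:E).
Proof.
move=> [f1 f2]; apply/measurable_EFinP; apply: measurable_funD.
  exact: measurableT_comp f1.
exact: measurableT_comp f2.
Qed.

Lemma Cintegrable_norm1 d (X : measurableType d) (m : {measure set X -> \bar R}) (f : X -> C) :
  cmeas f -> (\int[m]_x (norm1 (f x))%:E < +oo)%E -> Cintegrable m setT f.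
Proof.
move=> mf foo; have [f1 f2] := mf; split; apply/integrableP; split; try exact/measurable_EFinP.
  apply: le_lt_trans foo; apply: ge0_le_integral => //.
  - by apply: measurableT_comp => //; exact/measurable_EFinP.
  - exact: cmeas_norm1.
  - by move=> x _; rewrite lee_fin /norm1 lerDl.
apply: le_lt_trans foo; apply: ge0_le_integral => //.
- by apply: measurableT_comp => //; exact/measurable_EFinP.
- exact: cmeas_norm1.
- by move=> x _; rewrite lee_fin /norm1 lerDr.
Qed.

Lemma CintegralZ d (X : measurableType d) (m : {measure set X -> \bar R}) (c : C) (f : X -> C) :
  Cintegrable m setT f -> Cintegral m setT (fun x => c * f x) = c * Cintegral m setT f.
Proof.
move=> [i1 i2]; apply: complexP; rewrite ?cReM ?cImM /=.
  have E : (fun x => complex.Re (c * f x)) = fun x => complex.Re c * complex.Re (f x) - complex.Im c * complex.Im (f x).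
    by apply/funext => x; rewrite cReM.
  rewrite E RintegralB ?RintegralZl//.
    have := integrableZl measurableT (complex.Re c) i1; by apply: eq_integrable.
  have := integrableZl measurableT (complex.Im c) i2; by apply: eq_integrable.
have E : (fun x => complex.Im (c * f x)) = fun x => complex.Re c * complex.Im (f x) + complex.Im c * complex.Re (f x).
  by apply/funext => x; rewrite cImM.
rewrite E RintegralD ?RintegralZl//.
  have := integrableZl measurableT (complex.Re c) i2; by apply: eq_integrable.
have := integrableZl measurableT (complex.Im c) i1; by apply: eq_integrable.
Qed.

Section Product.
Context d (X : measurableType d) (m : {sigma_finite_measure set X -> \bar R}).
Variables (c : T -> C) (p : T * X -> C).
Hypothesis mc : cmeas c.
Hypothesis mp : cmeas p.

Let F (z : T * X) : C := c z.1 * p z.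

Lemma cmeas_prodF : cmeas F.
Proof. by apply: cmeasM => //; apply: cmeas_comp => //; exact: measurable_fst. Qed.

Let N (x : T) : \bar R := (\int[m]_y (norm1 (p (x, y)))%:E)%E.

(** Tonelli's theorem and [norm1M]; this bound gives the integrability of [F]. *)
Lemma norm1_product_le :
  (\int[mu \x m]_z (norm1 (F z))%:E <= \int[mu]_x ((norm1 (c x))%:E * N x))%E.
Proof.
have mF := cmeas_norm1 cmeas_prodF.
have F0 z : (0 <= (norm1 (F z))%:E)%E by rewrite lee_fin norm1_ge0.
rewrite fubini_tonelli1//; apply: ge0_le_integral => //.
- by move=> x _; exact: integral_ge0.
- exact: measurable_fun_fubini_tonelli_F.
- apply: emeasurable_funM; first exact: cmeas_norm1.
  apply: (@measurable_fun_fubini_tonelli_F _ _ _ _ _ m (fun z => (norm1 (p z))%:E)) => [|z].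
    exact: cmeas_norm1.
  by rewrite lee_fin norm1_ge0.
move=> x _; rewrite /N -ge0_integralZl//.
- apply: ge0_le_integral => //.
  + exact: (measurableT_comp mF (measurable_pair1 x)).
  + apply: measurable_funeM.
    exact: (measurableT_comp (cmeas_norm1 mp) (measurable_pair1 x)).
  + by move=> y _; rewrite /F /= -EFinM lee_fin norm1M.
- exact: (measurableT_comp (cmeas_norm1 mp) (measurable_pair1 x)).
- by move=> y _; rewrite lee_fin norm1_ge0.
- by rewrite lee_fin norm1_ge0.
Qed.

(** Where [c] vanishes the inner integral may diverge; there both integrands are 0. *)
Lemma Cintegral_product :
  (forall x, c x != 0 -> Cintegrable m setT (fun y => p (x, y))) ->
  (\int[mu]_x ((norm1 (c x))%:E * N x) < +oo)%E ->
  Cintegrable (mu \x m)%E setT F /\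
  Cintegral (mu \x m)%E setT F = Cintegral mu setT (fun x => c x * Cintegral m setT (fun y => p (x, y))).
Proof.
move=> ip Noo; have mF := cmeas_prodF.
have iF : Cintegrable (mu \x m)%E setT F.
  by apply: Cintegrable_norm1 => //; apply: le_lt_trans Noo; exact: norm1_product_le.
split => //.
have inner x : c x * Cintegral m setT (fun y => p (x, y)) = Cintegral m setT (fun y => F (x, y)).
  have [c0|cx] := eqVneq (c x) 0; last exact/esym/(CintegralZ (c x) (ip x cx)).
  rewrite /F /= c0 mul0r; apply: complexP; rewrite /= /Rintegral.
    by rewrite integral0_eq// => y _; rewrite mul0r.
  by rewrite integral0_eq// => y _; rewrite mul0r.
have fin x : Cintegrable m setT (fun y => F (x, y)).
  have [c0|cx] := eqVneq (c x) 0.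
    rewrite /F /= c0 (_ : (fun y => _) = fun=> 0); last by apply/funext => y; rewrite mul0r.
    by split; exact: integrable0.
  apply: Cintegrable_norm1.
    apply: cmeas_comp => //; exact: measurable_pair1.
  have [i1 i2] := ip x cx.
  have in1 : m.-integrable setT (fun y => (norm1 (p (x, y)))%:E).
    have := integrableD measurableT (integrable_norm i1) (integrable_norm i2).
    by apply: eq_integrable.
  apply: (@le_lt_trans _ _ (\int[m]_y ((norm1 (c x))%:E * (norm1 (p (x, y)))%:E))%E).
    apply: ge0_le_integral => //.
    - by move=> y _; rewrite lee_fin norm1_ge0.
    - exact: (measurableT_comp (cmeas_norm1 mF) (measurable_pair1 x)).
    - apply: measurable_funeM.
      exact: (measurableT_comp (cmeas_norm1 mp) (measurable_pair1 x)).
    - by move=> y _; rewrite /F /= -EFinM lee_fin norm1M.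
  by apply: integrable_lty => //; exact: integrableZl.
rewrite /Cintegral; under [in RHS]eq_Rintegral do rewrite inner.
under [X in _ = _ +i* X]eq_Rintegral do rewrite inner.
have [i1 i2] := iF; apply: complexP; rewrite /= /Rintegral.
  rewrite -(integral12_prod_meas1 i1); congr fine; apply: eq_integral => x _.
  rewrite /fubini_F /= /Rintegral fineK//.
  by apply: integrable_fin_num => //; have [] := fin x.
rewrite -(integral12_prod_meas1 i2); congr fine; apply: eq_integral => x _.
rewrite /fubini_F /= /Rintegral fineK//.
by apply: integrable_fin_num => //; have [] := fin x.
Qed.

End Product.

Section Tuples.
Local Notation L n := (@lebesgue_tuple R n).

Lemma measurable_tuple_cons n : measurable_fun [set: T * n.-tuple T] (@tuple_cons R n).
Proof. by apply: (@measurable_cons _ _ _ _ fst n snd). Qed.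

Lemma Cintegral_tupleS n (f : n.+1.-tuple T -> C) : cmeas f ->
  Cintegrable (mu \x L n)%E setT (fun z => f (tuple_cons z)) ->
  Cintegrable (L n.+1) setT f /\
  Cintegral (L n.+1) setT f = Cintegral (mu \x L n)%E setT (fun z => f (tuple_cons z)).
Proof.
move=> [m1 m2] [i1 i2].
have mt := @measurable_tuple_cons n.
have M1 : measurable_fun setT (fun x => (complex.Re (f x))%:E) by exact/measurable_EFinP.
have M2 : measurable_fun setT (fun x => (complex.Im (f x))%:E) by exact/measurable_EFinP.
split.
  split.
    exact: (@integrable_pushforward _ _ _ _ _ _ mt (mu \x L n)%E setT _ M1 i1).
  exact: (@integrable_pushforward _ _ _ _ _ _ mt (mu \x L n)%E setT _ M2 i2).
apply: complexP; rewrite /= /Rintegral; congr fine.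
  exact: (@integral_pushforward _ _ _ _ _ _ mt (mu \x L n)%E setT _ M1 i1).
exact: (@integral_pushforward _ _ _ _ _ _ mt (mu \x L n)%E setT _ M2 i2).
Qed.

Lemma ge0_integral_tupleS n (f : n.+1.-tuple T -> \bar R) : measurable_fun setT f ->
  (forall t, 0 <= f t)%E ->
  (\int[L n.+1]_t f t = \int[mu \x L n]_z f (tuple_cons z))%E.
Proof.
move=> mf f0.
exact: (@ge0_integral_pushforward _ _ _ _ _ _ (@measurable_tuple_cons n) (mu \x L n)%E setT f).
Qed.

End Tuples.
End ComplexFubini.

(** * Iterated integrals over simplices *)
Section WordsOnTuples.
Variable R : realType.
Local Notation C := R[i].
Local Notation T := (measurableTypeR R).
Local Notation mu := (@lebesgue_measure R).
Local Notation L n := (@lebesgue_tuple R n).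
Implicit Types (g : R -> C) (w : seq (R -> C)).

(** Measurability on the whole line asks for a value on the negative half-line, where
   nothing is known of the forms. *)
Definition truncp g (t : R) : C := if 0 < t then g t else 0.

Lemma cmeas_truncp g : (forall x, 0 < x -> ccont g x) -> cmeas (truncp g : T -> C).
Proof.
move=> cg.
have aux (h : R -> R) : (forall x, 0 < x -> {for x, continuous h}) ->
    measurable_fun [set: T] (fun t : T => if 0 < t then h t else 0).
  move=> ch; have mh : measurable_fun (`]0, +oo[%classic : set T) (h : T -> R).
    apply: subspace_continuous_measurable_fun => //.
    apply: continuous_in_subspaceT => t; rewrite inE/= in_itv/= andbT; exact: ch.
  have mD : measurable (`]0, +oo[%classic : set T) by exact: measurable_itv.
  have := (measurable_restrictT (h : T -> R) mD).1 mh.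
  congr measurable_fun; apply/funext => t; rewrite patchE.
  by rewrite mem_setE in_itv/= andbT.
split.
  rewrite (_ : (fun x => _) = fun t => if 0 < t then complex.Re (g t) else 0).
    by apply: (aux (fun t => complex.Re (g t))) => t /cg[].
  by apply/funext => t; rewrite /truncp; case: ifP.
rewrite (_ : (fun x => _) = fun t => if 0 < t then complex.Im (g t) else 0).
  by apply: (aux (fun t => complex.Im (g t))) => t /cg[].
by apply/funext => t; rewrite /truncp; case: ifP.
Qed.

(** The density of a word on the chains [x <= t_1 <= ... <= t_n], extended by 0. *)
Fixpoint chainf w : R -> (size w).-tuple T -> C :=
  match w return R -> (size w).-tuple T -> C with
  | [::] => fun _ _ => 1
  | g :: w' => fun x t =>
      if x <= thead t then truncp g (thead t) * @chainf w' (thead t) [tuple of behead t] else 0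
  end.

(** The last letter ensures the convergence of the iterated integrals at infinity. *)
Fixpoint good_word w : Prop :=
  if w is g :: w' then
    (if w' is [::] then decaying 0 g else moderate 0 g) /\ good_word w'
  else True.

Lemma good_ccont g w : good_word (g :: w) -> forall x, 0 < x -> ccont g x.
Proof. by case: w => [|? ?] [[]]. Qed.

Lemma measurable_thead n : measurable_fun [set: n.+1.-tuple T] (fun t => thead t : T).
Proof. exact: (@measurable_tnth _ T n.+1 ord0). Qed.

Lemma cmeas_chainf w : good_word w ->
  cmeas (fun z : T * (size w).-tuple T => chainf z.1 z.2).
Proof.
elim: w => [|g w IH] Hw; first exact: cmeas_cst.
have mth : measurable_fun [set: T * (size w).+1.-tuple T] (fun z => thead z.2 : T).
  exact: (measurableT_comp (@measurable_thead (size w)) measurable_snd).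
have mbh : measurable_fun [set: T * (size w).+1.-tuple T] (fun z => [tuple of behead z.2] : (size w).-tuple T).
  exact: (measurableT_comp (@measurable_behead _ T (size w)) measurable_snd).
rewrite /=.
apply: (@cmeas_if _ _ _ (fun z : T * (size w).+1.-tuple T => z.1 <= thead z.2)
   (fun z => truncp g (thead z.2) * chainf (thead z.2) [tuple of behead z.2]) (fun=> 0)).
- by apply: measurable_fun_ler => //; exact: measurable_fst.
- apply: cmeasM.
    by apply: (cmeas_comp _ mth); apply: cmeas_truncp; exact: good_ccont Hw.
  have {}IH : cmeas (fun z : T * (size w).-tuple T => chainf z.1 z.2) by apply: IH; case: Hw.
  have mp : measurable_fun [set: T * (size w).+1.-tuple T]
      (fun z => (thead z.2 : T, [tuple of behead z.2] : (size w).-tuple T)).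
    by apply/measurable_fun_pairP; split.
  exact: (cmeas_comp IH mp).
- exact: cmeas_cst.
Qed.

Lemma thead_cons n (z : T * n.-tuple T) : thead (tuple_cons z) = z.1.
Proof. by rewrite /thead /tuple_cons /= (tnth_nth z.1). Qed.

Lemma behead_cons n (z : T * n.-tuple T) : [tuple of behead (tuple_cons z)] = z.2.
Proof. exact: val_inj. Qed.

Section Step.
Variables (b : T -> bool) (g : R -> C) (w : seq (R -> C)).
Hypothesis mb : measurable_fun setT b.
Hypothesis b0 : forall x, b x -> 0 < x.
Hypothesis Hgw : good_word (g :: w).

(** The condition [b] on the first variable is either [x <= t_1], which gives the
   induction step for chains starting after [x], or [0 < t_1], which gives the simplex. *)
Definition stepf (t : (size w).+1.-tuple T) : C :=
  if b (thead t) then truncp g (thead t) * chainf (thead t) [tuple of behead t] else 0.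

Let c (x : T) : C := if b x then truncp g x else 0.
Let p (z : T * (size w).-tuple T) : C := chainf z.1 z.2.

Lemma stepf_cons z : stepf (tuple_cons z) = c z.1 * p z.
Proof. by rewrite /stepf thead_cons behead_cons /c /p; case: (b _); rewrite ?mul0r. Qed.

Lemma cmeas_stepc : cmeas c.
Proof.
apply: (@cmeas_if _ _ _ b (truncp g) (fun=> 0)) => //.
by apply: cmeas_truncp; exact: good_ccont Hgw.
Qed.

Lemma cmeas_stepf : cmeas stepf.
Proof.
have mth := @measurable_thead (size w).
have mbh := @measurable_behead _ T (size w).
apply: (@cmeas_if _ _ _ (fun t : (size w).+1.-tuple T => b (thead t))
   (fun t => truncp g (thead t) * chainf (thead t) [tuple of behead t]) (fun=> 0)).
- exact: measurableT_comp mb mth.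
- apply: cmeasM.
  by apply: (cmeas_comp _ mth); apply: cmeas_truncp; exact: good_ccont Hgw.
have mp : measurable_fun [set: (size w).+1.-tuple T]
    (fun t => (thead t : T, [tuple of behead t] : (size w).-tuple T)).
    by apply/measurable_fun_pairP; split.
  have mc : cmeas (fun z : T * (size w).-tuple T => chainf z.1 z.2).
    by apply: cmeas_chainf; case: Hgw.
  exact: (cmeas_comp mc mp).
- exact: cmeas_cst.
Qed.

Hypothesis IHbound : forall k : nat, exists M : R, forall x, 0 < x ->
  ((norm1 (g x))%:E * \int[L (size w)]_t (norm1 (chainf x t))%:E <= (M * expR (- (k%:R * x)))%:E)%E.
Hypothesis IHint : forall x, 0 < x -> Cintegrable (L (size w)) setT (chainf x) /\
  Cintegral (L (size w)) setT (chainf x) = titer x w.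

(** The integrand is compared with [M * exp (- k t)] on the half-line after [y]. *)
Lemma step_bound (k : nat) (M y : R) : 0 <= y -> (0 < k)%N -> (forall x, b x -> y <= x) ->
  (forall x : R, 0 < x ->
  ((norm1 (g x))%:E * \int[L (size w)]_t (norm1 (chainf x t))%:E <= (M * expR (- (k%:R * x)))%:E)%E) ->
  (\int[mu]_x ((norm1 (c x))%:E * \int[L (size w)]_t (norm1 (p (x, t)))%:E) <=
    (M * (expR (- (k%:R * y)) / k%:R))%:E)%E.
Proof.
move=> y0 k0 by_ HM; have k0R : 0 < k%:R :> R by rewrite ltr0n.
have M0 : 0 <= M.
  have := HM 1 ltr01; have : (0 <= (norm1 (g 1%R))%:E * \int[L (size w)]_t (norm1 (chainf 1 t))%:E)%E.
    by rewrite mule_ge0 ?lee_fin ?norm1_ge0//; apply: integral_ge0 => t _; rewrite lee_fin norm1_ge0.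
  by move=> /le_trans H /H; rewrite lee_fin pmulr_lge0// expR_gt0.
have [ie Ie] := expN_tail y k0R.
have E : (\int[mu]_(t in `[y, +oo[) (M * expR (- (k%:R * t)))%:E)%E = (M * (expR (- (k%:R * y)) / k%:R))%:E.
  under eq_integral do rewrite EFinM.
  rewrite ge0_integralZl ?lee_fin//; last first.
    exact: (measurable_int mu ie).
  by rewrite -Ie /Rintegral EFinM fineK//; exact: integrable_fin_num ie.
rewrite -E [leRHS]integral_mkcond; apply: ge0_le_integral => //.
- by move=> x _; rewrite mule_ge0 ?lee_fin ?norm1_ge0//; apply: integral_ge0 => t _; rewrite lee_fin norm1_ge0.
- apply: emeasurable_funM; first exact: cmeas_norm1 cmeas_stepc.
  apply: (@measurable_fun_fubini_tonelli_F _ _ _ _ _ (L (size w)) (fun z => (norm1 (p z))%:E)) => [|z].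
    by apply: cmeas_norm1; apply: cmeas_chainf; case: Hgw.
  by rewrite lee_fin norm1_ge0.
- apply/(measurable_restrictT _ _).1 => //.
  apply/measurable_EFinP; apply: measurable_funM => //.
  by apply/measurable_EFinP; exact: (measurable_int mu ie).
move=> x _; rewrite patchE mem_setE in_itv/= andbT /c.
case: ifPn => [bx|_]; last first.
  rewrite norm10 mul0e; case: ifP => // _; by rewrite lee_fin mulr_ge0 ?expR_ge0.
rewrite by_// /truncp b0//.
exact: HM (b0 bx).
Qed.

Lemma step_lty : (\int[mu]_x ((norm1 (c x))%:E * \int[L (size w)]_t (norm1 (p (x, t)))%:E) < +oo)%E.
Proof.
have [M HM] := IHbound 1; apply: le_lt_trans (step_bound (lexx 0) (ltn0Sn 0) _ HM) (ltry _).
by move=> x /b0/ltW.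
Qed.

Lemma stepP : Cintegrable (L (size w).+1) setT stepf /\
  Cintegral (L (size w).+1) setT stepf = Cintegral mu setT (fun x => if b x then g x * titer x w else 0).
Proof.
have mp : cmeas p by apply: cmeas_chainf; case: Hgw.
have [i1 e1] := @Cintegral_product R _ _ (L (size w)) c p cmeas_stepc mp
  (fun x => ltac:(rewrite /c; case: ifPn => [bx _|_ /eqP//]; exact: (IHint (b0 bx)).1)) step_lty.
have E : (fun z => stepf (tuple_cons z)) = (fun z => c z.1 * p z).
  by apply/funext => z; exact: stepf_cons.
have [i2 e2] := @Cintegral_tupleS R (size w) stepf cmeas_stepf ltac:(by rewrite E).
split => //; rewrite e2 E e1; congr Cintegral; apply/funext => x.
rewrite /c; case: ifPn => [bx|_]; last by rewrite mul0r.
by rewrite /truncp b0// (IHint (b0 bx)).2.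
Qed.

Lemma step_norm1 (k : nat) (M y : R) : 0 <= y -> (0 < k)%N -> (forall x, b x -> y <= x) ->
  (forall x : R, 0 < x ->
  ((norm1 (g x))%:E * \int[L (size w)]_t (norm1 (chainf x t))%:E <= (M * expR (- (k%:R * x)))%:E)%E) ->
  (\int[L (size w).+1]_t (norm1 (stepf t))%:E <= (M * (expR (- (k%:R * y)) / k%:R))%:E)%E.
Proof.
move=> y0 k0 by_ HM; apply: le_trans (step_bound y0 k0 by_ HM).
have mp : cmeas p by apply: cmeas_chainf; case: Hgw.
rewrite ge0_integral_tupleS; [|exact: cmeas_norm1 cmeas_stepf|by move=> t; rewrite lee_fin norm1_ge0].
under eq_integral do rewrite stepf_cons.
exact: norm1_product_le cmeas_stepc mp.
Qed.

End Step.

(** The decay of the last letter absorbs the exponential growth of the other ones, and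
   is passed from each variable to the previous one. *)
Lemma chainf_bound g w k : good_word (g :: w) -> exists M : R, forall x, 0 < x ->
  ((norm1 (g x))%:E * \int[L (size w)]_t (norm1 (chainf x t))%:E <= (M * expR (- (k%:R * x)))%:E)%E.
Proof.
elim: w g k => [|h w IH] g k Hgw.
  have [[_ /(_ k)[M HM]] _] := Hgw; exists (2 * M) => x x0.
  rewrite /= integral_dirac// diracT mul1e -EFinM lee_fin /norm1 /= normr1 normr0 addr0 mulr1.
  by apply: le_trans (norm1_le _) _; rewrite -mulrA ler_wpM2l// HM.
have [[_ [n [A HA]]] Hw] := Hgw.
have [M HM] := IH h (n + k).+1 Hw.
have A0 : 0 <= A.
  have /(le_trans (normc_ge0 _)) := HA 1 ltr01.
  by rewrite pmulr_lge0// expR_gt0.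
exists (2 * A * M) => x x0.
have mb : measurable_fun [set: T] (fun t : T => (0 < x) && (x <= t)).
  by rewrite x0; exact: measurable_fun_ler.
have bx t : (0 < x) && (x <= t) -> 0 < t by move=> /andP[x0' xt]; exact: lt_le_trans xt.
have := @step_norm1 _ h w mb bx Hw (n + k).+1 M x (ltW x0) (ltn0Sn _) (fun t => fun H => (andP H).2) HM.
have -> : (fun t => (norm1 (stepf (fun t : T => (0 < x) && (x <= t)) h t))%:E) =
     (fun t : (size w).+1.-tuple T => (norm1 (@chainf (h :: w) x t))%:E).
  by apply/funext => t; rewrite /stepf /= x0.
move=> H; apply: (@le_trans _ _ ((2 * A * expR (n%:R * x))%:E * (M * (expR (- ((n + k).+1%:R * x)) / (n + k).+1%:R))%:E)%E).
  apply: lee_pmul => //; rewrite ?lee_fin ?norm1_ge0//.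
    by apply: integral_ge0 => t _; rewrite lee_fin norm1_ge0.
  by apply: le_trans (norm1_le _) _; rewrite -mulrA ler_wpM2l// HA.
have M0 : 0 <= M.
  have := HM 1 ltr01; have : (0 <= (norm1 (h 1%R))%:E * \int[L (size w)]_t (norm1 (chainf 1 t))%:E)%E.
    by rewrite mule_ge0 ?lee_fin ?norm1_ge0//; apply: integral_ge0 => t _; rewrite lee_fin norm1_ge0.
  by move=> /le_trans H' /H'; rewrite lee_fin pmulr_lge0// expR_gt0.
rewrite -EFinM lee_fin mulrACA ler_wpM2l ?mulr_ge0// mulrA -expRD.
rewrite ler_pdivrMr ?ltr0n// -[leLHS]mulr1; apply: ler_pM; rewrite ?expR_ge0//.
  rewrite ler_expR -natr1 natrD; lra.
by rewrite ler1n.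
Qed.

Lemma chainf_integral w x : good_word w -> 0 < x -> Cintegrable (L (size w)) setT (chainf x) /\
  Cintegral (L (size w)) setT (chainf x) = titer x w.
Proof.
elim: w x => [|g w IH] x Hw x0.
  have mw (f : 0.-tuple T -> R) : measurable_fun setT f.
    rewrite (_ : f = fun=> f [tuple]); first exact: measurable_cst.
    by apply/funext => t; rewrite (tuple0 t).
  split.
    apply: Cintegrable_norm1; first exact: cmeas_cst.
    by rewrite /= integral_dirac// diracT mul1e ltry.
  by apply: complexP; rewrite /= /Rintegral integral_dirac// diracT mul1e.
have Hw' : good_word w by case: Hw.
have mb : measurable_fun [set: T] (fun t : T => (0 < x) && (x <= t)).
  by rewrite x0; exact: measurable_fun_ler.
have bx t : (0 < x) && (x <= t) -> 0 < t by move=> /andP[x0' xt]; exact: lt_le_trans xt.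
have [i e] := stepP mb bx Hw (fun k => chainf_bound k Hw) (fun y => IH y Hw').
have E : @chainf (g :: w) x = stepf (fun t : T => (0 < x) && (x <= t)) g (w := w).
  by apply/funext => t; rewrite /stepf /= x0.
rewrite E; split => //; rewrite e /= /tint; apply: complexP; rewrite /= [RHS]Rintegral_mkcond.
  congr Rintegral; apply/funext => t; rewrite patchE mem_setE in_itv/= andbT x0 /=.
  by case: ifP.
congr Rintegral; apply/funext => t; rewrite patchE mem_setE in_itv/= andbT x0 /=.
by case: ifP.
Qed.

Definition titer0 w : C :=
  if w is g :: w' then Cintegral mu `]0, +oo[%classic (fun t => g t * titer t w') else 1.

Lemma chainf_density w x t : 0 < x ->
  @chainf w x t = if path (fun x y : R => x <= y) x t then word_density t else 0.
Proof.
elim: w x t => [|g w IH] x t x0.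
  by rewrite (tuple0 t) /= /word_density big_ord0.
case/tupleP: t => a t /=; rewrite theadE.
have -> : [tuple of behead [tuple of a :: t]] = t by exact: val_inj.
case: ifPn => //= xa; have a0 : 0 < a by exact: lt_le_trans xa.
rewrite IH// /truncp a0; case: ifP => _; last by rewrite mulr0.
rewrite /word_density [RHS]big_ord_recl /=; congr (_ * _).
by apply: eq_bigr => i _; rewrite tnthS.
Qed.

Lemma measurable_chain n : measurable_fun [set: T * n.-tuple T]
  (fun z => path (fun x y : R => x <= y) z.1 z.2).
Proof.
elim: n => [|n IH].
  by rewrite (_ : (fun z => _) = fun=> true)//; apply/funext => -[x t]; rewrite (tuple0 t).
have mth : measurable_fun [set: T * n.+1.-tuple T] (fun z => thead z.2 : T).
  exact: (measurableT_comp (@measurable_thead n) measurable_snd).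
have mbh : measurable_fun [set: T * n.+1.-tuple T] (fun z => [tuple of behead z.2] : n.-tuple T).
  exact: (measurableT_comp (@measurable_behead _ T n) measurable_snd).
have mp : measurable_fun [set: T * n.+1.-tuple T]
    (fun z => (thead z.2 : T, [tuple of behead z.2] : n.-tuple T)).
  by apply/measurable_fun_pairP; split.
have m1 : measurable_fun [set: T * n.+1.-tuple T] (fun z => z.1 <= (thead z.2 : R)).
  by apply: measurable_fun_ler => //; exact: measurable_fst.
have := measurable_and m1 (measurableT_comp IH mp).
by congr measurable_fun; apply/funext => -[x t]; case/tupleP: t => a t /=; rewrite theadE.
Qed.

Lemma simplexE n (t : n.+1.-tuple T) :
  (t \in @simplex R n.+1) = (0 < thead t) && path (fun x y : R => x <= y) (thead t) (behead t).
Proof.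
case/tupleP: t => a t; rewrite theadE /=; apply/idP/idP; rewrite inE.
  move=> [/= pt pos]; rewrite pt andbT.
  by have := pos ord0; rewrite (tnth_nth 0).
move=> /andP[a0 pt]; split => //= j.
have := order_path_min (@le_trans _ R) pt => /allP H.
have : tnth [tuple of a :: t] j \in (a :: t) by exact: mem_tnth.
rewrite in_cons => /predU1P[->//|/H]; exact: lt_le_trans.
Qed.

Lemma measurable_simplex n : measurable (@simplex R n.+1).
Proof.
have mp : measurable_fun [set: n.+1.-tuple T]
    (fun t => (thead t : T, [tuple of behead t] : n.-tuple T)).
  by apply/measurable_fun_pairP; split; [exact: measurable_thead|exact: measurable_behead].
have m0 : measurable_fun [set: n.+1.-tuple T] (fun t => 0 < (thead t : R)).
  by apply: measurable_fun_ltr => //; exact: measurable_thead.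
have mb := measurable_and m0 (measurableT_comp (@measurable_chain n) mp).
rewrite (_ : @simplex R n.+1 = (setT `&` (fun t => (0 < (thead t : R)) && path (fun x y : R => x <= y) (thead t) (behead t)) @^-1` [set true])).
  exact: (mb measurableT [set true]).
rewrite setTI; apply/seteqP; split => t.
  by move=> H; rewrite /preimage /mkset -simplexE mem_set.
by rewrite /preimage /mkset -simplexE => /set_mem.
Qed.

(** The region of integration is the set where [0 < t_1] and the chain condition holds,
   so that its integral is the last step of the recursion of [chainf_integral]. *)
Lemma simplex_integral g w : good_word (g :: w) ->
  Cintegrable (L (size w).+1) (@simplex R (size w).+1) (@word_density R (g :: w)) /\
  Cintegral (L (size w).+1) (@simplex R (size w).+1) (@word_density R (g :: w)) = titer0 (g :: w).
Proof.
move=> Hw; have Hw' : good_word w by case: Hw.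
have mb : measurable_fun [set: T] (fun t : T => 0 < t) by exact: measurable_fun_ltr.
have [i e] := stepP mb (fun x H => H) Hw (fun k => chainf_bound k Hw) (fun y => @chainf_integral w y Hw').
have E : stepf (fun t : T => 0 < t) g (w := w) =
    (fun t => if t \in @simplex R (size w).+1 then @word_density R (g :: w) t else 0).
  apply/funext => t; case/tupleP: t => a t.
  rewrite /stepf theadE.
  have -> : [tuple of behead [tuple of a :: t]] = t by exact: val_inj.
  rewrite simplexE theadE /=.
  case: ifPn => //= a0; rewrite chainf_density// /truncp a0; case: ifP => _; last by rewrite mulr0.
  rewrite /word_density [RHS]big_ord_recl /=; congr (_ * _).
  by apply: eq_bigr => j _; rewrite tnthS.
have mS := @measurable_simplex (size w).
have Re_E : (fun t => complex.Re (stepf (fun t : T => 0 < t) g (w := w) t)) =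
   (fun t => complex.Re (@word_density R (g :: w) t)) \_ (@simplex R (size w).+1).
  by apply/funext => t; rewrite E patchE; case: ifP.
have Im_E : (fun t => complex.Im (stepf (fun t : T => 0 < t) g (w := w) t)) =
   (fun t => complex.Im (@word_density R (g :: w) t)) \_ (@simplex R (size w).+1).
  by apply/funext => t; rewrite E patchE; case: ifP.
have [i1 i2] := i; split.
  split.
    by apply/integrable_mkcond => //; rewrite restrict_EFin -Re_E.
  by apply/integrable_mkcond => //; rewrite restrict_EFin -Im_E.
rewrite /Cintegral Rintegral_mkcond [X in _ +i* X]Rintegral_mkcond -Re_E -Im_E -/(Cintegral _ _ _).
move: e; rewrite /Cintegral => ->.
by rewrite /titer0 /Cintegral; congr (_ +i* _); rewrite [RHS]Rintegral_mkcond; congr Rintegral;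
  apply/funext => t; rewrite patchE mem_setE in_itv/= andbT; case: ifP.
Qed.

End WordsOnTuples.

(** * The limit at zero *)
Section LimitAtZero.
Variable R : realType.
Local Notation C := R[i].
Local Notation mu := (@lebesgue_measure R).

(** The difference is the integral over ]0, x], where [f] is bounded by [M]. *)
Lemma head_integral_bound (f : R -> R) (M : R) x : 0 < x ->
  (forall t, 0 < t -> {for t, continuous f}) ->
  (forall t, 0 < t -> `|f t| <= M * expR (- t)) ->
  `|\int[mu]_(t in `]0, +oo[) f t - \int[mu]_(t in `[x, +oo[) f t| <= M * x.
Proof.
move=> x0 cf fM.
have M0 : 0 <= M.
  have /(le_trans (normr_ge0 _)) := fM x x0.
  by rewrite pmulr_lge0// expR_gt0.
have [ie _] := expN_tail 0 (ltr01 : 0 < 1 :> R).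
have ie' : mu.-integrable `]0, +oo[ (EFin \o (fun t => expR (- (1 * t)))).
  by apply: integrableS ie => //; apply: subset_itvr; rewrite bnd_simp.
have iM : mu.-integrable `]0, +oo[ (EFin \o (fun t => M * expR (- (1 * t)))).
  have -> : EFin \o (fun t => M * expR (- (1 * t))) = (fun t => M%:E * (EFin \o (fun t => expR (- (1 * t)))) t)%E.
    by apply/funext => t; rewrite /= EFinM.
  exact: integrableZl.
have mf : measurable_fun (`]0, +oo[%classic : set R) f.
  apply: subspace_continuous_measurable_fun => //.
  by apply: continuous_in_subspaceT => t; rewrite inE/= in_itv/= andbT; exact: cf.
have intf : mu.-integrable `]0, +oo[ (EFin \o f).
  apply: (le_integrable _ _ _ iM) => //; first exact/measurable_EFinP.
  move=> t; rewrite /= in_itv/= andbT => t0.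
  by rewrite lee_fin mul1r (le_trans (fM t t0))// ler_norm.
have intx : mu.-integrable `]0, x] (EFin \o f).
  by apply: integrableS intf => //; apply: subset_itvl.
have := @Rintegral_itvB _ f (BRight 0) +oo%O x intf.
rewrite !bnd_simp => /(_ (ltW x0) isT).
have -> : \int[mu]_(t in `]x, +oo[) f t = \int[mu]_(t in `[x, +oo[) f t.
  apply: Rintegral_itv_obnd_cbnd.
  by apply: integrableS intf => //; apply: subset_itvr; rewrite bnd_simp ltW.
move=> /esym ->; rewrite opprB addrCA subrr addr0.
apply: (le_trans (le_normr_Rintegral _ intx)) => //.
have -> : M * x = \int[mu]_(t in `]0, x]) M.
  by rewrite Rintegral_cst// /= lebesgue_measure_itv/= lte_fin x0 /= subr0.
apply: le_Rintegral => //.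
- by have := integrable_norm intx; apply: eq_integrable.
- have : mu.-integrable `[0, x] (EFin \o (fun=> M)).
    by apply: continuous_compact_integrable; [exact: segment_compact|move=> ?; exact: cvg_cst].
  by apply: integrableS => //; apply: subset_itvr; rewrite bnd_simp.
move=> t /=; rewrite in_itv/= => /andP[t0 _].
apply: le_trans (fM t t0) _; rewrite -[leRHS]mulr1 ler_wpM2l//.
by rewrite -expR0 ler_expR oppr_le0 ltW.
Qed.

Lemma cvg_tint0 (f : R -> C) : decaying 0 f ->
  tint x f @[x --> 0^'+] --> Cintegral mu `]0, +oo[%classic f.
Proof.
move=> [cf /(_ 1%N)[M HM]]; apply: cvgc_normP => e e0.
have M0 : 0 <= M.
  have /(le_trans (normc_ge0 _)) := HM 1 ltr01.
  by rewrite pmulr_lge0// expR_gt0.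
near=> x.
have x0 : 0 < x by near: x; exact: nbhs_right_gt.
have xe : x < e / (2 * (M + 1)).
  by near: x; apply: nbhs_right_lt; rewrite divr_gt0// mulr_gt0// ltr_pwDr.
apply: le_trans (normc_le_ReIm _) _; rewrite !cReD !cImD !cReN !cImN.
have HM' t : 0 < t -> normc (f t) <= M * expR (- t).
  by move=> t0; have := HM t t0; rewrite mul1r.
have Re_b := @head_integral_bound (fun t => complex.Re (f t)) M x x0 (fun t t0 => (cf t t0).1)
  (fun t t0 => le_trans (Re_le_normc _) (HM' t t0)).
have Im_b := @head_integral_bound (fun t => complex.Im (f t)) M x x0 (fun t t0 => (cf t t0).2)
  (fun t t0 => le_trans (Im_le_normc _) (HM' t t0)).
apply: le_trans (lerD Re_b Im_b) _.
move: xe; rewrite ltr_pdivlMr; last by rewrite mulr_gt0// ltr_pwDr.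
move=> xe; apply: le_trans (ltW xe); nra.
Unshelve. all: by end_near. Qed.

Lemma cvg_titer0 (w : seq (letter R)) (c : R -> C) : admissible_word 0 w -> decaying 0 c ->
  titer x (rcons (map (@dens R) w) c) @[x --> 0^'+] --> titer0 (rcons (map (@dens R) w) c).
Proof.
case: w => [|l w] Hw dc.
  have dc1 : decaying 0 (fun t => c t * 1).
    by rewrite (_ : (fun t => c t * 1) = c)//; apply/funext => t; rewrite mulr1.
  exact: cvg_tint0 dc1.
have [Hl {}Hw] := admissible_word_cons Hw.
have D : decaying 0 (fun t => dens l t * titer t (rcons (map (@dens R) w) c)).
  by apply: decayingMl; [exact: moderate_dens|exact: decaying_titer].
exact: cvg_tint0 D.
Qed.

Lemma cvg_bigsum_in (I : eqType) (T : Type) (F : set_system T) {FF : Filter F} (r : seq I)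
    (f : I -> T -> C) (l : I -> C) :
  (forall i, i \in r -> f i x @[x --> F] --> l i) ->
  \sum_(i <- r) f i x @[x --> F] --> \sum_(i <- r) l i.
Proof.
move=> H; rewrite big_seq big_mkcond /=; under eq_fun do rewrite big_seq big_mkcond /=.
apply: cvg_bigsum => i; case: ifP => [|_]; [exact: H|exact: cvgc_cst].
Qed.

(** The value of [regint] at the lower end 0. *)
Definition regint0 (u : seq C) : C :=
  if u is [::] then 1 else
  \sum_(i < size u) (-1) ^+ (size u - i.+1) *
    shsum (fun w => titer0 (rcons (map (@dens R) w) (mellin_form theta_zero (nth 0 u i))))
      (map inl (take i u)) (map inr (rev (drop i.+1 u))).

Lemma cvg_regint0 u : all_admissible 0 u -> regint x u @[x --> 0^'+] --> regint0 u.
Proof.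
move=> Hu; case: (eqVneq u [::]) => [->|u0]; first exact: cvgc_cst.
rewrite (funext (fun x => regintE x u0)).
have -> : regint0 u = \sum_(i < size u) (-1) ^+ (size u - i.+1) *
    shsum (fun w => titer0 (rcons (map (@dens R) w) (mellin_form theta_zero (nth 0 u i))))
      (map inl (take i u)) (map inr (rev (drop i.+1 u))) by case: (u) u0.
apply: cvg_bigsum => i; apply: cvgcM; first exact: cvgc_cst.
have sh : forall w, w \in shuffle (map inl (take i u)) (map inr (rev (drop i.+1 u))) ->
    admissible_word 0 w.
  move=> w; apply: admissible_shuffle.
    by apply/admissible_inl/all_admissible_sub/Hu => z; exact: mem_take.
  by apply/admissible_inr/all_admissible_sub/Hu => z; rewrite mem_rev; exact: mem_drop.
apply: cvg_bigsum_in => w /sh Hw; apply: cvg_titer0 => //; apply: decaying_theta_zero_form.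
by apply: Hu; exact: mem_nth.
Qed.

Lemma cvg_powint_0 (u : seq C) : (forall z, z \in u -> 0 < complex.Re z) ->
  powint x u @[x --> 0^'+] --> counit C u.
Proof.
move=> Hu; case: u Hu => [|z u] Hu.
  rewrite /powint csum_nil /=; under eq_fun do rewrite cpowt0 mulr1; exact: cvgc_cst.
rewrite /powint -[counit _ _]/(0 : C) -(mul0r (tail_coef (z :: u))); apply: cvgcM; last exact: cvgc_cst.
by apply: cvg_cpow_0; exact: Re_csum_gt0.
Qed.

Lemma cvg_inv_0 : (x : R)^-1 @[x --> 0^'+] --> +oo.
Proof.
apply/cvgryPge => A; near=> x.
have x0 : 0 < x by near: x; exact: nbhs_right_gt.
have A0 : 0 < `|A| + 1 by rewrite ltr_pwDr.
have xA : x < (`|A| + 1)^-1 by near: x; apply: nbhs_right_lt; rewrite invr_gt0.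
apply: (@le_trans _ _ (`|A| + 1)); first by rewrite (le_trans (ler_norm _))// lerDl.
by rewrite -[leLHS]invrK lef_pV2 ?posrE ?invr_gt0// ltW.
Unshelve. all: by end_near. Qed.

(** Both expressions are limits of [theta_tail x u] at 0. In its definition the factors
   [powint x] of nonempty words vanish at 0; in [theta_tail_split], the exponents of the
   reflected forms have negative real parts, so that [theta_path] converges at
   infinity. *)
Lemma regint0E u : (forall z, z \in u -> 2 <= complex.Re z) ->
  regint0 u = conv (fun w => theta_tail 1 (mirror w)) (theta_tail 1) u.
Proof.
move=> Hu; have Hadm : all_admissible 0 u by move=> z /Hu zu; rewrite /admissible zu lexx orbT.
have Hpos z : z \in u -> 0 < complex.Re z by move=> /Hu; apply: lt_le_trans.
have tu := tails_neq0_gt0 Hpos.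
have Hneg z : z \in u -> complex.Re (1 - z) < 0.
  by move=> /Hu; rewrite cReD cReN /=; lra.
have C1 : theta_tail x u @[x --> 0^'+] --> regint0 u.
  rewrite -[regint0 u]convw1; apply: cvg_conv => i.
    by apply: cvg_regint0; exact: all_admissible_take.
  by apply: cvg_powint_0 => z /mem_drop; exact: Hpos.
apply: (cvg_unique _ C1); first exact: norm_hausdorff.
have C2 : conv (fun w => theta_path x^-1 (mirror w)) (theta_tail 1) u @[x --> 0^'+] -->
    conv (fun w => theta_tail 1 (mirror w)) (theta_tail 1) u.
  apply: cvg_conv => i; last exact: cvgc_cst.
  apply: (cvg_comp _ _ cvg_inv_0 (cvg_theta_path_pinfty _)) => z.
  by rewrite mem_rev => /mapP[w /mem_take wu ->]; exact: Hneg.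
apply: cvg_trans C2; apply: near_eq_cvg; near=> x.
by rewrite theta_tail_split//; near: x; exact: nbhs_right_gt.
Unshelve. all: by end_near. Qed.

End LimitAtZero.

(** * The integral of the regularisation *)
Section RegularisationIntegral.
Variable R : realType.
Local Notation C := R[i].
Local Notation L n := (@lebesgue_tuple R n).

Lemma enum_take_ord r n : [seq j : 'I_r <- enum 'I_r | (j < n)%N] = take n (enum 'I_r).
Proof.
have E : forall j : 'I_r, (j < n)%N = (j \in take n (enum 'I_r)).
  by move=> j; rewrite in_take ?mem_enum// index_enum_ord.
rewrite (eq_filter E); have := enum_uniq 'I_r; set t := take _ _.
have -> : enum 'I_r = t ++ drop n (enum 'I_r) by rewrite cat_take_drop.
rewrite cat_uniq => /and3P[_ /hasPn td _]; rewrite filter_cat.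
rewrite (@eq_in_filter _ _ predT) ?filter_predT => [|j ->//].
by rewrite (@eq_in_filter _ _ pred0) ?filter_pred0 ?cats0// => j /td/negbTE.
Qed.

Lemma enum_drop_ord r n : [seq j : 'I_r <- enum 'I_r | (n <= j)%N] = drop n (enum 'I_r).
Proof.
have E : forall j : 'I_r, (n <= j)%N = (j \notin take n (enum 'I_r)).
  by move=> j; rewrite in_take ?mem_enum// index_enum_ord leqNgt.
rewrite (eq_filter E); have := enum_uniq 'I_r; set t := take _ _; set d := drop _ _.
have -> : enum 'I_r = t ++ d by rewrite cat_take_drop.
rewrite cat_uniq => /and3P[_ /hasPn td _]; rewrite filter_cat.
rewrite (@eq_in_filter _ _ pred0) ?filter_pred0 ?cat0s => [|j ->//].
by rewrite (@eq_in_filter _ _ predT) ?filter_predT// => j; exact: td.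
Qed.

Definition coords r (s : 'rV[C]_r) : seq C := [seq s ord0 i | i <- enum 'I_r].

Lemma size_coords r (s : 'rV[C]_r) : size (coords s) = r.
Proof. by rewrite size_map size_enum_ord. Qed.

Lemma nth_coords r (s : 'rV[C]_r) (i : 'I_r) : nth 0 (coords s) i = s ord0 i.
Proof. by rewrite (nth_map i) ?size_enum_ord// nth_ord_enum. Qed.

Lemma mem_coords r (s : 'rV[C]_r) z : reflect (exists i, z = s ord0 i) (z \in coords s).
Proof.
apply: (iffP mapP) => [[i _ ->]|[i ->]]; first by exists i.
by exists i => //; rewrite mem_enum.
Qed.

Lemma good_word_rcons (w : seq (letter R)) (c : R -> C) : admissible_word 0 w -> decaying 0 c ->
  good_word (rcons (map (@dens R) w) c).
Proof.
elim: w => [|l w IH] Hw dc //=; have [Hl {}Hw] := admissible_word_cons Hw.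
split; last exact: IH.
by have := moderate_dens Hl; case: w {IH Hw}.
Qed.

Lemma simplex_integral_rcons (w : seq (letter R)) (c : R -> C) :
  admissible_word 0 w -> decaying 0 c ->
  let v := rcons (map (@dens R) w) c in
  Cintegrable (L (size v)) (@simplex R (size v)) (@word_density R v) /\
  Cintegral (L (size v)) (@simplex R (size v)) (@word_density R v) = titer0 v.
Proof.
move=> Hw dc; have := good_word_rcons Hw dc.
by case: (rcons _ _) (size_rcons (map (@dens R) w) c) => // g v _; exact: simplex_integral.
Qed.

Lemma regularisationE r (s : 'rV[C]_r) : regularisation s = flatten [seq
    [seq ((-1) ^+ (r - i.+1), rcons (map (@dens R) w) (mellin_form theta_zero (s ord0 i)))
    | w <- shuffle (map inl (take i (coords s))) (map inr (rev (drop i.+1 (coords s))))]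
  | i : 'I_r <- enum 'I_r].
Proof.
rewrite /regularisation; congr flatten; apply: eq_map => i.
rewrite enum_take_ord (enum_drop_ord r i.+1).
have -> : take i (coords s) = map (fun j => s ord0 j) (take i (enum 'I_r)) by rewrite map_take.
have -> : drop i.+1 (coords s) = map (fun j => s ord0 j) (drop i.+1 (enum 'I_r)) by rewrite map_drop.
move: (take _ _) (drop _ _) => t d.
rewrite (_ : [seq mellin_form theta (s ord0 j) | j <- t] =
  map (@dens R) (map inl (map (fun j => s ord0 j) t))); last by rewrite -!map_comp.
rewrite (_ : rev [seq mellin_form theta_infty (s ord0 j) | j <- d] =
  map (@dens R) (map inr (rev (map (fun j => s ord0 j) d)))); last by rewrite -!map_rev -!map_comp.
by rewrite shuffle_map -map_comp.
Qed.

Lemma regularisation_integral r (s : 'rV[C]_r) : (0 < r)%N ->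
  (forall i, 2 <= complex.Re (s ord0 i)) ->
  iint_cvg (regularisation s) /\ iint (regularisation s) = regint0 (coords s).
Proof.
move=> r0 Hs.
have Hadm : all_admissible 0 (coords s).
  by move=> z /mem_coords[i ->]; rewrite /admissible Hs lexx orbT.
have Hc i : decaying 0 (mellin_form theta_zero (s ord0 i) : R -> C).
  by apply: decaying_theta_zero_form; apply: Hadm; apply/mem_coords; exists i.
have Hsh (i : 'I_r) w : w \in shuffle (map inl (take i (coords s))) (map inr (rev (drop i.+1 (coords s)))) ->
    admissible_word 0 w.
  apply: admissible_shuffle.
    by apply/admissible_inl/all_admissible_sub/Hadm => z; exact: mem_take.
  by apply/admissible_inr/all_admissible_sub/Hadm => z; rewrite mem_rev; exact: mem_drop.
rewrite regularisationE; split.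
  pose P (cw : C * word) := `[< Cintegrable (L (size cw.2)) (@simplex R (size cw.2)) (@word_density R cw.2) >].
  suff /all_nthP H : all P (flatten [seq
    [seq ((-1) ^+ (r - i.+1), rcons (map (@dens R) w) (mellin_form theta_zero (s ord0 i)))
    | w <- shuffle (map inl (take i (coords s))) (map inr (rev (drop i.+1 (coords s))))]
  | i : 'I_r <- enum 'I_r]) by move=> i /(H (0, [::])) /asboolP.
  have -> : forall ss : seq (seq (C * word)), all P (flatten ss) = all (all P) ss.
    by elim=> //= t ss IH; rewrite all_cat IH.
  rewrite all_map; apply/allP => i _ /=; rewrite all_map; apply/allP => w /Hsh Hw /=.
  by apply/asboolP; case: (simplex_integral_rcons Hw (Hc i)).
rewrite /iint big_flatten /= big_map big_enum /=.
have -> : regint0 (coords s) = \sum_(i < r) (-1) ^+ (r - i.+1) *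
    shsum (fun w => titer0 (rcons (map (@dens R) w) (mellin_form theta_zero (s ord0 i))))
      (map inl (take i (coords s))) (map inr (rev (drop i.+1 (coords s)))).
  transitivity (\sum_(i < size (coords s)) (-1) ^+ (size (coords s) - i.+1) *
    shsum (fun w => titer0 (rcons (map (@dens R) w) (mellin_form theta_zero (nth 0 (coords s) i))))
      (map inl (take i (coords s))) (map inr (rev (drop i.+1 (coords s))))).
    by case: (coords s) (size_coords s) r0 => // <-.
  by rewrite size_coords; apply: eq_bigr => i _; rewrite nth_coords.
apply: eq_bigr => i _; rewrite big_map /= -big_distrr /=; congr (_ * _).
rewrite /shsum [LHS]big_seq [RHS]big_seq; apply: eq_bigr => w /Hsh Hw.
by case: (simplex_integral_rcons Hw (Hc i)).
Qed.

End RegularisationIntegral.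

(** * The xi function *)
Section Xi.
Variable R : realType.
Local Notation C := R[i].
Implicit Types u v : seq C.

Definition xi_word u : C := conv (fun w => theta_tail 1 (mirror w)) (@theta_tail R 1) u.

Definition xi r (s : 'rV[C]_r) : C := xi_word (coords s).

Lemma conv_mirror (A B : seq C -> C) u :
  conv A B (mirror u) = conv (fun w => B (mirror w)) (fun w => A (mirror w)) u.
Proof. by rewrite /mirror conv_rev conv_map. Qed.

Lemma xi_word_mirror u : xi_word (mirror u) = xi_word u.
Proof.
by rewrite /xi_word conv_mirror; apply: eq_conv => w //; rewrite mirrorK.
Qed.

(** The part of xi that depends on [theta]; it is entire in the exponents. *)
Definition xi_core u : C := conv (fun w => regint 1 (mirror w)) (@regint R 1) u.

(** Grouping the four factors of the two copies of [theta_tail 1] by associativity. *)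
Lemma xi_word_core u : xi_word u =
  conv (conv (fun w => tail_coef (mirror w)) xi_core) (@tail_coef R) u.
Proof.
have G w : theta_tail 1 w = conv (@regint R 1) (@tail_coef R) w.
  by apply: eq_conv => v //; exact: powint1.
rewrite /xi_word (@eq_conv _ _ _ (conv (fun w => tail_coef (mirror w)) (fun w => regint 1 (mirror w)))
   _ (conv (@regint R 1) (@tail_coef R)))//.
  by rewrite convA; apply: eq_conv => v //; rewrite convA.
by move=> w; rewrite G conv_mirror.
Qed.

Lemma tail_coefE v : tail_coef v = \prod_(j < size v) - (csum (drop j v))^-1.
Proof. by elim: v => [|z v IH] /=; rewrite ?big_ord0// big_ord_recl /= IH. Qed.

Lemma csum_cat u v : csum (u ++ v) = csum u + csum v. Proof. exact: big_cat. Qed.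

Lemma csum_mirror u : csum (mirror u) = (size u)%:R - csum u.
Proof.
elim: u => [|z u IH]; first by rewrite csum_nil subr0.
rewrite mirror_cons -cats1 csum_cat IH /= !csum_cons csum_nil addr0 -natr1; ring.
Qed.

Lemma mirror_rcons u z : mirror (rcons u z) = (1 - z) :: mirror u.
Proof. by rewrite /mirror map_rcons rev_rcons. Qed.

Lemma tail_coef_mirror u : tail_coef (mirror u) = \prod_(i < size u) (csum (take i.+1 u) - i.+1%:R)^-1.
Proof.
elim/last_ind: u => [|u z IH]; first by rewrite big_ord0.
have E : take (size u).+1 (rcons u z) = rcons u z by rewrite -(size_rcons u z) take_size.
rewrite size_rcons big_ord_recr E /= mirror_rcons mulrC.
rewrite -[tail_coef _]/(- (csum ((1 - z) :: mirror u))^-1 * tail_coef (mirror u)).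
rewrite -mirror_rcons csum_mirror size_rcons -invrN opprB {}IH; congr (_ * _).
apply: eq_bigr => i _; rewrite -cats1 takel_cat//.
Qed.

Lemma csum_take_coords r (s : 'rV[C]_r) n : csum (take n (coords s)) = \sum_(j < r | (j < n)%N) s ord0 j.
Proof. by rewrite /csum /coords -map_take -enum_take_ord big_map big_filter big_enum_cond. Qed.

Lemma csum_drop_coords r (s : 'rV[C]_r) n : csum (drop n (coords s)) = \sum_(j < r | (n <= j)%N) s ord0 j.
Proof. by rewrite /csum /coords -map_drop -enum_drop_ord big_map big_filter big_enum_cond. Qed.

Lemma tail_coef_drop r (s : 'rV[C]_r) m : tail_coef (drop m (coords s)) =
  \prod_(i < r | (m <= i)%N) - (tail_form i s)^-1.
Proof.
rewrite tail_coefE size_drop size_coords.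
under eq_bigr => j _ do rewrite drop_drop csum_drop_coords.
rewrite -(big_mkord xpredT (fun j => - (\sum_(l < r | (j + m <= l)%N) s ord0 l)^-1)).
rewrite -(big_addn 0 r m xpredT (fun j => - (\sum_(l < r | (j <= l)%N) s ord0 l)^-1)) add0n.
rewrite -(big_mkord (fun i => m <= i)%N (fun j => - (\sum_(l < r | (j <= l)%N) s ord0 l)^-1)).
by rewrite (@big_nat_widenl _ _ _ m 0).
Qed.

Lemma tail_coef_mirror_take r (s : 'rV[C]_r) k : (k <= r)%N -> tail_coef (mirror (take k (coords s))) =
  \prod_(i < r | (i < k)%N) (head_form i s)^-1.
Proof.
move=> kr; rewrite tail_coef_mirror size_takel ?size_coords//.
rewrite (big_ord_widen r (fun i => (csum (take i.+1 (take k (coords s))) - i.+1%:R)^-1) kr).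
by apply: eq_bigr => i ik; rewrite take_takel// csum_take_coords.
Qed.

Lemma xi_expand r (s : 'rV[C]_r) : xi s = \sum_(m < r.+1) \sum_(k < m.+1)
  (\prod_(i < r | (i < k)%N) (head_form i s)^-1) * xi_core (drop k (take m (coords s))) *
  \prod_(i < r | (m <= i)%N) - (tail_form i s)^-1.
Proof.
rewrite /xi xi_word_core convE size_coords; apply: eq_bigr => m _.
have mr : (m <= r)%N by rewrite -ltnS.
have sz : size (take m (coords s)) = m by rewrite size_takel ?size_coords.
rewrite convE tail_coef_drop sz.
rewrite mulr_suml; apply: eq_bigr => k _; have km : (k <= m)%N by rewrite -ltnS.
by rewrite take_takel// tail_coef_mirror_take// (leq_trans km mr).
Qed.

Lemma xi_row0 (s : 'rV[C]_0) : xi s = 1.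
Proof.
have s0 : coords s = [::] by apply/size0nil/size_coords.
by rewrite /xi s0 /xi_word conv_nil /= !/theta_tail !conv_nil /powint csum_nil cpow1z !mul1r.
Qed.

Lemma xi_functional r (s : 'rV[C]_r) :
  xi s = xi (\row_(i < r) (1 - s ord0 (rev_ord i))).
Proof.
rewrite /xi -xi_word_mirror; congr xi_word; apply: (@eq_from_nth _ 0).
  by rewrite size_rev size_map !size_coords.
rewrite size_rev size_map size_coords => i ir.
have Hsz : (i < size [seq (1 - z)%R | z <- coords s])%N by rewrite size_map size_coords.
rewrite /mirror (nth_rev _ Hsz) size_map size_coords.
rewrite (nth_map 0) ?size_coords ?rev_ord_proof//; last exact: (rev_ord_proof (Ordinal ir)).
have -> : (coords s)`_(r - i.+1) = s ord0 (rev_ord (Ordinal ir)) by rewrite -nth_coords.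
by have := nth_coords (\row_(i < r) (1 - s ord0 (rev_ord i))) (Ordinal ir); rewrite mxE => ->.
Qed.

End Xi.

(** * Taylor expansion of complex powers *)
Section PowerTaylor.
Variable R : realType.
Local Notation C := R[i].

Lemma expR_sub1_le (x : R) : `|expR x - 1| <= `|x| * expR `|x|.
Proof.
have x0 := normr_ge0 x; have e1 : 1 <= expR `|x| by rewrite -expR0 ler_expR.
case: (leP 0 x) => [x_ge0|x_lt0].
  have e2 : 1 - x <= expR (- x) by have := @expR_ge1Dx R (- x).
  have e3 : expR x * expR (- x) = 1 by rewrite -expRD subrr expR0.
  have e4 := expR_gt0 x; have e5 : 1 <= expR x by rewrite -expR0 ler_expR.
  rewrite ger0_norm ?subr_ge0// (ger0_norm x_ge0); nra.
have e2 := @expR_ge1Dx R x; have e5 : expR x <= 1 by rewrite -expR0 ler_expR ltW.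
rewrite ler0_norm ?subr_le0// (ltr0_norm x_lt0).
move: e1; rewrite (ltr0_norm x_lt0) => e1; nra.
Qed.

Lemma expR_sub1x_le (x : R) : `|expR x - 1 - x| <= x ^+ 2 * expR `|x|.
Proof.
have e2 : 1 - x <= expR (- x) by have := @expR_ge1Dx R (- x).
have e3 : expR x * expR (- x) = 1 by rewrite -expRD subrr expR0.
have e4 := expR_gt0 x; have e1 := @expR_ge1Dx R x.
rewrite ger0_norm; last by lra.
apply: (@le_trans _ _ (x * (expR x - 1))); first by nra.
apply: le_trans (ler_norm _) _; rewrite normrM -real_normK ?num_real// expr2 -mulrA ler_wpM2l//.
exact: expR_sub1_le.
Qed.

Lemma normr_sin_le (y : R) : `|sin y| <= `|y|.
Proof.
wlog y0 : y / 0 <= y => [H|].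
  by case: (leP 0 y) => [/H//|y0]; have := H (- y); rewrite sinN !normrN; apply; rewrite oppr_ge0 ltW.
rewrite (ger0_norm y0) ler_norml sin_le// andbT.
case: (leP y 1) => y1; last by apply: (@le_trans _ _ (-1)); [lra|exact: sin_geN1].
apply: (@le_trans _ _ 0); first by lra.
by apply: sin_ge0_pi; rewrite y0/=; have := @pi_ge2 R; lra.
Qed.

Lemma cos_sub1_le (y : R) : `|cos y - 1| <= y ^+ 2.
Proof.
have E : cos y = 1 - 2 * sin (y / 2) ^+ 2.
  rewrite {1}(splitr y) cosD -!expr2 cos2sin2; ring.
have := normr_sin_le (y / 2); rewrite normrM => s1.
have s2 : sin (y / 2) ^+ 2 <= (y / 2) ^+ 2.
  rewrite -[leLHS]real_normK ?num_real// -[leRHS]real_normK ?num_real//.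
  by rewrite ler_sqr ?nnegrE// normrM.
rewrite E ler0_norm; last by have := sqr_ge0 (sin (y / 2)); lra.
have : (y / 2) ^+ 2 = y ^+ 2 / 4 by field.
have := sqr_ge0 y; lra.
Qed.

Lemma sin_subx_le (y : R) : `|sin y - y| <= 2 * y ^+ 2.
Proof.
wlog y0 : y / 0 <= y => [H|].
  case: (leP 0 y) => [/H//|y0]; have := H (- y).
  by rewrite sinN -opprD normrN sqrrN; apply; rewrite oppr_ge0 ltW.
have s1 := sin_le y0; rewrite ler0_norm ?subr_le0// opprB.
case: (leP y 1) => y1; last by have := sin_geN1 y; nra.
have s2 : y * cos y <= sin y by apply: ycos_le_sin; rewrite y0/=; have := @pi_ge2 R; lra.
have := cos_sub1_le y; rewrite ler_norml => /andP[+ _]; nra.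
Qed.

(** Real and imaginary parts are estimated by the Taylor remainders of [exp], [cos] and
   [sin] at [w ln t]; a factor [(ln t) ^ 2] is absorbed in the exponential. *)
Lemma cpow_taylor (t : R) (w : C) : normc w <= 1 ->
  normc (cpow t w - 1 - w * (ln t)%:C) <= 6 * normc w ^+ 2 * expR (3 * `|ln t|).
Proof.
move=> w1; set l := ln t; set L := `|l|; set d := normc w.
have d0 : 0 <= d by exact: normc_ge0.
have L0 : 0 <= L by exact: normr_ge0.
pose x := complex.Re w * l; pose y := complex.Im w * l.
have xb : `|x| <= d * L by rewrite normrM ler_wpM2r// Re_le_normc.
have yb : `|y| <= d * L by rewrite normrM ler_wpM2r// Im_le_normc.
have dL : d * L <= L by rewrite -[leRHS]mul1r ler_wpM2r.
have eL : L <= expR L by have := @expR_ge1Dx R L; lra.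
have e1 : 1 <= expR L by rewrite -expR0 ler_expR.
have ex : expR `|x| <= expR L by rewrite ler_expR (le_trans xb).
have ex' : expR x <= expR L by rewrite ler_expR (le_trans (ler_norm _))// (le_trans xb).
have x2 : x ^+ 2 <= d ^+ 2 * L ^+ 2.
  by rewrite -real_normK ?num_real// -exprMn ler_sqr ?nnegrE// mulr_ge0.
have y2 : y ^+ 2 <= d ^+ 2 * L ^+ 2.
  by rewrite -real_normK ?num_real// -exprMn ler_sqr ?nnegrE// mulr_ge0.
have ReB : `|complex.Re (cpow t w - 1 - w * l%:C)| <= 2 * (d ^+ 2 * L ^+ 2 * expR L).
  have -> : complex.Re (cpow t w - 1 - w * l%:C) = (expR x - 1 - x) + expR x * (cos y - 1).
    rewrite !cReD !cReN cpowE !cReM /= -/x -/y; ring.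
  apply: le_trans (ler_normD _ _) _; rewrite mulr_natl mulr2n; apply: lerD.
    apply: le_trans (expR_sub1x_le x) _; apply: ler_pM => //; rewrite ?sqr_ge0 ?expR_ge0//.
  rewrite normrM ger0_norm ?expR_ge0// mulrC; apply: ler_pM => //; rewrite ?expR_ge0//.
  exact: le_trans (cos_sub1_le y) _.
have ImB : `|complex.Im (cpow t w - 1 - w * l%:C)| <= 3 * (d ^+ 2 * L ^+ 2 * expR L).
  have -> : complex.Im (cpow t w - 1 - w * l%:C) = (expR x - 1) * sin y + (sin y - y).
    rewrite !cImD !cImN cpowE !cImM /= -/x -/y; ring.
  apply: le_trans (ler_normD _ _) _.
  have b1 : `|(expR x - 1) * sin y| <= d ^+ 2 * L ^+ 2 * expR L.
    have -> : d ^+ 2 * L ^+ 2 * expR L = (d * L * expR L) * (d * L) by ring.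
    rewrite normrM.
    apply: ler_pM => //; last exact: le_trans (normr_sin_le y) _.
    apply: le_trans (expR_sub1_le x) _; apply: ler_pM => //; rewrite ?expR_ge0//.
  have b2 : `|sin y - y| <= 2 * (d ^+ 2 * L ^+ 2 * expR L).
    apply: le_trans (sin_subx_le y) _; rewrite ler_wpM2l//.
    apply: le_trans y2 _; rewrite -[leLHS]mulr1 ler_wpM2l// mulr_ge0 ?sqr_ge0//.
  lra.
have e3 : expR (3 * L) = expR L ^+ 3 by rewrite mulrC -expRM_natr.
rewrite e3; apply: le_trans (normc_le_ReIm _) _; apply: le_trans (lerD ReB ImB) _.
have L2 : L ^+ 2 <= expR L ^+ 2 by rewrite ler_sqr ?nnegrE// expR_ge0.
have : d ^+ 2 * L ^+ 2 * expR L <= d ^+ 2 * expR L ^+ 3.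
  rewrite -mulrA [expR L ^+ 3]exprSr ler_wpM2l ?sqr_ge0// ler_wpM2r ?expR_ge0//.
have : 0 <= d ^+ 2 * expR L ^+ 3 by rewrite mulr_ge0 ?sqr_ge0// exprn_ge0// expR_ge0.
lra.
Qed.

End PowerTaylor.

(** * Second order expansions of families of functions *)
Section Jets.
Variable R : realType.
Local Notation C := R[i].
Variables (n : nat) (s0 : 'rV[C]_n) (a : R).
Hypothesis a0 : 0 < a.
Implicit Types (h : 'rV[C]_n).
Local Notation family := ('rV[C]_n -> R -> C).
Local Notation diff := ('I_n -> R -> C).

Definition sumnorm (h : 'rV[C]_n) : R := \sum_(i < n) normc (h ord0 i).

Lemma sumnorm_ge0 h : 0 <= sumnorm h.
Proof. by apply: sumr_ge0 => i _; exact: normc_ge0. Qed.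

Lemma sumnorm_coord (h : 'rV[C]_n) (i : 'I_n) : normc (h ord0 i) <= sumnorm h.
Proof. by rewrite /sumnorm (bigD1 i)//= lerDl; apply: sumr_ge0 => j _; exact: normc_ge0. Qed.

Definition lin (f1 : 'I_n -> C) (h : 'rV[C]_n) : C := \sum_(i < n) h ord0 i * f1 i.

Lemma lin_le (f1 : 'I_n -> C) h (F : R) : (forall i, normc (f1 i) <= F) -> normc (lin f1 h) <= F * sumnorm h.
Proof.
move=> fF; apply: le_trans (normc_sum _ _ _) _; rewrite mulrC /sumnorm mulr_suml.
by apply: ler_sum => i _; rewrite normcM ler_wpM2l ?normc_ge0.
Qed.

(** The remainder of order two of [f] at [s0], for a candidate differential. *)
Definition remainder (f : family) (f1 : diff) h t : C :=
  f (s0 + h) t - f s0 t - lin (f1 ^~ t) h.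

(** Families with a differential in the exponents at [s0] whose remainder is of order
   two, uniformly in [t] up to an exponential factor: at most of some growth for
   [moderate_jet], smaller than every [exp (- m t)] for [decaying_jet]. *)
Definition moderate_jet (f : family) : Prop := (forall s, moderate a (f s)) /\
  exists f1 : diff, (forall i, moderate a (f1 i)) /\
  exists (m : nat) (M : R), forall h t, sumnorm h <= 1 -> a < t ->
    normc (remainder f f1 h t) <= M * sumnorm h ^+ 2 * expR (m%:R * t).

Definition decaying_jet (f : family) : Prop := (forall s, decaying a (f s)) /\
  exists f1 : diff, (forall i, decaying a (f1 i)) /\
  forall m : nat, exists M : R, forall h t, sumnorm h <= 1 -> a < t ->
    normc (remainder f f1 h t) <= M * sumnorm h ^+ 2 * expR (- (m%:R * t)).

Lemma moderate_uniform (I : finType) (F : I -> R -> C) : (forall i, moderate a (F i)) ->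
  exists (m : nat) (M : R), forall i t, a < t -> normc (F i t) <= M * expR (m%:R * t).
Proof.
move=> H; have /choice[mM HmM] : forall i, exists mM : nat * R, forall t, a < t -> normc (F i t) <= mM.2 * expR (mM.1%:R * t).
  by move=> i; have [_ [m [M HM]]] := H i; exists (m, M).
exists (\sum_i (mM i).1)%N, (\sum_i `|(mM i).2|) => i t at_.
have t0 : 0 <= t by rewrite ltW// (lt_trans a0).
apply: le_trans (HmM i t at_) _; apply: le_trans (ler_wpM2r (expR_ge0 _) (ler_norm _)) _.
apply: ler_pM; rewrite ?expR_ge0//.
  by rewrite (bigD1 i)//= lerDl; apply: sumr_ge0.
by rewrite ler_expR ler_wpM2r// ler_nat (bigD1 i)//= leq_addr.
Qed.

Lemma decaying_uniform (I : finType) (F : I -> R -> C) (m : nat) : (forall i, decaying a (F i)) ->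
  exists M : R, forall i t, a < t -> normc (F i t) <= M * expR (- (m%:R * t)).
Proof.
move=> H; have /choice[M HM] : forall i, exists M : R, forall t, a < t -> normc (F i t) <= M * expR (- (m%:R * t)).
  by move=> i; have [_ /(_ m)] := H i.
exists (\sum_i `|M i|) => i t at_.
apply: le_trans (HM i t at_) _; apply: ler_wpM2r; first exact: expR_ge0.
apply: le_trans (ler_norm _) _.
by rewrite (bigD1 i)//= lerDl; apply: sumr_ge0.
Qed.

(** The product rule: besides the product of the two differentials, each term of the
   remainder has a factor which is a remainder of [f] or [g]. *)
Lemma remainderM_le (f g : family) (f1 g1 : diff) h t (F G : R) : sumnorm h <= 1 ->
  normc (f s0 t) <= F -> (forall i, normc (f1 i t) <= F) ->
  normc (remainder f f1 h t) <= F * sumnorm h ^+ 2 ->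
  normc (g s0 t) <= G -> (forall i, normc (g1 i t) <= G) ->
  normc (remainder g g1 h t) <= G * sumnorm h ^+ 2 ->
  normc (remainder (fun s t => f s t * g s t) (fun i t => f s0 t * g1 i t + f1 i t * g s0 t) h t)
    <= 6 * (F * G) * sumnorm h ^+ 2.
Proof.
move=> h1 f0F f1F rF g0G g1G rG; set d := sumnorm h in h1 rF rG *.
have d0 : 0 <= d by exact: sumnorm_ge0.
have F0 : 0 <= F by exact: le_trans (normc_ge0 _) f0F.
have G0 : 0 <= G by exact: le_trans (normc_ge0 _) g0G.
have LF := lin_le h f1F; have LG := lin_le h g1G; rewrite -/d in LF LG.
have E : remainder (fun s t => f s t * g s t) (fun i t => f s0 t * g1 i t + f1 i t * g s0 t) h t =
   lin (f1 ^~ t) h * lin (g1 ^~ t) h +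
   (remainder f f1 h t * (g s0 t + lin (g1 ^~ t) h + remainder g g1 h t) +
    (f s0 t + lin (f1 ^~ t) h) * remainder g g1 h t).
  have -> : remainder (fun s t => f s t * g s t) (fun i t => f s0 t * g1 i t + f1 i t * g s0 t) h t =
    f (s0 + h) t * g (s0 + h) t - f s0 t * g s0 t - (f s0 t * lin (g1 ^~ t) h + lin (f1 ^~ t) h * g s0 t).
    rewrite /remainder; congr (_ - _); rewrite /lin mulr_sumr mulr_suml -big_split /=.
    by apply: eq_bigr => i _; rewrite mulrDr !mulrA [_ * f s0 t]mulrC.
  rewrite /remainder; ring.
rewrite E; apply: le_trans (normcD _ _) _.
have b1 : normc (lin (f1 ^~ t) h * lin (g1 ^~ t) h) <= F * G * d ^+ 2.
  rewrite normcM (_ : _ * _ * _ ^+ 2 = F * d * (G * d)); last by ring.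
  by apply: ler_pM; rewrite ?normc_ge0.
have d2 : d ^+ 2 <= 1 by rewrite expr_le1.
have b2 : normc (remainder f f1 h t * (g s0 t + lin (g1 ^~ t) h + remainder g g1 h t)) <= F * d ^+ 2 * (3 * G).
  rewrite normcM; apply: ler_pM; rewrite ?normc_ge0//.
  apply: le_trans (normcD _ _) _; have := normcD (g s0 t) (lin (g1 ^~ t) h).
  have := ler_wpM2l G0 h1; have := ler_wpM2l G0 d2; lra.
have b3 : normc ((f s0 t + lin (f1 ^~ t) h) * remainder g g1 h t) <= (2 * F) * (G * d ^+ 2).
  rewrite normcM; apply: ler_pM; rewrite ?normc_ge0//.
  apply: le_trans (normcD _ _) _; have := ler_wpM2l F0 h1; lra.
have := normcD (remainder f f1 h t * (g s0 t + lin (g1 ^~ t) h + remainder g g1 h t))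
  ((f s0 t + lin (f1 ^~ t) h) * remainder g g1 h t).
lra.
Qed.

Lemma le_norm_nat_expR (M x : R) (m k : nat) t : 0 <= t -> (m <= k)%N -> 0 <= x ->
  M * x * expR (m%:R * t) <= `|M| * expR (k%:R * t) * x.
Proof.
move=> t0 mk x0; rewrite mulrAC ler_wpM2r//; apply: le_trans (ler_wpM2r (expR_ge0 _) (ler_norm _)) _.
by rewrite ler_wpM2l// ler_expR ler_wpM2r// ler_nat.
Qed.

Let option_ext (F0 : R -> C) (F1 : 'I_n -> R -> C) (o : option 'I_n) : R -> C :=
  if o is Some i then F1 i else F0.

Lemma moderate_jet_bound (f : family) : moderate_jet f -> exists f1 : diff, (forall i, moderate a (f1 i)) /\
  exists (m : nat) (M : R), forall h t, sumnorm h <= 1 -> a < t ->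
    [/\ normc (f s0 t) <= M * expR (m%:R * t), forall i, normc (f1 i t) <= M * expR (m%:R * t) &
        normc (remainder f f1 h t) <= M * expR (m%:R * t) * sumnorm h ^+ 2].
Proof.
move=> [mf [f1 [mf1 [m [M HM]]]]]; exists f1; split => //.
have [k [N HN]] : exists (m : nat) (M : R), forall o t, a < t ->
    normc (option_ext (f s0) f1 o t) <= M * expR (m%:R * t).
  by apply: moderate_uniform => -[i|]; [exact: mf1|exact: mf].
exists (m + k)%N, (`|M| + `|N|) => h t h1 at_.
have t0 : 0 <= t by rewrite ltW// (lt_trans a0).
have e1 := ler_wpM2r (expR_ge0 ((m + k)%:R * t)) (normr_ge0 M).
have e2 := ler_wpM2r (expR_ge0 ((m + k)%:R * t)) (normr_ge0 N).
have b o : normc (option_ext (f s0) f1 o t) <= (`|M| + `|N|) * expR ((m + k)%:R * t).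
  apply: le_trans (HN o t at_) _; have := @le_norm_nat_expR N 1 k (m + k) t t0 (leq_addl _ _) ler01.
  rewrite !mulr1; move=> H; apply: le_trans H _; rewrite mulrDl; lra.
split; [exact: (b None)|by move=> i; exact: (b (Some i))|].
apply: le_trans (HM h t h1 at_) _.
apply: le_trans (@le_norm_nat_expR M _ m (m + k) t t0 (leq_addr _ _) (sqr_ge0 _)) _.
by rewrite ler_wpM2r ?sqr_ge0// ler_wpM2r ?expR_ge0// lerDl.
Qed.

Lemma decaying_jet_bound (f : family) : decaying_jet f -> exists f1 : diff, (forall i, decaying a (f1 i)) /\
  forall m : nat, exists M : R, forall h t, sumnorm h <= 1 -> a < t ->
    [/\ normc (f s0 t) <= M * expR (- (m%:R * t)), forall i, normc (f1 i t) <= M * expR (- (m%:R * t)) &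
        normc (remainder f f1 h t) <= M * expR (- (m%:R * t)) * sumnorm h ^+ 2].
Proof.
move=> [df [f1 [df1 H]]]; exists f1; split => // m; have [M HM] := H m.
have [N HN] : exists (M : R), forall o t, a < t ->
    normc (option_ext (f s0) f1 o t) <= M * expR (- (m%:R * t)).
  by apply: decaying_uniform => -[i|]; [exact: df1|exact: df].
exists (`|M| + `|N|) => h t h1 at_.
have e0 := expR_ge0 (- (m%:R * t)).
have b o : normc (option_ext (f s0) f1 o t) <= (`|M| + `|N|) * expR (- (m%:R * t)).
  apply: le_trans (HN o t at_) _; rewrite ler_wpM2r//.
  by apply: le_trans (ler_norm _) _; rewrite lerDr.
split; [exact: (b None)|by move=> i; exact: (b (Some i))|].
apply: le_trans (HM h t h1 at_) _; rewrite mulrAC ler_wpM2r ?sqr_ge0// ler_wpM2r//.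
by apply: le_trans (ler_norm _) _; rewrite lerDl.
Qed.

Lemma moderate_jetM (f g : family) : moderate_jet f -> moderate_jet g ->
  moderate_jet (fun s t => f s t * g s t).
Proof.
move=> jf jg; have [[mf _] [mg _]] := (jf, jg); split=> [s|]; first exact: moderateM.
have [f1 [mf1 [m [M HM]]]] := moderate_jet_bound jf.
have [g1 [mg1 [k [N HN]]]] := moderate_jet_bound jg.
exists (fun i t => f s0 t * g1 i t + f1 i t * g s0 t); split=> [i|].
  by apply: moderateD; [exact: ltW|exact: moderateM..].
exists (m + k)%N, (6 * (M * N)) => h t h1 at_.
have [x1 x2 x3] := HM h t h1 at_; have [y1 y2 y3] := HN h t h1 at_.
apply: le_trans (remainderM_le h1 x1 x2 x3 y1 y2 y3) _.
by rewrite [(m + k)%:R]natrD [(m%:R + _) * t]mulrDl expRD le_eqVlt; apply/orP; left; apply/eqP; ring.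
Qed.

Lemma decaying_jetMl (f g : family) : moderate_jet f -> decaying_jet g ->
  decaying_jet (fun s t => f s t * g s t).
Proof.
move=> jf jg; have [[mf _] [dg _]] := (jf, jg); split=> [s|]; first exact: decayingMl.
have [f1 [mf1 [m [M HM]]]] := moderate_jet_bound jf.
have [g1 [dg1 HG]] := decaying_jet_bound jg.
exists (fun i t => f s0 t * g1 i t + f1 i t * g s0 t); split=> [i|k].
  by apply: decayingD; apply: decayingMl.
have [N HN] := HG (m + k)%N; exists (6 * (M * N)) => h t h1 at_.
have [x1 x2 x3] := HM h t h1 at_; have [y1 y2 y3] := HN h t h1 at_.
apply: le_trans (remainderM_le h1 x1 x2 x3 y1 y2 y3) _.
rewrite le_eqVlt; apply/orP; left; apply/eqP.
have -> : expR (- ((m + k)%:R * t)) = expR (- (m%:R * t)) * expR (- (k%:R * t)).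
  by rewrite natrD mulrDl opprD expRD.
have : expR (m%:R * t) * expR (- (m%:R * t)) = 1 by rewrite -expRD subrr expR0.
move: (expR (m%:R * t)) (expR (- (m%:R * t))) (expR (- (k%:R * t))) => p q r pq.
rewrite (_ : 6 * (M * p * (N * (q * r))) * _ = 6 * (M * N) * sumnorm h ^+ 2 * r * (p * q)); last by ring.
by rewrite pq mulr1.
Qed.

Lemma moderate_jet_cst (c : R -> C) : moderate a c -> moderate_jet (fun=> c).
Proof.
move=> mc; split=> //; exists (fun _ _ => 0); split=> [i|]; first exact: moderate_cst.
exists 0%N, 0 => h t _ _; rewrite /remainder subrr sub0r normcN /lin big1 ?normc0 ?mul0r// => i _.
by rewrite mulr0.
Qed.

Lemma decaying_jet_cst (c : R -> C) : decaying a c -> decaying_jet (fun=> c).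
Proof.
move=> mc; split=> //; exists (fun _ _ => 0); split=> [i|m]; first exact: decaying0.
exists 0 => h t _ _; rewrite /remainder subrr sub0r normcN /lin big1 ?normc0 ?mul0r// => i _.
by rewrite mulr0.
Qed.

Lemma decaying_jetD (f g : family) : decaying_jet f -> decaying_jet g ->
  decaying_jet (fun s t => f s t + g s t).
Proof.
move=> [df [f1 [df1 HF]]] [dg [g1 [dg1 HG]]]; split=> [s|]; first exact: decayingD.
exists (fun i t => f1 i t + g1 i t); split=> [i|m]; first exact: decayingD.
have [M HM] := HF m; have [N HN] := HG m; exists (M + N) => h t h1 at_.
have -> : remainder (fun s t => f s t + g s t) (fun i t => f1 i t + g1 i t) h t =
    remainder f f1 h t + remainder g g1 h t.
  rewrite /remainder (_ : lin _ h = lin (f1 ^~ t) h + lin (g1 ^~ t) h); first by ring.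
  by rewrite /lin -big_split; apply: eq_bigr => i _; rewrite mulrDr.
apply: le_trans (normcD _ _) _; rewrite !mulrDl; apply: lerD; [exact: HM|exact: HN].
Qed.

Lemma decaying_jet_sum (I : eqType) (r : seq I) (F : I -> 'rV[C]_n -> R -> C) :
  (forall i, i \in r -> decaying_jet (F i)) -> decaying_jet (fun s t => \sum_(i <- r) F i s t).
Proof.
elim: r => [|i r IH] H.
  rewrite (_ : (fun s t => _) = fun=> fun=> 0); first exact: decaying_jet_cst (decaying0 a).
  by apply/funext => s; apply/funext => t; rewrite big_nil.
rewrite (_ : (fun s t => _) = fun s t => F i s t + \sum_(i <- r) F i s t).
  apply: decaying_jetD; first by apply: H; rewrite mem_head.
  by apply: IH => j jr; apply: H; rewrite in_cons jr orbT.
by apply/funext => s; apply/funext => t; rewrite big_cons.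
Qed.

(** By linearity the remainder of the integral is the integral of the remainder, and
   the bounds of [decaying_jet] may be integrated. *)
Lemma decaying_jet_tint (f : family) : decaying_jet f -> decaying_jet (fun s x => tint x (f s)).
Proof.
move=> [df [f1 [df1 H]]]; have a_ge0 := ltW a0.
split=> [s|]; first exact: decaying_tint.
exists (fun i x => tint x (f1 i)); split=> [i|m]; first exact: decaying_tint.
have [M HM] := H m.+1; exists (2 * M) => h x h1 ax.
have dr : decaying a (remainder f f1 h).
  rewrite /remainder /lin.
  rewrite (_ : (fun t => _) = fun t => (f (s0 + h) t + -1 * f s0 t) + -1 * \sum_(i < n) h ord0 i * f1 i t).
    apply: decayingD; first by apply: decayingD => //; exact: decayingZ.
    by apply: decayingZ; apply: decaying_sum => // i _; exact: decayingZ.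
  by apply/funext => t; rewrite !mulN1r.
have -> : remainder (fun s x => tint x (f s)) (fun i x => tint x (f1 i)) h x = tint x (remainder f f1 h).
  have -> : remainder f f1 h = fun t => (f (s0 + h) t + -1 * f s0 t) + -1 * \sum_(i < n) h ord0 i * f1 i t.
    by apply/funext => t; rewrite !mulN1r.
  have dl : decaying a (fun t => \sum_(i < n) h ord0 i * f1 i t).
    by apply: decaying_sum => // i _; exact: decayingZ.
  rewrite (tintD a_ge0 ax (decayingD (df _) (decayingZ _ (df _))) (decayingZ _ dl)).
  rewrite (tintD a_ge0 ax (df _) (decayingZ _ (df _))).
  rewrite (tintZ a_ge0 _ ax (df _)) (tintZ a_ge0 _ ax dl) !mulN1r /remainder; congr (_ - _).
  rewrite (tint_sum a_ge0 (F := fun i t => h ord0 i * f1 i t) ax)//.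
    by apply: eq_bigr => i _; rewrite (tintZ a_ge0 _ ax (df1 i)).
  by move=> i _; exact: decayingZ.
rewrite -(mulrA 2 M).
apply: (tint_bound a_ge0 _ _ ax); first exact: dr.1.
by move=> t at_; exact: HM.
Qed.

End Jets.

(** * From second order expansions to differentiability *)
Section JetDifferentiable.
Variable R : realType.
Local Notation C := R[i].
Variable n : nat.
Implicit Types h : 'rV[C]_n.

Lemma normr_row_ge (h : 'rV[C]_n) (i : 'I_n) : `|h ord0 i| <= `|h|.
Proof.
rewrite -[leRHS]/(mx_norm h) mx_normE -[leLHS]nngE num_le.
exact: (le_bigmax _ (fun ij : 'I_1 * 'I_n => `|h ij.1 ij.2|%:nng) (ord0, i)).
Qed.

Lemma normrc (z : C) : `|z| = (normc z)%:C.
Proof. by case: z. Qed.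

Lemma norm_row_real (h : 'rV[C]_n) : `|h| = (complex.Re `|h|)%:C.
Proof. by have := normr_ge0 h; case: `|h| => x y; rewrite lecE /= => /andP[/eqP -> _]. Qed.

Lemma sumnorm_le h : sumnorm h <= n%:R * complex.Re `|h|.
Proof.
apply: (@le_trans _ _ (\sum_(i < n) complex.Re `|h|)); last first.
  by rewrite sumr_const card_ord mulr_natl.
apply: ler_sum => i _; have := normr_row_ge h i.
by rewrite norm_row_real normrc lecR.
Qed.

Lemma lin_linear (L : 'I_n -> C) : linear (lin L).
Proof.
move=> c h k; rewrite /lin scaler_sumr -big_split; apply: eq_bigr => i _.
by rewrite !mxE mulrDl /GRing.scale /= mulrA.
Qed.

HB.instance Definition _ (L : 'I_n -> C) :=
  GRing.isLinear.Build C 'rV[C]_n C *:%R (lin L) (lin_linear L).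

Lemma lin_continuous (L : 'I_n -> C) : continuous (lin L : 'rV[C]_n -> C).
Proof.
move=> h; have FF : Filter (nbhs h) by exact: nbhs_filter.
apply: (cvg_bigsum (FF := FF)) => i; apply: (cvgcM (FF := FF)); last exact: (cvgc_cst (FF := FF)).
exact: coord_continuous.
Qed.

(** The norm of ['rV[C]_n] has values in [C], but they are real, and [n] times the norm
   bounds [sumnorm]; a remainder quadratic in [sumnorm] is therefore negligible. *)
Lemma differentiable_jet (f : 'rV[C]_n -> C) s0 (L : 'I_n -> C) (M : R) :
  (forall h, sumnorm h <= 1 -> normc (f (s0 + h) - f s0 - lin L h) <= M * sumnorm h ^+ 2) ->
  differentiable f s0.
Proof.
move=> H.
pose df : {linear 'rV[C]_n -> C} := lin L.
have E : f \o shift s0 = cst (f s0) + df +o_ (0 : 'rV[C]_n) id.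
  apply/eqaddoP => e e0.
  have e_real : e = (complex.Re e)%:C by move: e0; case: (e) => x y; rewrite ltcE /= => /andP[/eqP -> _].
  have re0 : 0 < complex.Re e by move: e0; rewrite {1}e_real ltcR.
  (* The first bound ensures [sumnorm h <= 1], the second one the size of the remainder. *)
  pose d := Num.min (n%:R + 1)^-1 (complex.Re e / ((`|M| + 1) * (n%:R + 1) ^+ 2)).
  have n1 : 0 < n%:R + 1 :> R by rewrite ltr_pwDr.
  have M1 : 0 < (`|M| + 1) * (n%:R + 1) ^+ 2 :> R by rewrite mulr_gt0 ?exprn_gt0// ltr_pwDr.
  have d0 : 0 < d by rewrite lt_min invr_gt0 n1 divr_gt0.
  have near_d : \forall h \near (0 : 'rV[C]_n), `|h| < d%:C.
    by apply: (@nbhs0_lt C 'rV[C]_n d%:C); rewrite ltcR.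
  apply: filterS near_d => h; rewrite norm_row_real ltcR => hd.
  have rho0 : 0 <= complex.Re `|h| by have := normr_ge0 h; rewrite {1}norm_row_real lecR.
  have hs := sumnorm_le h; have s0_ := sumnorm_ge0 h.
  set rho := complex.Re `|h| in hd rho0 hs *.
  move: hd; rewrite lt_min => /andP[hd1 hd2].
  have nrho : n%:R * rho <= (n%:R + 1) * rho by rewrite ler_wpM2r// lerDl.
  have h1 : sumnorm h <= 1.
    apply: le_trans hs _; apply: le_trans nrho _; rewrite mulrC -ler_pdivlMr// mul1r; exact: ltW.
  have := H h h1.
  rewrite normrc {1}e_real -rmorphM lecR => Hh.
  rewrite (_ : _ h = f (s0 + h) - f s0 - lin L h); last first.
    rewrite -[LHS]/(f (h + s0) - (f s0 + lin L h)) [h + s0]addrC; ring.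
  apply: le_trans Hh _.
  have q : (`|M| + 1) * (n%:R + 1) ^+ 2 * rho <= complex.Re e.
    by move: hd2; rewrite ltr_pdivlMr// mulrC => /ltW.
  apply: (@le_trans _ _ ((`|M| + 1) * ((n%:R + 1) * rho) ^+ 2)).
    apply: (@le_trans _ _ ((`|M| + 1) * sumnorm h ^+ 2)).
      by rewrite ler_wpM2r ?sqr_ge0// (le_trans (ler_norm _))// lerDl.
    rewrite ler_wpM2l ?addr_ge0//; apply: lerXn2r; rewrite ?nnegrE//.
      by rewrite mulr_ge0// ltW.
    exact: le_trans nrho.
  rewrite exprMn [rho ^+ 2]expr2 !mulrA; apply: ler_wpM2r => //.
  by move: q; rewrite expr2 mulrA.
have D : 'd f s0 = df :> ('rV[C]_n -> C) by apply: diff_unique => //; exact: lin_continuous.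
apply/diff_locallyP; rewrite D; split; [exact: lin_continuous|exact: E].
Qed.

End JetDifferentiable.

(** * Entire dependence on the exponents *)
Section EntireCore.
Variable R : realType.
Local Notation C := R[i].
Variable n : nat.
Local Notation V := 'rV[C]_n.
Implicit Types (s h : V).

(** The words met in [xi_core] have entries [s_i] or [1 - s_i]; the boolean tells which
   one, so that the shuffles of such words do not depend on [s]. *)
Definition symbol : Type := ('I_n * bool)%type.

Definition value s (j : symbol) : C := if j.2 then 1 - s ord0 j.1 else s ord0 j.1.

Definition value_sign (j : symbol) : C := if j.2 then -1 else 1.

Lemma valueD s h j : value (s + h) j = value s j + value_sign j * h ord0 j.1.
Proof. by case: j => i []; rewrite /value /value_sign /= !mxE ?mul1r ?mulN1r ?opprD ?addrA. Qed.

Lemma normc_value_sign j (z : C) : normc (value_sign j * z) = normc z.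
Proof. by rewrite /value_sign; case: j.2; rewrite ?mulN1r ?normcN ?mul1r. Qed.

Section AtPoint.
Variables (s0 : V) (a : R).
Hypothesis a0 : 0 < a.

Lemma moderate_ln : moderate a (fun t => (ln t)%:C : C).
Proof.
split=> [x ax|].
  split; first exact: continuous_ln (lt_trans a0 ax).
  by move=> ?; exact: cvg_cst.
exists 1%N, (expR `|ln a|) => t at_; rewrite normc_real -expRD mul1r.
apply: le_trans (abs_ln_le a0 at_) _; have := @expR_ge1Dx R (`|ln a| + t); lra.
Qed.

(** The remainder is [cpow_taylor] multiplied by a fixed power of [t]; on [t > a] the
   factor [exp (3 |ln t|)] grows at most exponentially. *)
Lemma moderate_jet_cpow j : moderate_jet s0 a (fun s t => cpow t (value s j - 1)).
Proof.
split=> [s|]; first exact: moderate_cpow.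
pose D (i : 'I_n) t := (if i == j.1 then value_sign j else 0) * ((ln t)%:C * cpow t (value s0 j - 1)).
exists D; split=> [i|].
  apply: moderateM; first exact: moderate_cst.
  by apply: moderateM; [exact: moderate_ln|exact: moderate_cpow].
have [_ [m [M HM]]] := moderate_cpow (value s0 j - 1) a0.
exists (m + 3)%N, (6 * (M * expR (3 * `|ln a|))) => h t h1 at_.
set w := value_sign j * h ord0 j.1.
have wh : normc w <= sumnorm h by rewrite normc_value_sign; exact: sumnorm_coord.
have E : remainder s0 (fun s t => cpow t (value s j - 1)) D h t =
    cpow t (value s0 j - 1) * (cpow t w - 1 - w * (ln t)%:C).
  have -> : remainder s0 (fun s t => cpow t (value s j - 1)) D h t = cpow t (value (s0 + h) j - 1) -
     cpow t (value s0 j - 1) - w * ((ln t)%:C * cpow t (value s0 j - 1)).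
    congr (_ - _); rewrite /lin (bigD1 j.1)//= big1 ?addr0 => [|i /negbTE ij].
      by rewrite /D eqxx mulrCA mulrA.
    by rewrite /D ij mul0r mulr0.
  rewrite valueD -/w (_ : _ + w - 1 = (value s0 j - 1) + w); last by ring.
  rewrite cpowD; ring.
rewrite E normcM; have T := cpow_taylor t (le_trans wh h1).
have l3 : expR (3 * `|ln t|) <= expR (3 * `|ln a|) * expR (3%:R * t).
  by rewrite -expRD -mulrDr ler_expR ler_wpM2l// addrC; exact: abs_ln_le.
have w2 : normc w ^+ 2 <= sumnorm h ^+ 2.
  by apply: lerXn2r => //; rewrite nnegrE ?normc_ge0 ?sumnorm_ge0.
apply: (@le_trans _ _ (M * expR (m%:R * t) * (6 * sumnorm h ^+ 2 * (expR (3 * `|ln a|) * expR (3%:R * t))))).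
  apply: ler_pM; rewrite ?normc_ge0//; first exact: HM.
  apply: le_trans T _; apply: ler_pM => //; rewrite ?expR_ge0 ?mulr_ge0 ?sqr_ge0//.
  - exact: normc_ge0.
  - exact: normc_ge0.
  by rewrite ler_wpM2l.
have -> : expR ((m + 3)%:R * t) = expR (m%:R * t) * expR (3%:R * t).
  by rewrite [(m + 3)%:R]natrD [(m%:R + _) * t]mulrDl expRD.
move: (expR _) (expR _) (expR _) => p q r.
by rewrite le_eqVlt; apply/orP; left; apply/eqP; ring.
Qed.

Definition letter_value s (l : symbol + symbol) : letter R :=
  match l with inl j => inl (value s j) | inr j => inr (value s j) end.

Lemma moderate_jet_dens l : moderate_jet s0 a (fun s => dens (letter_value s l)).
Proof.
case: l => j /=.
  apply: (moderate_jetM a0 (f := fun _ t => (theta t)%:C)); last exact: moderate_jet_cpow.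
  by apply: moderate_jet_cst; exact: moderate_theta.
apply: (moderate_jetM a0 (f := fun _ t => (theta_infty t)%:C)); last exact: moderate_jet_cpow.
apply: moderate_jet_cst; exact: (moderate_cst a 1).
Qed.

Lemma decaying_jet_zero_form j : decaying_jet s0 a (fun s => mellin_form theta_zero (value s j)).
Proof.
rewrite (_ : (fun s => _) = fun s t => cpow t (value s j - 1) * (theta_zero t)%:C).
  apply: (decaying_jetMl a0); first exact: moderate_jet_cpow.
  by apply: decaying_jet_cst; exact: decaying_theta_zero.
by apply/funext => s; apply/funext => t; rewrite mulrC.
Qed.

Lemma decaying_jet_titer (w : seq (symbol + symbol)) j :
  decaying_jet s0 a (fun s x => titer x (rcons (map (@dens R) (map (letter_value s) w))
     (mellin_form theta_zero (value s j)))).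
Proof.
elim: w => [|l w IH] /=.
  apply: (decaying_jet_tint a0 (f := fun s t => mellin_form theta_zero (value s j) t * 1)).
  rewrite (_ : (fun s t => _) = fun s => mellin_form theta_zero (value s j)); first exact: decaying_jet_zero_form.
  by apply/funext => s; apply/funext => t; rewrite mulr1.
apply: (decaying_jet_tint a0 (f := fun s t => dens (letter_value s l) t *
   titer t (rcons (map (@dens R) (map (letter_value s) w)) (mellin_form theta_zero (value s j))))).
by apply: (decaying_jetMl a0); [exact: moderate_jet_dens|exact: IH].
Qed.

(** The shuffles of the symbols do not depend on [s], hence [regint] is a fixed
   combination of iterated integrals of letters that depend on [s]. *)
Lemma decaying_jet_regint (v : seq symbol) : v != [::] ->
  decaying_jet s0 a (fun s x => regint x (map (value s) v)).
Proof.
move=> v0; have [j0 _] : exists j0, j0 \in v by case: v v0 => // j v _; exists j; rewrite mem_head.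
rewrite (_ : (fun s x => _) = fun s x => \sum_(i < size v) (-1) ^+ (size v - i.+1) *
   \sum_(w <- shuffle (map inl (take i v)) (map inr (rev (drop i.+1 v))))
     titer x (rcons (map (@dens R) (map (letter_value s) w)) (mellin_form theta_zero (value s (nth j0 v i))))).
  apply: (decaying_jet_sum (F := fun (i : 'I_(size v)) s x => (-1) ^+ (size v - i.+1) *
   \sum_(w <- shuffle (map inl (take i v)) (map inr (rev (drop i.+1 v))))
     titer x (rcons (map (@dens R) (map (letter_value s) w)) (mellin_form theta_zero (value s (nth j0 v i)))))).
  move=> i _; apply: (decaying_jetMl a0 (f := fun _ _ => (-1) ^+ (size v - i.+1))).
    by apply: moderate_jet_cst; exact: moderate_cst.
  apply: (decaying_jet_sum (F := fun w s x => titer x (rcons (map (@dens R) (map (letter_value s) w)) (mellin_form theta_zero (value s (nth j0 v i)))))) => w _.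
  exact: decaying_jet_titer.
apply/funext => s; apply/funext => x; rewrite regintE; last by case: (v) v0.
rewrite size_map; apply: eq_bigr => i _; congr (_ * _).
rewrite (nth_map j0)// -map_take -map_drop -map_rev /shiter /shsum.
have -> : map inl (map (value s) (take i v)) = map (letter_value s) (map inl (take i v)).
  by rewrite -!map_comp.
have -> : map inr (map (value s) (rev (drop i.+1 v))) = map (letter_value s) (map inr (rev (drop i.+1 v))).
  by rewrite -!map_comp.
by rewrite shuffle_map big_map.
Qed.

End AtPoint.

Lemma differentiable_regint (v : seq symbol) s : differentiable (fun s => regint 1 (map (value s) v)) s.
Proof.
case: (eqVneq v [::]) => [->|v0]; first exact: differentiable_cst.
(* The expansion is taken on a half-line that contains 1 and stays away from 0. *)
have h2 : 0 < 2^-1 :> R by rewrite invr_gt0.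
have [_ [f1 [_ /(_ 0%N)[M HM]]]] := decaying_jet_regint s h2 v0.
apply: (@differentiable_jet R n _ s (f1 ^~ 1) M) => h h1.
have := HM h 1 h1; rewrite mul0r oppr0 expR0 mulr1; apply.
by rewrite invf_lt1// ltr1n.
Qed.

Definition dual_symbol (j : symbol) : symbol := (j.1, ~~ j.2).

Lemma value_dual s j : value s (dual_symbol j) = 1 - value s j.
Proof. by case: j => i []; rewrite /value //= opprB addrC subrK. Qed.

Lemma differentiable_xi_core (v : seq symbol) s :
  differentiable (fun s => xi_core (map (value s) v)) s.
Proof.
have E : (fun s => xi_core (map (value s) v)) =
    \sum_(i < (size v).+1) ((fun s => regint 1 (map (value s) (rev (map dual_symbol (take i v))))) *
       (fun s => regint 1 (map (value s) (drop i v)))).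
  apply/funext => s'; rewrite /xi_core convE size_map fct_sumE; apply: eq_bigr => i _.
  rewrite -map_take -map_drop /mirror; congr (regint 1 _ * _).
  by rewrite map_rev -!map_comp; congr rev; apply: eq_map => j /=; rewrite value_dual.
rewrite E; apply: differentiable_sum => i.
exact: (differentiableM (differentiable_regint _ s) (differentiable_regint _ s)).
Qed.

End EntireCore.

(** * Poles *)
Section Poles.
Variable R : realType.
Local Notation C := R[i].
Variable r : nat.
Local Notation V := 'rV[C]_r.
Implicit Types (s w : V).

Lemma differentiable_big_sum (I : Type) (l : seq I) (P : pred I) (F : I -> V -> C) s :
  (forall i, P i -> differentiable (F i) s) -> differentiable (fun s => \sum_(i <- l | P i) F i s) s.
Proof.
move=> H; elim: l => [|i l IH].
  by under eq_fun do rewrite big_nil; exact: differentiable_cst.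
rewrite (_ : (fun s => _) = fun s => if P i then F i s + \sum_(j <- l | P j) F j s
    else \sum_(j <- l | P j) F j s); last by apply/funext => s'; rewrite big_cons.
case: (P i) (H i) => [/(_ isT) Hi|_]; last exact: IH.
exact: (differentiableD Hi IH).
Qed.

Lemma differentiable_big_prod (I : Type) (l : seq I) (P : pred I) (F : I -> V -> C) s :
  (forall i, P i -> differentiable (F i) s) -> differentiable (fun s => \prod_(i <- l | P i) F i s) s.
Proof.
move=> H; elim: l => [|i l IH].
  by under eq_fun do rewrite big_nil; exact: differentiable_cst.
rewrite (_ : (fun s => _) = fun s => if P i then F i s * \prod_(j <- l | P j) F j s
    else \prod_(j <- l | P j) F j s); last by apply/funext => s'; rewrite big_cons.
case: (P i) (H i) => [/(_ isT) Hi|_]; last exact: IH.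
exact: (differentiableM Hi IH).
Qed.

Lemma differentiable_tail_form (k : 'I_r) s : differentiable (tail_form k) s.
Proof. by apply: differentiable_big_sum => i _; exact: differentiable_coord. Qed.

Lemma differentiable_head_form (k : 'I_r) s : differentiable (head_form k) s.
Proof.
apply: (@differentiableB _ _ _ (fun s => \sum_(j < r | (j <= k)%N) s ord0 j) (fun=> k.+1%:R)).
  by apply: differentiable_big_sum => i _; exact: differentiable_coord.
exact: differentiable_cst.
Qed.

Definition core_slice k m s : C := xi_core (drop k (take m (coords s))).

Lemma differentiable_core_slice k m s : differentiable (core_slice k m) s.
Proof.
have E : core_slice k m = fun s => xi_core (map (value s) (drop k (take m [seq (i, false) | i <- enum 'I_r]))).
  by apply/funext => s'; rewrite /core_slice map_drop map_take -map_comp.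
rewrite E; exact: differentiable_xi_core.
Qed.

(** The sum of [xi_expand] over the common denominator. *)
Definition numerator s : C := \sum_(m < r.+1) \sum_(k < m.+1)
  (\prod_(i < r | (k <= i)%N) head_form i s) * core_slice k m s *
  (\prod_(i < r | (i < m)%N) tail_form i s * \prod_(i < r | (m <= i)%N) -1).

Lemma differentiable_numerator s : differentiable numerator s.
Proof.
apply: differentiable_big_sum => m _; apply: differentiable_big_sum => k _.
apply: (@differentiableM _ _ (fun s => (\prod_(i < r | (k <= i)%N) head_form i s) * core_slice k m s)
  (fun s => \prod_(i < r | (i < m)%N) tail_form i s * \prod_(i < r | (m <= i)%N) -1)).
  apply: (@differentiableM _ _ (fun s => \prod_(i < r | (k <= i)%N) head_form i s) (core_slice k m)).
    by apply: differentiable_big_prod => i _; exact: differentiable_head_form.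
  exact: differentiable_core_slice.
apply: (@differentiableM _ _ (fun s => \prod_(i < r | (i < m)%N) tail_form i s) (fun=> _)).
  by apply: differentiable_big_prod => i _; exact: differentiable_tail_form.
exact: differentiable_cst.
Qed.

Lemma prod_polar_form s : \prod_l polar_form l s =
  (\prod_(i < r) head_form i s) * (\prod_(i < r) tail_form i s).
Proof. by rewrite big_sumType. Qed.

Lemma xi_numerator s : off_poles s -> xi s = numerator s / \prod_l polar_form l s.
Proof.
move=> Hs; rewrite xi_expand /numerator mulr_suml; apply: eq_bigr => m _.
rewrite mulr_suml; apply: eq_bigr => k _; rewrite prod_polar_form -/(core_slice k m s).
have split_prod (j : nat) (G : 'I_r -> C) : \prod_(i < r) G i =
    (\prod_(i < r | (i < j)%N) G i) * \prod_(i < r | (j <= i)%N) G i.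
  rewrite (bigID (fun i : 'I_r => (i < j)%N)) /=; congr (_ * _).
  by apply: eq_bigl => i; rewrite -leqNgt.
rewrite (split_prod k (fun i => head_form i s)) (split_prod m (fun i => tail_form i s)).
have h1 : \prod_(i < r | (i < k)%N) head_form i s != 0.
  by apply/prodf_neq0 => i _; exact: (Hs (inl i)).
have h2 : \prod_(i < r | (k <= i)%N) head_form i s != 0.
  by apply/prodf_neq0 => i _; exact: (Hs (inl i)).
have h3 : \prod_(i < r | (i < m)%N) tail_form i s != 0.
  by apply/prodf_neq0 => i _; exact: (Hs (inr i)).
have h4 : \prod_(i < r | (m <= i)%N) tail_form i s != 0.
  by apply/prodf_neq0 => i _; exact: (Hs (inr i)).
have -> : \prod_(i < r | (m <= i)%N) - (tail_form i s)^-1 =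
   (\prod_(i < r | (m <= i)%N) -1) * (\prod_(i < r | (m <= i)%N) tail_form i s)^-1.
  by rewrite -prodfV -big_split /=; apply: eq_bigr => i _; rewrite mulN1r.
rewrite prodfV; set sg := \prod_(_ < _ | _) -1.
move: h1 h2 h3 h4; set A := \prod_(_ < _ | _) _; set B := \prod_(_ < _ | _) _.
set D := \prod_(_ < _ | _) _; set E := \prod_(_ < _ | _) _.
by move=> A0 B0 D0 E0; field; rewrite A0 B0 D0 E0.
Qed.

Lemma head_one (k : 'I_r) : @head_form R r k (const_mx 1) = 0.
Proof.
rewrite /head_form; under eq_bigr do rewrite mxE.
by rewrite -(big_ord_widen_cond r xpredT (fun=> 1) (ltn_ord k)) sumr_const card_ord subrr.
Qed.

(** At [(1, ..., 1)] all the head forms vanish, so that only the term of the empty product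
   of head forms remains; it has no factor from [theta]. *)
Lemma numerator_one_neq0 : numerator (const_mx 1) != 0.
Proof.
have T (k : 'I_r) : @tail_form R r k (const_mx 1) != 0.
  rewrite /tail_form; under eq_bigr do rewrite mxE.
  by rewrite (bigD1 k)//= gt_eqF// ltr_pwDl// sumr_ge0.
have Z (k : nat) : (k < r)%N -> \prod_(i < r | (k <= i)%N) @head_form R r i (const_mx 1) = 0.
  by move=> kr; rewrite (bigD1 (Ordinal kr))//= head_one mul0r.
rewrite /numerator big_ord_recr /= big1 ?add0r => [|m _]; last first.
  by apply: big1 => k _; rewrite Z ?mul0r// (leq_ltn_trans _ (ltn_ord m))// -ltnS.
rewrite big_ord_recr /= big1 ?add0r => [|k _]; last by rewrite Z// !mul0r.
rewrite /core_slice drop_oversize ?size_take ?size_coords; last by case: ifP.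
rewrite /xi_core conv_nil /= !mul1r mulr1 !mulf_neq0//.
- by apply/prodf_neq0 => i; rewrite leqNgt ltn_ord.
- by apply/prodf_neq0 => i _; exact: T.
- by apply/prodf_neq0 => i; rewrite leqNgt ltn_ord.
Qed.

(** At 0 all the tail forms vanish, and only the term without tail forms remains. *)
Lemma numerator_zero_neq0 : numerator 0 != 0.
Proof.
have T (k : 'I_r) : tail_form k (0 : V) = 0.
  by rewrite /tail_form big1// => i _; rewrite mxE.
have H (k : 'I_r) : head_form k (0 : V) != 0.
  by rewrite /head_form big1 ?sub0r ?oppr_eq0 ?pnatr_eq0// => i _; rewrite mxE.
rewrite /numerator big_ord_recl /= [X in _ + X]big1 ?addr0 => [|m _]; last first.
  have mr : (0 < r)%N by case: (r) m => // -[].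
  apply: big1 => k _; rewrite [X in _ * (X * _)](bigD1 (Ordinal mr))//= T !mul0r mulr0//.
rewrite big_ord_recl big_ord0 addr0 /core_slice /= take0 /xi_core conv_nil /= !mulr1 !mulf_neq0//.
- by apply/prodf_neq0 => i _; exact: H.
- by apply/prodf_neq0.
- by apply/prodf_neq0 => i _; rewrite oppr_eq0 oner_eq0.
Qed.

Lemma xi_simple_poles : simple_poles_along (@polar_form R r) (@xi R r).
Proof.
exists numerator; split=> [s _|s Hs|[k|k]].
- exact: differentiable_numerator.
- exact: xi_numerator.
- exists (const_mx 1); [exact: head_one|exact: numerator_one_neq0].
- exists 0; last exact: numerator_zero_neq0.
  by rewrite /= /tail_form big1// => i _; rewrite mxE.
Qed.

End Poles.

(** * Meromorphy and residues *)
Section MeromorphicResidue.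
Variable R : realType.
Local Notation C := R[i].
Variable r : nat.
Local Notation V := 'rV[C]_r.
Implicit Types (s w : V).

Definition polar_slope (l : 'I_r + 'I_r) : C := match l with inl k => k.+1%:R | inr k => (r - k)%:R end.

Lemma polar_slope_neq0 l : polar_slope l != 0.
Proof. by case: l => k; rewrite pnatr_eq0// subn_eq0 -ltnNge. Qed.

Lemma polar_form_shift l s (e : C) :
  polar_form l (s + const_mx e) = polar_form l s + e * polar_slope l.
Proof.
have card_head (k : 'I_r) : \sum_(j < r | (j <= k)%N) e = e * k.+1%:R.
  by rewrite -(big_ord_widen_cond r xpredT (fun=> e) (ltn_ord k)) sumr_const card_ord mulr_natr.
have card_tail (k : 'I_r) : \sum_(j < r | (k <= j)%N) e = e * (r - k)%:R.
  rewrite -(big_mkord (fun j => k <= j)%N (fun=> e)).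
  transitivity (\sum_(k <= j < r) e); first by rewrite (@big_nat_widenl _ _ _ k 0).
  by rewrite sumr_const_nat mulr_natr.
case: l => k /=; rewrite /head_form /tail_form; under eq_bigr do rewrite !mxE; rewrite big_split /=.
  by rewrite card_head addrAC.
by rewrite card_tail.
Qed.

(** Along the diagonal direction every polar form has a nonzero slope, hence is nonzero
   at all points close enough to [s], except perhaps [s]. *)
Lemma polar_form_generic (U : set V) s : open U -> U s ->
  exists2 w, U w & \prod_l polar_form l w != 0.
Proof.
move=> oU Us.
have H1 : \forall e \near (0 : C)^', U (s + const_mx e).
  have /nbhs_ballP[eps eps0 HU] : nbhs s U by exact: open_nbhs_nbhs.
  apply: cvg_within; apply: filterS (@nbhs0_lt C C^o eps eps0) => e ee; apply: HU; split=> [//|i j].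
  by rewrite -ball_normE /ball_ /= !mxE opprD addrA subrr sub0r normrN.
have H2 : \forall e \near (0 : C)^', forall l, polar_form l (s + const_mx e) != 0.
  apply: filter_forall => l; under eq_near do rewrite polar_form_shift.
  case: (eqVneq (polar_form l s) 0) => [->|l0].
    near=> e; rewrite add0r mulf_neq0 ?polar_slope_neq0//; near: e; exact: nbhs_dnbhs_neq.
  apply: cvg_within; have : polar_form l s + e * polar_slope l @[e --> (0 : C)] --> polar_form l s.
    rewrite -[X in _ --> X]addr0 -[X in _ --> _ + X](mul0r (polar_slope l)).
    have FF : Filter (nbhs (0 : C)) by exact: nbhs_filter.
    apply: (cvgcD (FF := FF) (f := fun=> polar_form l s) (g := fun e => e * polar_slope l)).
      exact: (cvgc_cst (FF := FF)).
    by apply: (cvgcM (FF := FF)); [exact: cvg_id|exact: (cvgc_cst (FF := FF))].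
  by move=> /(@cvgr_neq0 C C^o) /(_ l0).
have PF : ProperFilter (0 : C)^' by exact: Proper_dnbhs_numFieldType.
have [e [Ue He]] := @filter_ex _ _ PF _ (filterI H1 H2).
by exists (s + const_mx e) => //; apply/prodf_neq0 => l _; exact: He.
Unshelve. all: by end_near. Qed.

Lemma differentiable_polar_form (l : 'I_r + 'I_r) s : differentiable (polar_form l) s.
Proof. by case: l => k; [exact: differentiable_head_form|exact: differentiable_tail_form]. Qed.

Lemma xi_meromorphic : meromorphic (@xi R r).
Proof.
move=> z; exists setT, (@numerator R r), (fun s => \prod_l polar_form l s); split.
- by split => //; exact: openT.
- by move=> s _; exact: differentiable_numerator.
- by move=> s _; apply: differentiable_big_prod => l _; exact: differentiable_polar_form.
- by move=> U oU _ [s Us]; exact: polar_form_generic oU Us.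
move=> s _ /prodf_neq0 Hs; apply: xi_numerator => l; exact: Hs.
Qed.

(** The part of [xi_expand] without poles along the tail hyperplanes. *)
Definition head_part m s : C := conv (fun v => tail_coef (mirror v)) (@xi_core R) (take m (coords s)).

Lemma head_partE m s : (m <= r)%N -> head_part m s =
  \sum_(k < m.+1) (\prod_(i < r | (i < k)%N) (head_form i s)^-1) * core_slice k m s.
Proof.
move=> mr; rewrite /head_part convE size_takel ?size_coords//; apply: eq_bigr => k _.
have km : (k <= m)%N by rewrite -ltnS.
by rewrite take_takel// tail_coef_mirror_take// (leq_trans km mr).
Qed.

Lemma xi_head_part s : xi s = \sum_(m < r.+1) head_part m s * \prod_(i < r | (m <= i)%N) - (tail_form i s)^-1.
Proof.
by rewrite /xi xi_word_core convE size_coords; apply: eq_bigr => m _; rewrite tail_coef_drop.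
Qed.

Lemma cvgcV (T : Type) (F : set_system T) {FF : Filter F} (f : T -> C) (l : C) : l != 0 ->
  f x @[x --> F] --> l -> (f x)^-1 @[x --> F] --> l^-1.
Proof. by move=> l0 fl; exact: cvgV. Qed.

Lemma cvg_bigprod (T I : Type) (F : set_system T) {FF : Filter F} (e : seq I) (P : pred I)
    (f : I -> T -> C) (l : I -> C) :
  (forall i, P i -> f i x @[x --> F] --> l i) ->
  \prod_(i <- e | P i) f i x @[x --> F] --> \prod_(i <- e | P i) l i.
Proof.
move=> H; elim: e => [|i e IH].
  by rewrite big_nil; under eq_fun do rewrite big_nil; exact: cvgc_cst.
rewrite big_cons (_ : (fun x => _) = fun x => if P i then f i x * \prod_(j <- e | P j) f j x
    else \prod_(j <- e | P j) f j x); last by apply/funext => x; rewrite big_cons.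
case: (P i) (H i) => [/(_ isT) Hi|_]; last exact: IH.
exact: (cvgcM (FF := FF) (f := f i) (g := fun x => \prod_(j <- e | P j) f j x) Hi IH).
Qed.

Lemma differentiable_cvg (f : V -> C) s : differentiable f s -> f w @[w --> nbhs s] --> f s.
Proof. by move=> /differentiable_continuous. Qed.

Section Residue.
Variables (k : 'I_r) (s : V).
Hypothesis tail0 : tail_form k s = 0.
Hypothesis other : forall l, l != inr k -> polar_form l s != 0.

Let head_neq0 i : head_form i s != 0. Proof. exact: (other (l := inl i)). Qed.

Let tail_neq0 i : i != k -> tail_form i s != 0.
Proof. by move=> ik; apply: (other (l := inr i)); apply: contra ik => /eqP[->]. Qed.

(** The product of the tail form of [k] with the factor of [head_part m] in
   [xi_head_part], in a form which is continuous across its zeros. *)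
Definition residue_term m w : C :=
  if (m <= k)%N then - \prod_(i < r | (m <= i)%N && (i != k)) - (tail_form i w)^-1
  else tail_form k w * \prod_(i < r | (m <= i)%N) - (tail_form i w)^-1.

Lemma residue_termE m w : tail_form k w != 0 ->
  tail_form k w * \prod_(i < r | (m <= i)%N) - (tail_form i w)^-1 = residue_term m w.
Proof.
move=> k0; rewrite /residue_term; case: ifP => // mk.
by rewrite (bigD1 k)//= mulrA mulrN divff// mulN1r.
Qed.

Lemma cvg_tail_form i : tail_form i w @[w --> nbhs s] --> tail_form i s.
Proof. exact: differentiable_cvg (differentiable_tail_form i s). Qed.

Lemma cvg_residue_term m : residue_term m w @[w --> nbhs s] --> residue_term m s.
Proof.
have FF : Filter (nbhs s) by exact: nbhs_filter.
have N (f : V -> C) l : f w @[w --> nbhs s] --> l -> - f w @[w --> nbhs s] --> - l.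
  by move=> fl; rewrite -[- l]sub0r; under eq_fun do rewrite -sub0r; apply: (cvgcB (FF := FF)) fl; exact: (cvgc_cst (FF := FF)).
have T i : i != k -> - (tail_form i w)^-1 @[w --> nbhs s] --> - (tail_form i s)^-1.
  by move=> ik; apply: N; apply: (cvgcV (FF := FF)); [exact: tail_neq0|exact: cvg_tail_form].
rewrite /residue_term; case: ifP => mk.
  by apply: N; apply: (cvg_bigprod (FF := FF)) => i /andP[_]; exact: T.
apply: (cvgcM (FF := FF)); first exact: cvg_tail_form.
apply: (cvg_bigprod (FF := FF)) => i mi; apply: T.
by apply/eqP => ik; rewrite -ik mi in mk.
Qed.

Lemma cvg_head_part m : (m <= r)%N -> head_part m w @[w --> nbhs s] --> head_part m s.
Proof.
have FF : Filter (nbhs s) by exact: nbhs_filter.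
move=> mr; rewrite head_partE//; under eq_fun do rewrite head_partE//.
apply: (cvg_bigsum (FF := FF)) => j; apply: (cvgcM (FF := FF)).
  apply: (cvg_bigprod (FF := FF)) => i _; apply: (cvgcV (FF := FF)) => //.
  exact: differentiable_cvg (differentiable_head_form i s).
exact: differentiable_cvg (differentiable_core_slice j m s).
Qed.

Lemma xi_residue_limit : residue_at (tail_form k) (@xi R r) s
  (\sum_(m < r.+1) head_part m s * residue_term m s).
Proof.
have FF : Filter (nbhs s) by exact: nbhs_filter.
have L : \sum_(m < r.+1) head_part m w * residue_term m w @[w --> nbhs s] -->
    \sum_(m < r.+1) head_part m s * residue_term m s.
  apply: (cvg_bigsum (FF := FF)) => m; apply: (cvgcM (FF := FF)); last exact: cvg_residue_term.
  by apply: cvg_head_part; rewrite -ltnS.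
have L' : (\sum_(m < r.+1) head_part m w * residue_term m w)
    @[w --> within [set w | tail_form k w != 0] (nbhs s)] -->
    \sum_(m < r.+1) head_part m s * residue_term m s by exact: cvg_within_filter L.
rewrite /residue_at; apply: cvg_trans L'; apply: near_eq_cvg; near=> w.
have w0 : tail_form k w != 0 by near: w; exact: withinT.
rewrite xi_head_part mulr_sumr; apply: eq_bigr => m _.
by rewrite mulrCA residue_termE.
Unshelve. all: by end_near. Qed.

(** On the hyperplane, with indices from 0, the sums [s_i + ... + s_(r-1)] and
   [s_i + ... + s_(k-1)] agree for [i < k], hence the surviving terms are those of the expansion of xi in the first
   variables. *)
Lemma residue_value : \sum_(m < r.+1) head_part m s * residue_term m s =
  (-1) ^+ (r - k) * xi (\row_(j < k) s ord0 (widen_ord (ltnW (ltn_ord k)) j))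
               / \prod_(j < r | (k < j)%N) tail_form j s.
Proof.
have kr := ltnW (ltn_ord k).
set s' := \row_(j < k) _.
have Es' : coords s' = take k (coords s).
  apply: (@eq_from_nth _ 0); first by rewrite size_takel !size_coords.
  rewrite size_coords => i ik; rewrite nth_take//.
  rewrite (nth_coords s' (Ordinal ik)) mxE.
  exact: esym (nth_coords s (widen_ord (ltnW (ltn_ord k)) (Ordinal ik))).
have tail_eq i : (i <= k)%N -> csum (drop i (coords s')) = csum (drop i (coords s)).
  move=> ik; rewrite Es' -[in RHS](cat_take_drop k (coords s)) drop_cat.
  rewrite size_takel ?size_coords//; case: ltngtP ik => // [ik _|-> _].
    by rewrite csum_cat csum_drop_coords -/(tail_form k s) tail0 addr0.
  by rewrite subnn drop0 drop_oversize ?size_takel ?size_coords// csum_nil csum_drop_coords -/(tail_form k s) tail0.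
have T m : (m <= k)%N -> residue_term m s = (- \prod_(i < r | (k < i)%N) - (tail_form i s)^-1) *
     tail_coef (drop m (coords s')).
  move=> mk; rewrite /residue_term mk mulNr mulrC; congr (- _).
  rewrite (bigID (fun i : 'I_r => (i < k)%N)) /=; congr (_ * _); last first.
    apply: eq_bigl => i; rewrite -leqNgt; case: (ltngtP k i) => // ki; rewrite ?andbF// ?andbT.
      by rewrite (leq_trans mk (ltnW ki)) andTb; apply/eqP => E; rewrite E ltnn in ki.
    by rewrite (_ : i = k) ?eqxx ?andbF//; exact: val_inj.
  rewrite tail_coef_drop.
  transitivity (\prod_(i < k | (m <= i)%N) - (csum (drop i (coords s)))^-1); last first.
    by apply: eq_bigr => i _; rewrite /tail_form -csum_drop_coords tail_eq// ltnW.
  rewrite (big_ord_widen_cond r (fun i => m <= i)%N (fun i => - (csum (drop i (coords s)))^-1) kr).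
  apply: eq_big => [i|i _]; last by rewrite csum_drop_coords.
  by case: (ltnP i k) => ik; rewrite ?andbF// !andbT; case: (eqVneq i k) ik => [->|]; rewrite ?ltnn// andbT.
have S : - \prod_(i < r | (k < i)%N) - (tail_form i s)^-1 =
    (-1) ^+ (r - k) / \prod_(j < r | (k < j)%N) tail_form j s.
  have -> : \prod_(i < r | (k < i)%N) - (tail_form i s)^-1 =
     (\prod_(i < r | (k < i)%N) -1) * (\prod_(i < r | (k < i)%N) tail_form i s)^-1.
    by rewrite -prodfV -big_split /=; apply: eq_bigr => i _; rewrite mulN1r.
  rewrite -(big_mkord (fun j => k < j)%N (fun=> -1)).
  have -> : \prod_(0 <= i < r | (k < i)%N) (-1) = \prod_(k.+1 <= i < r) (-1 : C).
    by rewrite [RHS](@big_nat_widenl _ _ _ k.+1 0).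
  by rewrite prodr_const_nat -mulNr -mulN1r -exprS subnSK.
have -> : \sum_(m < r.+1) head_part m s * residue_term m s = \sum_(m < k.+1) head_part m s * residue_term m s.
  have kr1 : (k.+1 <= r.+1)%N by rewrite ltnS.
  rewrite [RHS](big_ord_widen_cond r.+1 xpredT (fun m => head_part m s * residue_term m s) kr1).
  rewrite [RHS]big_mkcond /=; apply: eq_bigr => m _; case: ifP => //; rewrite ltnS => mk.
  by rewrite /residue_term mk tail0 mul0r mulr0.
rewrite /xi xi_word_core convE size_coords mulrAC -S mulr_sumr; apply: eq_bigr => m _.
have mk : (m <= k)%N by rewrite -ltnS.
by rewrite T// mulrCA; congr (_ * (_ * _)); rewrite Es' take_takel.
Qed.

End Residue.
End MeromorphicResidue.

(** * Shuffle products of xi on words *)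
Section ShuffleMembership.
Variable T : eqType.
Implicit Types u v w : seq T.

Lemma mem_shuffle_consl a u v w : w \in shuffle u v -> a :: w \in shuffle (a :: u) v.
Proof.
case: v => [|b v]; first by rewrite !shuffles0 !inE => /eqP ->.
by move=> wuv; rewrite shuffle_cons mem_cat map_f.
Qed.

Lemma mem_shuffle_consr b u v w : w \in shuffle u v -> b :: w \in shuffle u (b :: v).
Proof.
case: u => [|a u]; first by rewrite !shuffle0s !inE => /eqP ->.
by move=> wuv; rewrite shuffle_cons mem_cat orbC map_f.
Qed.

Lemma mem_shuffle_ind (P : seq T -> seq T -> seq T -> Prop) :
  P [::] [::] [::] ->
  (forall a u v w, P u v w -> P (a :: u) v (a :: w)) ->
  (forall b u v w, P u v w -> P u (b :: v) (b :: w)) ->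
  forall u v w, w \in shuffle u v -> P u v w.
Proof.
move=> P0 Pl Pr u v w; have [n] := ubnP (size u + size v).
elim: n u v w => // n IH [|a u] [|b v] w le_n.
- by rewrite inE => /eqP ->.
- by rewrite inE => /eqP ->; apply: (Pr); apply: IH; rewrite ?shuffle0s ?mem_seq1.
- by rewrite inE => /eqP ->; apply: (Pl); apply: IH; rewrite ?shuffles0 ?mem_seq1// addn0 in le_n *.
rewrite shuffle_cons mem_cat => /orP[] /mapP[w' w'uv ->].
  by apply: Pl; apply: IH.
by apply: Pr; apply: IH => //; move: le_n; rewrite /= addnS.
Qed.

Lemma mem_shuffle_cat u1 v1 w1 u2 v2 w2 : w1 \in shuffle u1 v1 -> w2 \in shuffle u2 v2 ->
  w1 ++ w2 \in shuffle (u1 ++ u2) (v1 ++ v2).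
Proof.
move=> + w2uv; move: u1 v1 w1; apply: mem_shuffle_ind => //= a u v w.
  exact: mem_shuffle_consl.
exact: mem_shuffle_consr.
Qed.

Lemma cat_shuffle u v : u ++ v \in shuffle u v.
Proof.
rewrite -[in shuffle _ _](cats0 u) -[v in shuffle _ v]cat0s.
by apply: mem_shuffle_cat; rewrite ?shuffles0 ?shuffle0s mem_seq1.
Qed.

Lemma mem_shuffle_rev u v w : w \in shuffle u v -> rev w \in shuffle (rev u) (rev v).
Proof.
move: u v w; apply: mem_shuffle_ind => // a u v w H; rewrite !rev_cons -!cats1.
  by rewrite -[rev v]cats0; apply: mem_shuffle_cat => //; rewrite mem_seq1.
by rewrite -[rev u]cats0; apply: mem_shuffle_cat => //; rewrite mem_seq1.
Qed.

(** The relation [r] compares the letters of [u] and those of [v] separately, and puts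
   no condition on a letter of [u] and one of [v]. As [r] is strict on each block, the
   first letter of [w] can only be the first letter of [u] or of [v]. *)
Lemma mem_shuffle_pairwise (r : rel T) u v w :
  {in u & v, forall x y, r x y && r y x} ->
  {in u &, forall x y, ~~ (r x y && r y x)} -> {in v &, forall x y, ~~ (r x y && r y x)} ->
  pairwise r u -> pairwise r v ->
  (w \in shuffle u v) = perm_eq w (u ++ v) && pairwise r w.
Proof.
move=> uv uu vv ru rv; apply/idP/andP => [wuv|[]].
  split; first exact: mem_shuffle wuv.
  suff : perm_eq w (u ++ v) /\ ({in u & v, forall x y, r x y && r y x} -> pairwise r u ->
     pairwise r v -> pairwise r w) by case=> _; apply.
  clear uu vv uv ru rv; move: u v w wuv; apply: mem_shuffle_ind => // a u v w [p H].
    split; first by rewrite /= perm_cons.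
    move=> uv; rewrite /= => /andP[/allP au ru] rv; rewrite H ?andbT//; last first.
      by move=> x y xu yv; apply: uv; rewrite // in_cons xu orbT.
    apply/allP => x; rewrite (perm_mem p) mem_cat => /orP[/au//|xv].
    by have /andP[] := uv a x (mem_head _ _) xv.
  split; first by rewrite perm_sym perm_catC /= perm_cons perm_catC perm_sym.
  move=> uv ru; rewrite /= => /andP[/allP au rv]; rewrite H ?andbT//; last first.
    by move=> x y xu yv; apply: uv; rewrite // in_cons yv orbT.
  apply/allP => x; rewrite (perm_mem p) mem_cat => /orP[xu|/au//].
  by have /andP[] := uv x a xu (mem_head _ _).
have first_eq (t : seq T) a x (w' : seq T) : {in a :: t &, forall x y, ~~ (r x y && r y x)} ->
    pairwise r (a :: t) -> all (r x) w' -> a \in x :: w' -> x \in a :: t -> x = a.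
  move=> tt /= /andP[/allP at_ _] /allP xw; rewrite !in_cons => /predU1P[->//|aw] /predU1P[//|xt].
  by have := tt x a; rewrite !in_cons xt eqxx orbT => /(_ isT isT); rewrite xw ?at_.
elim: w u v uv uu vv ru rv => [|x w IH] u v uv uu vv ru rv p rw.
  by have := perm_size p; rewrite size_cat; case: u v {uv uu vv ru rv p} => [|? ?] [|? ?].
have xuv : x \in u ++ v by rewrite -(perm_mem p) mem_head.
have [xw {}rw] : all (r x) w /\ pairwise r w by move: rw => /= /andP[].
move: xuv; rewrite mem_cat => /orP[xu|xv].
  case: u xu uv uu ru p => // a u xu uv uu ru p.
  have xa : x = a.
    by apply: (first_eq u a x w) => //; rewrite (perm_mem p) mem_cat mem_head.
  rewrite xa; apply: mem_shuffle_consl; apply: IH => //.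
  - by move=> y z yu zv; apply: uv; rewrite // in_cons yu orbT.
  - by move=> y z yu zu; apply: uu; rewrite in_cons ?yu ?zu orbT.
  - by move: ru => /= /andP[].
  - by move: p; rewrite xa /= perm_cons.
case: v xv uv vv rv p => // a v xv uv vv rv p.
have xa : x = a.
  by apply: (first_eq v a x w) => //; rewrite (perm_mem p) mem_cat mem_head orbT.
rewrite xa; apply: mem_shuffle_consr; apply: IH => //.
- by move=> y z yu zv; apply: uv; rewrite // in_cons zv orbT.
- by move=> y z yu zu; apply: vv; rewrite in_cons ?yu ?zu orbT.
- by move: rv => /= /andP[].
- by move: p; rewrite xa perm_sym perm_catC /= perm_cons perm_catC perm_sym.
Qed.

Lemma uniq_shuffle u v : uniq (u ++ v) -> uniq (shuffle u v).
Proof.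
have [n] := ubnP (size u + size v); elim: n u v => // n IH [|a u] [|b v] // le_n Huv.
rewrite shuffle_cons cat_uniq !map_inj_uniq; [|by move=> ? ? []..].
have ab : a != b.
  by apply/eqP => E; move: Huv; rewrite E /= mem_cat mem_head orbT.
rewrite !IH ?andbT; last 4 first.
- by move: le_n; rewrite /= addnS.
- by apply: subseq_uniq Huv; apply: cat_subseq => //; exact: subseq_cons.
- by move: le_n.
- by case/andP: Huv.
apply/hasPn => w /mapP[w' _ ->]; apply/negP => /mapP[w'' _ [E _]].
by rewrite E eqxx in ab.
Qed.

End ShuffleMembership.

Lemma mem_shuffle_map (T U : eqType) (f : T -> U) u v w :
  w \in shuffle u v -> map f w \in shuffle (map f u) (map f v).
Proof. by move=> wuv; rewrite shuffle_map map_f. Qed.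

Section TailShuffle.
Variable R : realType.
Local Notation C := R[i].
Implicit Types u v w : seq C.

Lemma perm_csum u v : perm_eq u v -> csum u = csum v.
Proof. by move=> uv; exact: perm_big. Qed.

(** With [a] and [b] the sums of the two words, this is the identity
   [1 / (a b) = (1 / a + 1 / b) / (a + b)], applied to the first letters. *)
Lemma tail_coef_shmul u v : (forall w, w \in shuffle u v -> tails_neq0 w) ->
  tails_neq0 u -> tails_neq0 v -> shmul (@tail_coef R) u v.
Proof.
have [n] := ubnP (size u + size v); elim: n u v => // n IH [|a u] [|b v] le_n H.
- by move=> _ _; exact: shmul0s.
- by move=> _ _; exact: shmul0s.
- by move=> _ _; exact: shmuls0.
move=> /= /andP[u0 tu] /andP[v0 tv].
have IHu : shmul (@tail_coef R) u (b :: v).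
  apply: IH => //; last by rewrite /= v0.
  by move=> w /(mem_shuffle_consl a)/H/andP[].
have IHv : shmul (@tail_coef R) (a :: u) v.
  apply: IH => //; [by move: le_n; rewrite /= addnS| |by rewrite /= u0].
  by move=> w /(mem_shuffle_consr b)/H/andP[].
pose S := csum (a :: u) + csum (b :: v).
have S0 : S != 0 by have /andP[] := H _ (cat_shuffle (a :: u) (b :: v)); rewrite /S -csum_cat.
rewrite /shmul shsum_cons.
have -> : shsum (fun w => tail_coef (a :: w)) u (b :: v) = - S^-1 * (tail_coef u * tail_coef (b :: v)).
  rewrite IHu /shsum mulr_sumr big_seq [RHS]big_seq; apply: eq_bigr => w wuv.
  by rewrite -[LHS]/(- (csum (a :: w))^-1 * tail_coef w) (perm_csum (mem_shuffle (mem_shuffle_consl a wuv))) csum_cat.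
have -> : shsum (fun w => tail_coef (b :: w)) (a :: u) v = - S^-1 * (tail_coef (a :: u) * tail_coef v).
  rewrite IHv /shsum mulr_sumr big_seq [RHS]big_seq; apply: eq_bigr => w wuv.
  by rewrite -[LHS]/(- (csum (b :: w))^-1 * tail_coef w) (perm_csum (mem_shuffle (mem_shuffle_consr b wuv))) csum_cat.
rewrite -[tail_coef (a :: u)]/(- (csum (a :: u))^-1 * tail_coef u) -[tail_coef (b :: v)]/(- (csum (b :: v))^-1 * tail_coef v).
move: S0 u0 v0; rewrite /S; move: (csum (a :: u)) (csum (b :: v)) => x y S0 x0 y0.
by field; rewrite S0 x0 y0.
Qed.

Lemma tails_neq0_catr u v : tails_neq0 (u ++ v) -> tails_neq0 v.
Proof. by move/(tails_neq0_drop (size u)); rewrite drop_size_cat. Qed.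

(** The point [u] is off the poles of xi: the suffixes of [mirror u] are the reflected
   prefixes of [u]. *)
Definition regular u : bool := tails_neq0 u && tails_neq0 (mirror u).

Lemma mirror_cat u v : mirror (u ++ v) = mirror v ++ mirror u.
Proof. by rewrite /mirror map_cat rev_cat. Qed.

Lemma mem_shuffle_mirror u v w : w \in shuffle u v -> mirror w \in shuffle (mirror u) (mirror v).
Proof. by move=> wuv; apply: mem_shuffle_rev; exact: mem_shuffle_map. Qed.

Lemma shmul_mirror (A : seq C -> C) u v :
  shmul A (mirror u) (mirror v) -> shmul (fun w => A (mirror w)) u v.
Proof. by rewrite /shmul /mirror shsum_rev /shsum shuffle_map big_map. Qed.

(** The three factors of [xi_word_core] are multiplicative. For the rational ones, a
   shuffle of pieces of [u] and [v] extends to a shuffle of [u] and [v], from which it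
   inherits its nonzero denominators. *)
Lemma xi_word_shmul u v : regular u -> regular v ->
  (forall w, w \in shuffle u v -> regular w) -> shmul (@xi_word R) u v.
Proof.
move=> /andP[u1 u2] /andP[v1 v2] H.
have regint_mul x y : shmul (@regint R 1) x y.
  have h : 2^-1 < 1 :> R by rewrite invf_lt1// ltr1n.
  by apply: (@regint_shmul R 2^-1) => // z _; rewrite /admissible invr_gt0 ltr0n.
have core_mul x y : shmul (@xi_core R) x y.
  change (shmul (conv (fun w => regint 1 (mirror w)) (@regint R 1)) x y).
  by apply: shmul_conv => i j //; exact: shmul_mirror.
rewrite /shmul xi_word_core xi_word_core.
rewrite (@eq_shsum _ _ _ (conv (conv (fun w => tail_coef (mirror w)) (@xi_core R)) (@tail_coef R)) u v (@xi_word_core R)).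
apply: shmul_conv => i j; last first.
  apply: tail_coef_shmul; [|exact: tails_neq0_drop..] => w wd.
  have := mem_shuffle_cat (cat_shuffle (take i u) (take j v)) wd.
  by rewrite !cat_take_drop => /H/andP[/tails_neq0_catr].
apply: shmul_conv => k l //.
have wt : forall w, w \in shuffle (take k (take i u)) (take l (take j v)) -> tails_neq0 (mirror w).
  move=> w wt; have := mem_shuffle_cat (mem_shuffle_cat wt (cat_shuffle (drop k (take i u)) (drop l (take j v))))
     (cat_shuffle (drop i u) (drop j v)).
  by rewrite !cat_take_drop => /H/andP[_]; rewrite !mirror_cat => /tails_neq0_catr/tails_neq0_catr.
have tk (x : seq C) m n : tails_neq0 (mirror x) -> tails_neq0 (mirror (take m (take n x))).
  move=> H'; have : tails_neq0 (mirror ((take m (take n x) ++ drop m (take n x)) ++ drop n x)).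
    by rewrite !cat_take_drop.
  by rewrite !mirror_cat => /tails_neq0_catr/tails_neq0_catr.
apply: shmul_mirror; apply: tail_coef_shmul; [move=> w|exact: tk|exact: tk].
by move=> /mem_shuffle_mirror; rewrite !mirrorK => /wt; rewrite mirrorK.
Qed.

End TailShuffle.

(** * Shuffles as permutations *)
Section ShufflePermutations.
Variables p q : nat.
Local Notation n := (p + q)%N.
Local Notation lefts := [seq lshift q i | i <- enum 'I_p].
Local Notation rights := [seq rshift p i | i <- enum 'I_q].

(** The comparison that occurs in the definition of [shuffle_perms]. *)
Definition block_lt : rel 'I_n := fun x y => ((x < p)%N == (y < p)%N) ==> (x < y)%N.

Lemma perm_lefts_rights : perm_eq (lefts ++ rights) (enum 'I_n).
Proof.
apply: uniq_perm; rewrite ?enum_uniq//.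
  rewrite cat_uniq (map_inj_uniq (@lshift_inj p q)) (map_inj_uniq (@rshift_inj p q)).
  rewrite !enum_uniq andbT /=.
  by apply/hasPn => _ /mapP[j _ ->]; apply/negP => /mapP[i _ /eqP]; rewrite eq_rlshift.
move=> i; rewrite mem_enum mem_cat; case: (split_ordP i) => j ->.
  by rewrite map_f ?mem_enum.
by rewrite orbC map_f ?mem_enum.
Qed.

Lemma pairwise_ltn_enum m : pairwise (fun i j : 'I_m => (i < j)%N) (enum 'I_m).
Proof.
have := iota_ltn_sorted 0 m; rewrite -val_enum_ord sorted_pairwise; last exact: ltn_trans.
by rewrite pairwise_map.
Qed.

Lemma mem_shuffle_blocks (w : seq 'I_n) :
  (w \in shuffle lefts rights) = perm_eq w (enum 'I_n) && pairwise block_lt w.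
Proof.
rewrite -(permPr perm_lefts_rights); apply: mem_shuffle_pairwise.
- move=> _ _ /mapP[i _ ->] /mapP[j _ ->]; rewrite /block_lt /= ltn_ord.
  by rewrite ltnNge leq_addr.
- move=> _ _ /mapP[i _ ->] /mapP[j _ ->]; rewrite /block_lt /= !ltn_ord /=.
  by case: ltngtP.
- move=> _ _ /mapP[i _ ->] /mapP[j _ ->]; rewrite /block_lt /= !ltnNge !leq_addr /= -!ltnNge.
  by case: ltngtP.
- rewrite pairwise_map; apply: sub_pairwise (pairwise_ltn_enum p) => i j ij.
  by rewrite /block_lt /= ij implybT.
- rewrite pairwise_map; apply: sub_pairwise (pairwise_ltn_enum q) => i j ij.
  by rewrite /block_lt /= ltn_add2l ij implybT.
Qed.

Definition perm_word (sigma : 'S_n) : seq 'I_n := [seq sigma i | i <- enum 'I_n].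

Lemma perm_word_inj : injective perm_word.
Proof.
move=> s t /eq_in_map st; apply/permP => i; apply: st; exact: mem_enum.
Qed.

Lemma mem_shuffle_perms sigma : (sigma \in shuffle_perms p q) = pairwise block_lt (perm_word sigma).
Proof.
rewrite inE pairwise_map; apply/forallP/idP => [H|H i].
  apply: sub_pairwise (pairwise_ltn_enum n) => i j ij.
  by have /forallP/(_ j) := H i; rewrite ij.
apply/forallP => j; apply/implyP => /andP[ij sij].
have /(_ i j) := elimT (@pairwiseP _ _ i (enum 'I_n)) H; rewrite !inE size_enum_ord !ltn_ord !nth_ord_enum.
by move=> /(_ isT isT ij); rewrite /= /block_lt sij.
Qed.

Lemma perm_eq_perm_word (w : seq 'I_n) : perm_eq w (enum 'I_n) -> exists sigma, w = perm_word sigma.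
Proof.
move=> pw.
have sz : size w = n by rewrite (perm_size pw) size_enum_ord.
have uw : uniq w by rewrite (perm_uniq pw) enum_uniq.
have inj : injective (fun i : 'I_n => nth i w i).
  move=> i j; rewrite (set_nth_default j) ?sz// => /eqP.
  by rewrite nth_uniq ?sz// => /eqP/val_inj.
exists (perm inj); case: w sz {pw uw} inj => [|x w] sz inj.
  by rewrite /perm_word; apply/esym/size0nil; rewrite size_map size_enum_ord.
apply: (@eq_from_nth _ x) => [|i]; rewrite sz; first by rewrite size_map size_enum_ord.
move=> iN; rewrite (nth_map (Ordinal iN)) ?size_enum_ord// permE /=.
have -> : nth (Ordinal iN) (enum 'I_n) i = Ordinal iN.
  by apply: val_inj; rewrite /= nth_enum_ord.
by apply: set_nth_default; rewrite sz.
Qed.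

(** Both sides are the arrangements of ['I_(p + q)] in which each block is increasing. *)
Lemma perm_shuffle_perms :
  perm_eq [seq perm_word sigma | sigma <- enum (shuffle_perms p q)] (shuffle lefts rights).
Proof.
apply: uniq_perm.
- by rewrite map_inj_uniq ?enum_uniq//; exact: perm_word_inj.
- by apply: uniq_shuffle; rewrite (perm_uniq perm_lefts_rights) enum_uniq.
move=> w; rewrite mem_shuffle_blocks; apply/mapP/andP => [[sigma]|[pw rw]].
  rewrite mem_enum mem_shuffle_perms => rw ->; split => //.
  apply: uniq_perm; rewrite ?enum_uniq//; first by rewrite map_inj_uniq ?enum_uniq//; exact: perm_inj.
  move=> i; rewrite mem_enum; apply/mapP; exists (sigma^-1%g i); first exact: mem_enum.
  by rewrite permKV.
have [sigma E] := perm_eq_perm_word pw; exists sigma => //.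
by rewrite mem_enum mem_shuffle_perms -E.
Qed.

End ShufflePermutations.

Section XiShuffle.
Variable R : realType.
Local Notation C := R[i].

Lemma tails_neq0_drops (u : seq C) :
  (forall i, (i < size u)%N -> csum (drop i u) != 0) -> tails_neq0 u.
Proof.
elim: u => //= z u IH H; rewrite (H 0%N)//=; apply: IH => i iu; exact: (H i.+1).
Qed.

Lemma off_poles_regular r (s : 'rV[C]_r) : off_poles s -> regular (coords s).
Proof.
move=> Hs; apply/andP; split; apply: tails_neq0_drops => i.
  by rewrite size_coords => ir; rewrite csum_drop_coords; exact: (Hs (inr (Ordinal ir))).
rewrite size_rev size_map size_coords => ir.
have jr : ((r - i).-1 < r)%N by lia.
have E : (r - i)%N = ((r - i).-1).+1 by lia.
rewrite /mirror drop_rev size_map size_coords -map_take -/(mirror _) csum_mirror.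
rewrite size_takel ?size_coords ?leq_subr// E csum_take_coords -oppr_eq0 opprB.
exact: (Hs (inl (Ordinal jr))).
Qed.

Lemma coords_col_perm r (sigma : 'S_r) (s : 'rV[C]_r) :
  coords (col_perm sigma s) = [seq s ord0 i | i <- [seq sigma i | i <- enum 'I_r]].
Proof. by rewrite -map_comp; apply: eq_map => i; rewrite /= mxE. Qed.

Lemma xi_shuffle p q (s : 'rV[C]_(p + q)) :
  off_poles (lsubmx s) -> off_poles (rsubmx s) ->
  (forall sigma, sigma \in shuffle_perms p q -> off_poles (col_perm sigma s)) ->
  xi (lsubmx s) * xi (rsubmx s) = \sum_(sigma in shuffle_perms p q) xi (col_perm sigma s).
Proof.
move=> Hl Hr Hsh.
have El : coords (lsubmx s) = [seq s ord0 i | i <- [seq lshift q i | i <- enum 'I_p]].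
  by rewrite -map_comp; apply: eq_map => i; rewrite /= mxE.
have Er : coords (rsubmx s) = [seq s ord0 i | i <- [seq rshift p i | i <- enum 'I_q]].
  by rewrite -map_comp; apply: eq_map => i; rewrite /= mxE.
have Esh : shuffle (coords (lsubmx s)) (coords (rsubmx s)) =
    map (map (s ord0)) (shuffle [seq lshift q i | i <- enum 'I_p] [seq rshift p i | i <- enum 'I_q]).
  by rewrite El Er shuffle_map.
have H : forall w, w \in shuffle (coords (lsubmx s)) (coords (rsubmx s)) -> regular w.
  rewrite Esh => _ /mapP[v + ->]; rewrite -(perm_mem (perm_shuffle_perms p q)) => /mapP[sigma].
  rewrite mem_enum => /Hsh/off_poles_regular + ->; by rewrite coords_col_perm.
have := xi_word_shmul (off_poles_regular Hl) (off_poles_regular Hr) H.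
rewrite /shmul /shsum Esh big_map -(perm_big _ (perm_shuffle_perms p q)) /= big_map big_enum /=.
by rewrite /xi => ->; apply: eq_bigr => sigma _; rewrite coords_col_perm.
Qed.

End XiShuffle.

Theorem theorem1p1 (R : realType) :
  exists xi : forall r : nat, 'rV[R[i]]_r -> R[i],
    (forall s : 'rV[R[i]]_0, xi 0%N s = 1) /\
    (forall r : nat, (1 <= r)%N ->
      [/\ exists c : R, forall s : 'rV[R[i]]_r,
            (forall i, c < complex.Re (s ord0 i)) ->
            iint_cvg (regularisation s) /\ xi r s = iint (regularisation s),
          meromorphic (xi r),
          forall s : 'rV[R[i]]_r, off_poles s ->
            xi r s = xi r (\row_(i < r) (1 - s ord0 (rev_ord i))),
          simple_poles_along (@polar_form R r) (xi r)
        & forall (k : 'I_r) (s : 'rV[R[i]]_r),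
            tail_form k s = 0 ->
            (forall l, l != inr k -> polar_form l s != 0) ->
            residue_at (tail_form k) (xi r) s
              ((-1) ^+ (r - k)
               * xi k (\row_(j < k) s ord0 (widen_ord (ltnW (ltn_ord k)) j))
               / \prod_(j < r | (k < j)%N) tail_form j s)]) /\
    (forall p q : nat, (1 <= p)%N -> (1 <= q)%N ->
      forall s : 'rV[R[i]]_(p + q),
        off_poles (lsubmx s) -> off_poles (rsubmx s) ->
        (forall sigma, sigma \in shuffle_perms p q ->
           off_poles (col_perm sigma s)) ->
        xi p (lsubmx s) * xi q (rsubmx s) =
        \sum_(sigma in shuffle_perms p q) xi (p + q)%N (col_perm sigma s)).
Proof.
exists (@xi R); split; first exact: xi_row0.
split=> [r r0|p q _ _ s]; last exact: xi_shuffle.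
split.
(* Near 0, [theta t] grows like [1 / t]: from real part 2 on, all forms are bounded. *)
- exists 2 => s Hs.
  have Hs2 i : 2 <= complex.Re (s ord0 i) by exact: ltW.
  have [c1 c2] := regularisation_integral r0 Hs2; split => //.
  rewrite c2 /xi /xi_word regint0E// => z /mem_coords[i ->]; exact: Hs2.
- exact: xi_meromorphic.
- by move=> s _; exact: xi_functional.
- exact: xi_simple_poles.
move=> k s tail0 other; rewrite -residue_value//; exact: xi_residue_limit.
Qed.
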